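(* Let $0<\theta<\frac12$, let $u$ be the weak solution of $-\Delta u=\sum_{j=1}^N\alpha_j\delta_{x_j}$ in $\Omega$, $u=0$ on $\partial\Omega$, and let $U\in\mathbb{V}_{\mathcal T}$ be its Galerkin approximation associated with the conforming triangulation $\mathcal T$ of $\Omega$. For any triangle $T\in\mathcal T$ we have the local bound \[ \eta_{T,\theta}\le C_L\,|u-U|_{1-\theta,\omega_T}, \] where $\omega_T$ is the patch (union) of all triangles of $\mathcal T$ sharing a side with $T$ ($T$ itself included). Furthermore, we have the global bound \[ \eta_\theta\le\tilde C_L\,|u-U|_{1-\theta,\Omega}. \] Both constants $C_L$, $\tilde C_L$ depend only on $\theta$, the polynomial degree $\ell$, the shape coefficient $\sigma_{\mathcal T}$ and the number $N$ of point sources.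
   Context: Domain and Sobolev spaces. $\Omega\subset\mathbb{R}^2$ is a (bounded, connected, open) polygonal, not necessarily convex, domain with Lipschitz boundary. For a bounded open $G\subset\mathbb{R}^d$ (or the closure of such a set with null boundary) and $s=n+t$ with $n\in\mathbb{N}_0$, $0<t<1$, set $|\phi|_{s,G}^2=\sum_{|\beta|=n}\int_G\int_G\frac{|D^\beta\phi(x)-D^\beta\phi(y)|^2}{|x-y|^{d+2t}}\,dx\,dy$ and $\|\phi\|_{s,G}^2=\|\phi\|_{n,G}^2+|\phi|_{s,G}^2$, where $\|\phi\|_{n,G}^2=\sum_{|\beta|\le n}\|D^\beta\phi\|_{L^2(G)}^2$. $H_0^s(G)$ is the completion of $C_0^\infty(G)$ under $\|\cdot\|_{s,G}$. Continuous problem. $N\in\mathbb{N}$, $\alpha_j\in\mathbb{R}$, $x_j\in\Omega$ $(j=1,\dots,N)$, and $\delta_{x_j}$ is the Dirac measure at $x_j$. The form $\mathcal{B}[v,\varphi]=\int_\Omega\nabla v\cdot\nabla\varphi\,dx$ extends by continuity to a continuous bilinear form on $H_0^{1-\theta}(\Omega)\times H_0^{1+\theta}(\Omega)$ for every $0<\theta<\frac12$. The weak solution $u$ is the unique function that belongs to $H_0^{1-\theta}(\Omega)$ and satisfies $\mathcal{B}[u,\phi]=\sum_{j=1}^N\alpha_j\phi(x_j)$ for all $\phi\in H_0^{1+\theta}(\Omega)$, for every $0<\theta<\frac12$ (recall $H^{1+\theta}(\Omega)\subset C^0(\overline\Omega)$). Discretization. $\mathcal T$ is a conforming (edge-to-edge)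 triangulation of $\Omega$ into (closed) triangles; its shape coefficient $\sigma_{\mathcal T}$ is the minimum angle appearing in $\mathcal T$. Given $\ell\in\mathbb{N}$, $\mathcal P^\ell$ is the space of polynomials of total degree $\le\ell$ and $\mathbb{V}_{\mathcal T}=\{V\in C(\overline\Omega): V=0\text{ on }\partial\Omega,\ V|_T\in\mathcal P^\ell\ \forall T\in\mathcal T\}$. The Galerkin approximation $U\in\mathbb{V}_{\mathcal T}$ is defined by $\int_\Omega\nabla U\cdot\nabla V\,dx=\sum_{j=1}^N\alpha_jV(x_j)$ for all $V\in\mathbb{V}_{\mathcal T}$. Estimator. $h_T=|T|^{1/2}$. On an interelement edge $E=T_1\cap T_2$, $\llbracket\nabla U\rrbracket_{|E}=\nabla U^1\cdot n^1+\nabla U^2\cdot n^2$, where $U^i=U|_{T_i}$ and $n^i$ is the outer unit normal of $T_i$; on boundary edges $\llbracket\nabla U\rrbracket:=0$. Set \[ \eta_{T,\theta}^2=h_T^{2+2\theta}\|\Delta U\|_{L^2(T)}^2+h_T^{1+2\theta}\|\llbracket\nabla U\rrbracket\|_{L^2(\partial T)}^2,\qquad \eta_\theta^2=\sum_{T\in\mathcal T}\eta_{T,\theta}^2 . \] *)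

(* Defs.v *)
From HB Require Import structures.
From mathcomp Require Import all_boot all_order all_algebra.
From mathcomp Require Import all_classical all_reals all_analysis.

Set Implicit Arguments.
Unset Strict Implicit.
Unset Printing Implicit Defensive.

Import Order.TTheory GRing.Theory Num.Theory numFieldNormedType.Exports.

Local Open Scope classical_set_scope.
Local Open Scope ring_scope.

Section plane.
Context {R : realType}.
Implicit Types (x y a b : R * R) (f g : R * R -> R) (G : set (R * R)).

(* The library's norm on R * R is the sup norm; the Euclidean one is needed. *)
Definition dot x y : R := x.1 * y.1 + x.2 * y.2.
Definition enorm x : R := Num.sqrt (dot x x).

Local Notation leb2 := ((@lebesgue_measure R) \x (@lebesgue_measure R))%E.

Definition boundary G : set (R * R) := closure G `\` interior G.

Definition segment a b : set (R * R) :=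
  [set x | exists2 s : R, 0 <= s <= 1 & x = (1 - s) *: a + s *: b].

Definition grad f x : R * R := ('D_((1, 0) : R * R) f x, 'D_((0, 1) : R * R) f x).

Definition pderiv (i j : nat) f : R * R -> R :=
  iter i (fun g => 'D_((1, 0) : R * R) g) (iter j (fun g => 'D_((0, 1) : R * R) g) f).

Definition laplacian f x : R := pderiv 2 0 f x + pderiv 0 2 f x.

(* The library derivative is total, so derivability is required at each order;
   [true] stands for the first variable and [false] for the second one. *)
Definition smooth f : Prop := forall s : seq bool,
  let dir (i : bool) : R * R := if i then (1, 0) else (0, 1) in
  let g := foldr (fun i h => 'D_(dir i) h) f s in
  continuous g /\ forall (i : bool) x, derivable g x (dir i).

(* C_0^oo(Om), functions being extended by zero to the plane *)
Definition test_fun (Om : set (R * R)) f : Prop :=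
  [/\ smooth f, compact (closure [set x | f x != 0])
    & closure [set x | f x != 0] `<=` Om].

Definition L2sq G f : \bar R := (\int[leb2]_(x in G) ((f x) ^+ 2)%:E)%E.

Definition gagliardo (t : R) G f : \bar R :=
  (\int[leb2]_(x in G) \int[leb2]_(y in G)
     ((f x - f y) ^+ 2 / enorm (x - y) `^ (2 + 2 * t))%:E)%E.

(* |f|_{s,G} and ||f||_{s,G} for s = n + t, with classical derivatives (none if
   n = 0) *)
Definition hseminorm (n : nat) (t : R) G f : \bar R :=
  ((\sum_(i < n.+1) gagliardo t G (pderiv i (n - i) f)) `^ 2^-1)%E.

Definition hnorm (n : nat) (t : R) G f : \bar R :=
  ((\sum_(i < n.+1) \sum_(j < n.+1 | (i + j <= n)%N) L2sq G (pderiv i j f)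
    + \sum_(i < n.+1) gagliardo t G (pderiv i (n - i) f)) `^ 2^-1)%E.

(* The completion of C_0^oo(Om) under the norm of order n + t is realised inside
   L^2(Om): an element is the L^2 limit f of a Cauchy sequence [fk] of test
   functions, and [fk] then converges to f in H_0^(n+t)(Om). *)
Definition H0_cvg (n : nat) (t : R) (Om : set (R * R)) (fk : nat -> R * R -> R) f :=
  [/\ forall k, test_fun Om (fk k),
      forall e : R, 0 < e -> exists k0, forall j k, (k0 <= j)%N -> (k0 <= k)%N ->
        (hnorm n t Om (fk j \- fk k)%R < e%:E)%E
    & (fun k => L2sq Om (fk k \- f)) @ \oo --> 0%E].

Definition H0 (n : nat) (t : R) (Om : set (R * R)) f : Prop :=
  measurable_fun (Om : set (measurableTypeR R * measurableTypeR R)) f /\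
  exists fk, H0_cvg n t Om fk f.

Definition Bform (Om : set (R * R)) f g : R :=
  \int[leb2]_(x in Om) dot (grad f x) (grad g x).

(* [b] is the value at (v, w) of the extension by continuity of [Bform Om] from
   C_0^oo x C_0^oo to H_0^(1 - theta) x H_0^(1 + theta). *)
Definition Bext (theta : R) (Om : set (R * R)) (v w : R * R -> R) (b : R) : Prop :=
  forall vk wk : nat -> R * R -> R,
    H0_cvg 0 (1 - theta) Om vk v -> H0_cvg 1 theta Om wk w ->
    (fun k => Bform Om (vk k) (wk k)) @ \oo --> b.

(* Near each boundary point, in orthonormal coordinates with axes [e] and [e]
   rotated by a right angle, [Om] is the strict epigraph of a Lipschitz
   function. *)
Definition lipschitz_boundary (Om : set (R * R)) : Prop :=
  forall p, boundary Om p ->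
  exists (e : R * R) (gam : R -> R) (L r : R),
    [/\ enorm e = 1, 0 < r, L.-lipschitz gam
      & forall x, enorm (x - p) < r ->
          (Om x <-> gam (dot x e) < dot x (- e.2, e.1))].

Definition polygonal (Om : set (R * R)) : Prop :=
  exists (n : nat) (a b : 'I_n -> R * R),
    boundary Om = \bigcup_(i in [set: 'I_n]) segment (a i) (b i).

Definition polygonal_domain (Om : set (R * R)) : Prop :=
  [/\ open Om, Om !=set0, connected Om, bounded_set Om
    & polygonal Om /\ lipschitz_boundary Om].

(* [phi] ranges over continuous representatives of H_0^(1 + theta). *)
Definition weak_solution (Om : set (R * R)) (N : nat) (alpha : 'I_N -> R)
    (x : 'I_N -> R * R) (u : R * R -> R) : Prop :=
  forall theta : R, 0 < theta < 2^-1 ->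
    H0 0 (1 - theta) Om u /\
    forall phi : R * R -> R, H0 1 theta Om phi ->
      {within closure Om, continuous phi} ->
      Bext theta Om u phi (\sum_(j < N) alpha j * phi (x j)).

Definition triangle := 'I_3 -> R * R.
Implicit Types T : triangle.

Definition tri_set T : set (R * R) :=
  [set x | exists lam : 'I_3 -> R, [/\ forall k, 0 <= lam k,
     \sum_k lam k = 1 & x = \sum_k lam k *: T k]].

(* Indices in 'I_3 are added modulo 3: [edge T k] is opposite to vertex [k]. *)
Definition edge T (k : 'I_3) : set (R * R) := segment (T (k + 1)) (T (k + 2)).

Definition edge_length T (k : 'I_3) : R := enorm (T (k + 2) - T (k + 1)).

(* twice the signed area *)
Definition tri_det T : R :=
  let a := T 1 - T 0 in let b := T 2 - T 0 in a.1 * b.2 - a.2 * b.1.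

(* [nu] is [edge T k] rotated clockwise: it points outwards when the vertices
   are in counterclockwise order, and inwards otherwise. *)
Definition outer_normal T (k : 'I_3) : R * R :=
  let d := T (k + 2) - T (k + 1) in let nu : R * R := (d.2, - d.1) in
  (Num.sg (tri_det T) / enorm d) *: nu.

Definition angle T (k : 'I_3) : R :=
  let a := T (k + 1) - T k in let b := T (k + 2) - T k in
  acos (dot a b / (enorm a * enorm b)).

Definition mesh_size T : R := Num.sqrt (fine (leb2 (tri_set T))).

Definition edge_integral T (k : 'I_3) (f : R * R -> R) : \bar R :=
  ((edge_length T k)%:E * \int[@lebesgue_measure R]_(s in `[0%R, 1%R])
     (f ((1 - s) *: T (k + 1) + s *: T (k + 2)))%:E)%E.

Definition poly2 (l : nat) (p : R * R -> R) : Prop :=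
  exists c : nat -> nat -> R, forall x,
    p x = \sum_(i < l.+1) \sum_(j < l.+1 | (i + j <= l)%N)
            c i j * x.1 ^+ i * x.2 ^+ j.

(* Distinct triangles are disjoint or meet in a common vertex or a common edge;
   in particular their interiors are disjoint. *)
Definition conforming_triangulation (Om : set (R * R)) (m : nat)
    (K : 'I_m -> triangle) : Prop :=
  [/\ forall i, tri_det (K i) != 0,
      closure Om = \bigcup_(i in [set: 'I_m]) tri_set (K i)
    & forall i j, i != j ->
      [\/ tri_set (K i) `&` tri_set (K j) = set0,
          exists k k', K i k = K j k' /\
            tri_set (K i) `&` tri_set (K j) = [set K i k]
        | exists k k', edge (K i) k = edge (K j) k' /\
            tri_set (K i) `&` tri_set (K j) = edge (K i) k]].

(* The default value [pi] of the minimum exceeds every angle. *)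
Definition shape_coef (m : nat) (K : 'I_m -> triangle) : R :=
  \big[Num.min/pi]_(i < m) \big[Num.min/pi]_(k < 3) angle (K i) k.

Definition fe_space (Om : set (R * R)) (m : nat) (K : 'I_m -> triangle)
    (l : nat) (V : R * R -> R) : Prop :=
  [/\ {within closure Om, continuous V},
      forall x, boundary Om x -> V x = 0
    & forall i, exists p, poly2 l p /\ forall x, tri_set (K i) x -> V x = p x].

Definition galerkin (Om : set (R * R)) (N : nat) (alpha : 'I_N -> R)
    (x : 'I_N -> R * R) (m : nat) (K : 'I_m -> triangle) (l : nat)
    (U : R * R -> R) : Prop :=
  fe_space Om K l U /\
  forall V, fe_space Om K l V ->
    Bform Om U V = \sum_(j < N) alpha j * V (x j).

(* the polynomial equal to U on T, defined on the whole plane so that its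
   gradient makes sense on the edges of T *)
Definition local_poly (l : nat) (U : R * R -> R) T : R * R -> R :=
  xget (fun=> 0) [set p | poly2 l p /\ forall x, tri_set T x -> U x = p x].

Definition tri_patch (m : nat) (K : 'I_m -> triangle) (i : 'I_m) : set (R * R) :=
  \bigcup_(j in [set j | j = i \/ exists k k', edge (K i) k = edge (K j) k'])
    tri_set (K j).

(* An edge that belongs to no other triangle is a boundary edge. *)
Definition jump (m : nat) (K : 'I_m -> triangle) (l : nat) (U : R * R -> R)
    (i : 'I_m) (k : 'I_3) (x : R * R) : R :=
  if [pick jk : 'I_m * 'I_3 |
      (jk.1 != i) && `[< edge (K i) k = edge (K jk.1) jk.2 >]] is Some (j, k')
  then dot (grad (local_poly l U (K i)) x) (outer_normal (K i) k)
       + dot (grad (local_poly l U (K j)) x) (outer_normal (K j) k')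
  else 0.

Definition eta_sq (m : nat) (K : 'I_m -> triangle) (l : nat) (theta : R)
    (U : R * R -> R) (i : 'I_m) : \bar R :=
  let h := mesh_size (K i) in
  ((h `^ (2 + 2 * theta))%:E *
     L2sq (tri_set (K i)) (laplacian (local_poly l U (K i)))
   + (h `^ (1 + 2 * theta))%:E *
     \sum_(k < 3) edge_integral (K i) k (fun x => (jump K l U i k x) ^+ 2)%R)%E.

Definition eta_loc (m : nat) (K : 'I_m -> triangle) (l : nat) (theta : R)
    (U : R * R -> R) (i : 'I_m) : \bar R :=
  (eta_sq K l theta U i `^ 2^-1)%E.

Definition eta_glob (m : nat) (K : 'I_m -> triangle) (l : nat) (theta : R)
    (U : R * R -> R) : \bar R :=
  ((\sum_(i < m) eta_sq K l theta U i) `^ 2^-1)%E.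

End plane.

Arguments triangle R : clear implicits.

(* Main.v *)
Require Import Defs.
From HB Require Import structures.
From mathcomp Require Import all_boot all_order all_algebra.
From mathcomp Require Import all_classical all_reals all_analysis.
From mathcomp Require Import measurable_realfun lebesgue_integral_fubini.
From mathcomp Require Import ring lra.

(** The error u - U is bounded from below by testing the equation against well
    chosen functions. If phi is a test function that vanishes at all the
    sources, then the integral of u times the Laplacian of phi is zero
    ([weak_laplacian]): the very weak form of the equation needs no derivative
    of u. Hence the integral of (u - U) times the Laplacian of phi only involves
    U. As that Laplacian is supported in a small set S and has mean zero on it,
    the oscillation of u - U on S suffices, and a fractional Poincare argument
    bounds the square of the integral by the Gagliardo seminorm of u - U on S
    ([mean_zero_gagliardo], [residual_le]).

    It remains to choose phi so that U gives back the estimator. In orthogonal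
    coordinates (s, t) adapted to an edge, phi is a product chi(s) xi(t). On a
    triangle U is a polynomial, which is integrated by parts against phi. If chi
    and xi are dual to the monomials of degree at most l, the result is a chosen
    coefficient of the Laplacian of U ([element_residual]). If xi is instead a
    profile across the edge, orthogonal to polynomials on either side of it, the
    result is a chosen coefficient of the jump of the normal derivative
    ([edge_residual]). Functions of one variable with prescribed moments are all
    that is needed ([exists_moments], [exists_profile]).

    The sources are avoided by cutting the edge into N + 1 cells: one of them
    contains no projection of a source ([free_cell]). There are finitely many
    choices for the cell and the coefficient, so the constants do not depend on
    the position of the sources. This is where N enters.

    The minimal angle enters through the frames: in the frame of each of its
    edges, scaled to length 1, a triangle contains a fixed strip along the edge
    and is contained in a fixed square ([fat_shape], [fat_tri_int],
    [fat_tri_set]). Bounds on the coefficients thus become bounds on the norms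
    in the estimator, and the powers of the length of the edge cancel
    ([element_term_le], [edge_term_le]).

    The strips used for a triangle lie in its patch, which gives the local
    bound. A point belongs to at most six strips ([strip_overlap]), and the
    double integrals over them add up to at most six times the one over the
    domain ([sum_gagliardo_le]), which gives the global bound. *)

Set Implicit Arguments.
Unset Strict Implicit.
Unset Printing Implicit Defensive.

Import Order.TTheory GRing.Theory Num.Theory numFieldNormedType.Exports.

Local Open Scope classical_set_scope.
Local Open Scope ring_scope.

Local Notation "f ^`1" := (derive1 f) (at level 1, left associativity, format "f ^`1").

(** * Smooth functions of one variable *)

Section smooth1.

Local Open Scope classical_set_scope.
Context {R : realType}.
Implicit Types f g : R -> R.

(** Wrapping the statement in an inductive type keeps it from being unfolded;
    smoothness is then proved by the coinduction principle [smooth1_ind]. *)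
Variant smooth1 f : Prop := Smooth1 of forall n x, derivable (f^`(n)%classic) x 1.

(** It is enough to exhibit a class of derivable functions that contains f and
    is closed under derivation. *)
Lemma smooth1_ind (C : set (R -> R)) :
  (forall f, C f -> (forall x, derivable f x 1) /\ C f^`1) ->
  forall f, C f -> smooth1 f.
Proof.
move=> H f Cf; split=> n; have : C (f^`(n)%classic) by elim: n => //= n /H[].
by move=> /H[].
Qed.

Lemma smooth1_derivable f x : smooth1 f -> derivable f x 1.
Proof. by move=> [/(_ 0%N)]. Qed.

Lemma smooth1_derive f : smooth1 f -> smooth1 f^`1.
Proof. by move=> [sf]; split=> n x; have := sf n.+1 x; rewrite derive1Sn. Qed.

Lemma smooth1_continuous f : smooth1 f -> continuous f.
Proof.
by move=> sf x; apply/differentiable_continuous/derivable1_diffP/smooth1_derivable.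
Qed.

Lemma derive1D f g (x:R) : smooth1 f -> smooth1 g ->
  (fun y => f y + g y)^`1 x = f^`1 x + g^`1 x.
Proof.
by move=> sf sg; rewrite !derive1E deriveD //; exact: smooth1_derivable.
Qed.

Lemma derive1M f g x : smooth1 f -> smooth1 g ->
  (fun y => f y * g y)^`1 x = f^`1 x * g x + f x * g^`1 x.
Proof.
move=> sf sg; rewrite !derive1E deriveM; do ?exact: smooth1_derivable.
by rewrite /GRing.scale /= addrC mulrC.
Qed.

Lemma smooth1D f g : smooth1 f -> smooth1 g -> smooth1 (fun x => f x + g x).
Proof.
move=> sf sg.
apply: (@smooth1_ind [set h | exists f g, [/\ smooth1 f, smooth1 g & h = fun x => f x + g x]]); last by exists f, g.
move=> {f g sf sg} h [f [g [sf sg ->]]]; split.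
  by move=> x; apply: derivableD; exact: smooth1_derivable.
exists f^`1, g^`1; split; do ?exact: smooth1_derive.
by apply/funext => x; exact: derive1D.
Qed.

(** The class generated by products is closed under derivation by the Leibniz
    rule, while the set of products alone is not. *)
Inductive sum_prod : (R -> R) -> Prop :=
| SumProd1 f g : smooth1 f -> smooth1 g -> sum_prod (fun x => f x * g x)
| SumProdD f g : sum_prod f -> sum_prod g -> sum_prod (fun x => f x + g x).

Lemma smooth1M f g : smooth1 f -> smooth1 g -> smooth1 (fun x => f x * g x).
Proof.
move=> sf sg; apply: (@smooth1_ind sum_prod); last exact: SumProd1.
move=> h; elim=> {f g sf sg h} [f g sf sg|f g _ [df sf] _ [dg sg]].
  split; first by move=> x; apply: derivableM; exact: smooth1_derivable.
  rewrite (_ : _^`1 = fun x => f^`1 x * g x + f x * g^`1 x).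
    by apply: SumProdD; apply: SumProd1 => //; exact: smooth1_derive.
  by apply/funext => x; exact: derive1M.
split; first by move=> x; exact: derivableD.
rewrite (_ : _^`1 = fun x => f^`1 x + g^`1 x); first exact: SumProdD.
by apply/funext => x; rewrite !derive1E deriveD.
Qed.

Lemma smooth1_cst (c : R) : smooth1 (fun=> c).
Proof.
apply: (@smooth1_ind [set h | exists c, h = fun=> c]); last by exists c.
move=> h [b ->]; split; first by move=> x; exact: derivable_cst.
by exists 0; apply/funext => x; rewrite derive1E derive_cst.
Qed.

Lemma derive1_id (x : R) : (fun y : R => y)^`1 x = (1 : R).
Proof. by rewrite derive1E derive_id. Qed.

Lemma smooth1_id : smooth1 (fun x : R => x).
Proof.
split=> -[|n] x; first by apply: derivable_id.
rewrite derive1Sn (_ : derive1 (fun y : R => y) = fun=> (1 : R)); first by case: (smooth1_cst 1).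
by apply/funext => y; exact: derive1_id.
Qed.

Lemma smooth1Xn n : smooth1 (fun x : R => x ^+ n).
Proof.
elim: n => [|n ih]; first exact: smooth1_cst.
under [fun x => _]funext => x do rewrite exprS.
exact: (smooth1M smooth1_id ih).
Qed.

Lemma derive1Xn n (x : R) : (fun y : R => y ^+ n)^`1 x = (n%:R : R) * x ^+ n.-1.
Proof. by rewrite derive1E exp_derive /GRing.scale /= mulr1. Qed.

Lemma is_derive_affine f (c b x : R) : smooth1 f ->
  is_derive x 1 (fun y => f (c * y + b)) (c * f^`1 (c * x + b)).
Proof.
move=> sf.
have h1 : is_derive x 1 (fun y : R => c * y + b) c.
  by apply: is_derive_eq; rewrite addr0 /GRing.scale /= mulr1.
have h2 : is_derive (c * x + b) 1 f (f^`1 (c * x + b)).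
  by apply: DeriveDef; [exact: smooth1_derivable | rewrite derive1E].
have H := @is_derive1_comp R f (fun y => c * y + b) x _ _ h2 h1.
by apply: (is_derive_eq H); rewrite /GRing.scale /= mulrC.
Qed.

Lemma smooth1_affine f (c b : R) : smooth1 f -> smooth1 (fun x => f (c * x + b)).
Proof.
move=> sf.
apply: (@smooth1_ind [set h | exists k f, smooth1 f /\ h = fun x => k * f (c * x + b)]); last first.
  by exists 1, f; split => //; apply/funext => x; rewrite mul1r.
move=> {f sf} h [k [f [sf ->]]].
have D (x : R) : is_derive x 1 (fun y => k * f (c * y + b)) (k * (c * f^`1 (c * x + b))).
  have H := is_derive_affine c b x sf.
  exact: (is_deriveZ k).
split; first by move=> x; have [] := D x.
exists (k * c), f^`1; split; first exact: smooth1_derive.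
by apply/funext => x; rewrite derive1E (derive_val) mulrA.
Qed.

Lemma derive1_affine f (c b x : R) : smooth1 f ->
  (fun y => f (c * y + b))^`1 x = c * f^`1 (c * x + b).
Proof.
by move=> sf; rewrite derive1E; have H := is_derive_affine c b x sf; rewrite derive_val.
Qed.

(** The functions p(1/x) exp(-1/x) extended by 0: a family closed under
    derivation, hence made of smooth functions, flat at 0. *)
Definition flat (p : {poly R}) (x : R) : R :=
  if 0 < x then p.[x^-1] * expR (- x^-1) else 0.

Lemma expR_poly_bound (p : {poly R}) :
  exists C : R, forall y, 1 <= y -> `|p.[y]| * expR (- y) <= C / y ^+ 2.
Proof.
exists (\sum_(i < size p) `|p`_i| * (i.+2)`!%:R) => y y1.
have y0 : 0 < y by exact: lt_le_trans y1.
rewrite ler_pdivlMr ?exprn_gt0 // horner_coef.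
apply: (@le_trans _ _ ((\sum_(i < size p) `|p`_i| * y ^+ i) * expR (- y) * y ^+ 2)).
  rewrite ler_pM2r ?exprn_gt0 // ler_pM2r ?expR_gt0 //.
  apply: (le_trans (ler_norm_sum _ _ _)); apply: ler_sum => i _.
  by rewrite normrM (ger0_norm (exprn_ge0 _ (ltW y0))).
rewrite !mulr_suml; apply: ler_sum => i _.
rewrite -!mulrA ler_wpM2l //.
rewrite mulrCA -exprD addn2 mulrC expRN ler_pdivrMr ?expR_gt0 //.
have := expR_ge1Dxn i.+1 (ltW y0).
rewrite -ler_pdivrMl ?ltr0n ?fact_gt0 // mulrC.
by apply: le_trans; rewrite lerDr.
Qed.

Lemma flat_le0 p (x:R) : x <= 0 -> flat p x = 0.
Proof. by rewrite /flat ltNge => ->. Qed.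

(** A quadratic bound at 0 makes the difference quotient tend to 0; this
    covers the only point where [flat] is not given by a formula. *)
Lemma is_derive0_quadratic f (C : R) : f 0 = 0 ->
  (\forall h \near (0 : R), `|f h| <= C * h ^+ 2) -> is_derive (0 : R) 1 f 0.
Proof.
move=> f0 fC.
have H : h^-1 *: ((f \o shift 0) (h *: 1) - f 0) @[h --> 0^'] --> (0 : R).
  apply/cvgrPdist_le => e e0; near=> h.
  rewrite f0 subr0 sub0r normrN /= /shift /= addr0 /GRing.scale /= mulr1.
  have hn0 : h != 0 by near: h; exact: nbhs_dnbhs_neq.
  rewrite normrM normfV ler_pdivrMl ?normr_gt0 //.
  apply: (@le_trans _ _ (C * h ^+ 2)); first by near: h; apply: nbhs_dnbhs.
  rewrite -[h ^+ 2]real_normK ?num_real // expr2 mulrCA.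
  rewrite ler_wpM2l //; apply: (@le_trans _ _ ((`|C| + 1) * `|h|)).
    by rewrite ler_wpM2r // (le_trans (ler_norm _)) // lerDl.
  rewrite -ler_pdivlMl ?ltr_wpDl // mulrC; near: h; apply: dnbhs0_le.
  by rewrite divr_gt0 // ltr_wpDl.
apply: DeriveDef; first by apply/cvg_ex; exists 0.
exact: cvg_lim H.
Unshelve. all: by end_near. Qed.

Lemma is_derive_flat p (x : R) :
  is_derive x 1 (flat p) (flat ('X^2 * (p - p^`()%R)) x).
Proof.
have [x0|x0|->] := ltgtP x 0.
- rewrite flat_le0 ?ltW //.
  apply: (near_eq_is_derive (f := cst 0)) => //.
  near=> y; rewrite flat_le0 //; apply: ltW; near: y; exact: lt_nbhsl.
- rewrite /flat x0.
  have E : \forall y \near x, p.[y^-1] * expR (- y^-1) = flat p y.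
    near=> y; rewrite /flat ifT //; near: y; exact: lt_nbhsr.
  apply: (near_eq_is_derive E).
  have xn0 : x != 0 by rewrite gt_eqF.
  have h1 : is_derive x 1 (fun y : R => y^-1) (- x ^- 2).
    have H := is_deriveV (f := fun y : R => y) xn0.
    by apply: (is_derive_eq (H _ _ _)); rewrite /GRing.scale /= mulr1.
  have h2 : is_derive x 1 (fun y => p.[y^-1]) (p^`()%R.[x^-1] * - x ^- 2).
    have : is_derive (x^-1) 1 (horner p) (p^`()%R.[x^-1]) by exact: is_derive_poly.
    by move=> h; exact: (@is_derive1_comp R (horner p) (fun y => y^-1) x _ _ h h1).
  have h3 : is_derive x 1 (fun y : R => - y^-1) (x ^- 2).
    by apply: is_derive_eq; rewrite opprK.
  have h4 : is_derive x 1 (fun y => expR (- y^-1)) (expR (- x^-1) * x ^- 2).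
    have h5 : is_derive (- x^-1) 1 expR (expR (- x^-1)) by exact: is_derive_expR.
    exact: (@is_derive1_comp R expR (fun y => - y^-1) x _ _ h5 h3).
  have := is_deriveM h2 h4.
  move=> h; apply: (is_derive_eq h).
  rewrite /GRing.scale /= !hornerE -exprVn.
  set a := p.[_]; set b := _.[_]; set c := x^-1; set d := expR _; cbn -[GRing.mul GRing.add GRing.opp GRing.exp].
  ring.
- rewrite (flat_le0 _ (lexx 0)).
  have [C HC] := expR_poly_bound p.
  apply: (@is_derive0_quadratic _ C); first by rewrite flat_le0.
  near=> h; rewrite /flat; case: ifPn => h0; last first.
    rewrite normr0 (@le_trans _ _ (C * 0)) ?mulr0 //.
    rewrite mulr_ge0 ?sqr_ge0 //; have := HC 1 (lexx _).
    rewrite expr1n divr1; apply: le_trans; exact: mulr_ge0 (expR_ge0 _).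
  rewrite normrM (ger0_norm (expR_ge0 _)).
  have h1 : 1 <= h^-1.
    rewrite -(invr1 R) lef_pV2 ?posrE //; near: h.
    exact: lt_le_nbhsl.
  by have := HC _ h1; rewrite exprVn invrK.
Unshelve. all: by end_near. Qed.

Lemma smooth1_flat p : smooth1 (flat p).
Proof.
apply: (@smooth1_ind [set h | exists p, h = flat p]); last by exists p.
move=> h [q ->]; split; first by move=> x; have [] := is_derive_flat q x.
exists ('X^2 * (q - q^`()%R)); apply/funext => x.
by rewrite derive1E; have H := is_derive_flat q x; rewrite derive_val.
Qed.

End smooth1.

(** * Compactly supported functions with prescribed moments *)

Section test1.
Context {R : realType}.
Implicit Types (f g : R -> R) (a b A B : R).
Local Notation mu := (@lebesgue_measure R).

(** Functions in C_0^oo of the line, supported in [a, b]. *)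
Definition test1 a b f := smooth1 f /\ forall x, ~~ (a < x < b) -> f x = 0.

Lemma test1_derive a b f : test1 a b f -> test1 a b f^`1.
Proof.
move=> [sf f0]; split; first exact: smooth1_derive.
have d0 x : (\forall y \near x, f y = 0) -> f^`1 x = 0.
  move=> h; rewrite derive1E.
  have := @near_eq_is_derive _ _ _ (cst 0) f x 1 0 _ (is_derive_cst 0 x 1).
  move=> H; suff /H D : \forall y \near x, cst 0 y = f y by rewrite derive_val.
  by apply: filterS h.
have cf' : continuous f^`1 by exact/smooth1_continuous/smooth1_derive.
move=> x; rewrite negb_and -!leNgt => /orP[xa|bx].
- have L y : y < a -> f^`1 y = 0.
    move=> ya; apply: d0; near=> z; apply: f0.
    rewrite negb_and -!leNgt; apply/orP; left.
    by near: z; exact: lt_le_nbhsl.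
  move: xa; rewrite le_eqVlt => /predU1P[->{x}|/L //].
  apply/eqP; apply: contrapT => /negP n0.
  have h1 : \forall y \near a^'-, f^`1 y != 0.
    by apply: cvg_within; exact: (cvgr_neq0 _ (cf' a) n0).
  have h2 : \forall y \near a^'-, y < a by exact: withinT.
  by have [y [/eqP ne /L]] := filter_ex (filterI h1 h2).
- have L y : b < y -> f^`1 y = 0.
    move=> ya; apply: d0; near=> z; apply: f0.
    rewrite negb_and -!leNgt; apply/orP; right.
    by near: z; exact: lt_le_nbhsr.
  move: bx; rewrite le_eqVlt => /predU1P[<-{x}|/L //].
  apply/eqP; apply: contrapT => /negP n0.
  have h1 : \forall y \near b^'+, f^`1 y != 0.
    by apply: cvg_within; exact: (cvgr_neq0 _ (cf' b) n0).
  have h2 : \forall y \near b^'+, b < y by exact: withinT.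
  by have [y [/eqP ne /L]] := filter_ex (filterI h1 h2).
Unshelve. all: by end_near. Qed.

Lemma test1D a b f g : test1 a b f -> test1 a b g -> test1 a b (fun x => f x + g x).
Proof.
move=> [sf f0] [sg g0]; split; first exact: smooth1D.
by move=> x xab; rewrite f0 // g0 // addr0.
Qed.

Lemma test1Z a b (c : R) f : test1 a b f -> test1 a b (fun x => c * f x).
Proof.
move=> [sf f0]; split; first by apply: smooth1M => //; exact: smooth1_cst.
by move=> x xab; rewrite f0 // mulr0.
Qed.

Lemma test1_sub a b A B f : A <= a -> b <= B -> test1 a b f -> test1 A B f.
Proof.
move=> Aa bB [sf f0]; split => // x xAB; apply: f0; apply: contra xAB => /andP[ax xb].
by rewrite (le_lt_trans Aa) // (lt_le_trans xb).
Qed.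

Lemma integrable_cc f A B : continuous f -> mu.-integrable `[A, B] (EFin \o f).
Proof.
move=> cf; apply: continuous_compact_integrable; first exact: segment_compact.
exact: continuous_subspaceT.
Qed.

Lemma Rintegral_derive1 f A B : A < B -> smooth1 f ->
  \int[mu]_(x in `[A, B]) f^`1 x = f B - f A.
Proof.
move=> AB sf; rewrite /Rintegral.
rewrite (@continuous_FTC2 _ f^`1 f) //.
- exact/continuous_subspaceT/smooth1_continuous/smooth1_derive.
- have cf := smooth1_continuous sf.
  split; first by move=> x _; exact: smooth1_derivable.
    exact/cvg_at_right_filter/cf.
  exact/cvg_at_left_filter/cf.
Qed.

Definition mom A B f j := \int[mu]_(x in `[A, B]) (f x * x ^+ j).

Lemma continuousMXn f j : continuous f -> continuous (fun x => f x * x ^+ j).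
Proof. by move=> cf x; apply: cvgM; [exact: cf | exact: exprn_continuous]. Qed.

Lemma momD A B f g j : continuous f -> continuous g ->
  mom A B (fun x => f x + g x) j = mom A B f j + mom A B g j.
Proof.
move=> cf cg; rewrite /mom -RintegralD //; try exact/integrable_cc/continuousMXn.
by apply: eq_Rintegral => x _; rewrite mulrDl.
Qed.

Lemma momZ A B c f j : continuous f ->
  mom A B (fun x => c * f x) j = c * mom A B f j.
Proof.
move=> cf; rewrite /mom -RintegralZl //; try exact/integrable_cc/continuousMXn.
by apply: eq_Rintegral => x _; rewrite mulrA.
Qed.

Lemma mom_derive1 A B f j : A < B -> smooth1 f ->
  mom A B f^`1 j = f B * B ^+ j - f A * A ^+ j - j%:R * mom A B f j.-1.
Proof.
move=> AB sf; have sx := @smooth1Xn R j.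
rewrite -(Rintegral_derive1 AB (smooth1M sf sx)).
under eq_Rintegral do rewrite derive1M // derive1Xn mulrCA.
rewrite RintegralD //; first last.
- apply: integrable_cc => x; apply: cvgM; first exact: cst_continuous.
  exact/continuousMXn/smooth1_continuous.
- exact/integrable_cc/continuousMXn/smooth1_continuous/smooth1_derive.
by rewrite RintegralZl //; [rewrite addrK | exact/integrable_cc/continuousMXn/smooth1_continuous].
Qed.

Lemma test1_bnd a b A B f : A <= a -> b <= B -> test1 a b f -> f A = 0 /\ f B = 0.
Proof.
move=> Aa bB [_ f0]; split; apply: f0; rewrite negb_and -!leNgt ?Aa ?bB ?orbT //.
Qed.

Lemma mom_test1_derive1 a b A B f j : A < B -> A <= a -> b <= B -> test1 a b f ->
  mom A B f^`1 j = - (j%:R * mom A B f j.-1).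
Proof.
move=> AB Aa bB tf; have [fA fB] := test1_bnd Aa bB tf.
by rewrite mom_derive1 //; [rewrite fA fB !mul0r subr0 sub0r | case: tf].
Qed.

Definition bump a b x := flat 1 (x - a) * flat 1 (b - x).

Lemma test1_bump a b : test1 a b (bump a b).
Proof.
split=> [|x].
  apply: smooth1M.
    have := smooth1_affine 1 (- a) (smooth1_flat (1 : {poly R})).
    by under [X in smooth1 X]funext do rewrite mul1r.
  have := smooth1_affine (-1) b (smooth1_flat (1 : {poly R})).
  by under [X in smooth1 X]funext do rewrite mulN1r addrC.
rewrite negb_and -!leNgt /bump => /orP[xa|bx].
  by rewrite flat_le0 ?mul0r // subr_le0.
by rewrite [X in _ * X]flat_le0 ?mulr0 // subr_le0.
Qed.

Lemma flat1_gt0 (x : R) : 0 < x -> 0 < flat 1 x.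
Proof. by move=> x0; rewrite /flat x0 hornerC mul1r expR_gt0. Qed.

Lemma flat1_ge0 (x : R) : 0 <= flat 1 x.
Proof. by have [/flat_le0->|/flat1_gt0/ltW] := leP x 0. Qed.

Lemma flat1_homo (x y : R) : x <= y -> flat 1 x <= flat 1 y.
Proof.
move=> xy; have [/flat_le0->|x0] := leP x 0; first exact: flat1_ge0.
have y0 := lt_le_trans x0 xy.
by rewrite /flat x0 y0 !hornerC !mul1r ler_expR lerN2 lef_pV2.
Qed.

Lemma mom_bump_gt0 a b A B : A <= a -> a < b -> b <= B -> 0 < mom A B (bump a b) 0.
Proof.
move=> Aa ab bB; rewrite /mom; under eq_Rintegral do rewrite expr0 mulr1.
set h := (b - a) / 4.
have h0 : 0 < h by rewrite divr_gt0 // subr_gt0.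
have hE : h * 4 = b - a by rewrite divfK.
have c0 : 0 < flat 1 h * flat 1 h by rewrite mulr_gt0 // flat1_gt0.
have cb : continuous (bump a b) by have [/smooth1_continuous] := test1_bump a b.
have b0 x : 0 <= bump a b x by rewrite mulr_ge0 // flat1_ge0.
apply: (@lt_le_trans _ _ (\int[mu]_(x in `[a + h, b - h]) (flat 1 h * flat 1 h))).
  rewrite Rintegral_cst // mulr_gt0 // /= lebesgue_measure_itv /= lte_fin ifT /=; lra.
apply: (@le_trans _ _ (\int[mu]_(x in `[a + h, b - h]) bump a b x)).
  apply: le_Rintegral => //; [by apply: integrable_cc => ?; exact: cvg_cst|exact: integrable_cc|].
  move=> x; rewrite /= in_itv /= => /andP[ax xb].
  by apply: ler_pM; rewrite ?flat1_ge0 // flat1_homo //; lra.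
rewrite /Rintegral fine_le //.
- by apply: integrable_fin_num => //; exact: integrable_cc.
- by apply: integrable_fin_num => //; exact: integrable_cc.
apply: ge0_subset_integral => //.
- by apply/measurable_EFinP; apply: measurable_funTS; exact: continuous_measurable_fun.
- by move=> x _; rewrite lee_fin.
- by move=> x; rewrite /= !in_itv /= => /andP[ax xb]; apply/andP; split; lra.
Qed.

(** Starting from a bump of mean 1, each derivation kills one more moment and
    turns the first surviving one into a known nonzero number. *)
Lemma exists_test1_top a b A B n : A <= a -> a < b -> b <= B ->
  exists f, [/\ test1 a b f, forall j, (j < n)%N -> mom A B f j = 0 & mom A B f n = 1].
Proof.
move=> Aa ab bB; have AB : A < B by exact: le_lt_trans Aa (lt_le_trans ab bB).
elim: n => [|n [f [tf f0 f1]]].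
  have m0 := mom_bump_gt0 Aa ab bB.
  exists (fun x => (mom A B (bump a b) 0)^-1 * bump a b x); split => //.
    exact/test1Z/test1_bump.
  rewrite momZ ?mulVf ?gt_eqF //.
  by have [/smooth1_continuous] := test1_bump a b.
have cf' : continuous f^`1 by case: (test1_derive tf) => /smooth1_continuous.
(* integrating by parts, differentiation raises the first nonzero moment by one *)
exists (fun x => - n.+1%:R^-1 * f^`1 x); split.
- exact/test1Z/test1_derive.
- move=> j jn; rewrite momZ // (mom_test1_derive1 _ AB Aa bB tf).
  by case: j jn => [|j] jn; rewrite ?mul0r ?oppr0 ?mulr0 //= f0 // mulr0 oppr0 mulr0.
- rewrite momZ // (mom_test1_derive1 _ AB Aa bB tf) /= f1 mulr1 mulrNN.
  by rewrite mulVf // pnatr_eq0.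
Qed.

(** Functions whose first nonzero moment is the n-th one form a triangular
    system, which is solved by induction on n. *)
Lemma exists_moments a b A B n (m : nat -> R) : A <= a -> a < b -> b <= B ->
  exists f, test1 a b f /\ forall j, (j < n)%N -> mom A B f j = m j.
Proof.
move=> Aa ab bB; elim: n => [|n [f [tf fm]]].
  by exists (bump a b); split => //; exact: test1_bump.
have [g [tg g0 g1]] := exists_test1_top n Aa ab bB.
have [cf cg] : continuous f /\ continuous g.
  by case: tf tg => /smooth1_continuous ? _ [/smooth1_continuous ? _].
have cZ c : continuous (fun x => c * g x).
  by move=> x; apply: cvgM; [exact: cst_continuous|exact: cg].
exists (fun x => f x + (m n - mom A B f n) * g x); split; first exact/test1D/test1Z.
move=> j; rewrite ltnS leq_eqVlt => /predU1P[->|jn]; rewrite momD // momZ //.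
  by rewrite g1 mulr1 addrC subrK.
by rewrite g0 // mulr0 addr0 fm.
Qed.

End test1.

(** * Affine changes of variables in the plane *)

Section plane_measure.
Context {R : realType}.
Local Notation mu := (@lebesgue_measure R).
Local Notation leb2 := (mu \x mu)%E.
Local Notation RR := (measurableTypeR R * measurableTypeR R)%type.
Implicit Types (U : set (R * R)).

Lemma open_measurable2 U : open U -> measurable (U : set RR).
Proof.
move=> oU.
pose B (i : rat * rat * nat) : set (R * R) :=
  ball (ratr i.1.1 : R) (i.2.+1%:R^-1 / 2 : R) `*` ball (ratr i.1.2 : R) (i.2.+1%:R^-1 / 2 : R).
have mB i : measurable (B i : set RR).
  by apply: measurableX; apply: open_measurable; exact: ball_open.
have -> : U = \bigcup_(n in [set n | exists2 i, pickle i = n & B i `<=` U])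
    (if unpickle n is Some i then B i else set0).
  apply/seteqP; split => [x Ux|x [n [i <- BU]]]; last by rewrite pickleK => /BU.
  have /nbhs_ballP[e /= e0 xeU] : nbhs x U by exact: open_nbhs_nbhs.
  pose k := Num.bound e^-1.
  have ke : k.+1%:R^-1 < e.
    rewrite -[ltRHS]invrK ltf_pV2 ?posrE ?invr_gt0 //.
    apply: (@lt_le_trans _ _ (Num.bound e^-1)%:R); last by rewrite ler_nat.
    by apply: archi_boundP; rewrite invr_ge0 ltW.
  set r : R := k.+1%:R^-1 / 2.
  have r0 : 0 < r by rewrite divr_gt0 // invr_gt0.
  have H (y : R) : exists q : rat, `|y - ratr q| < r.
    have b0 : ball y r !=set0 by exists y; exact: ballxx.
    have oB : open (ball y r) by exact: ball_open.
    by have [z [yq [q _ qE]]] := dense_rat b0 oB; exists q; rewrite qE.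
  have [[q1 h1] [q2 h2]] := (H x.1, H x.2).
  exists (pickle (q1, q2, k)).
    exists (q1, q2, k) => //; move=> y [/= y1 y2]; apply: xeU.
    have kE : r + r = k.+1%:R^-1 by rewrite -splitr.
    split; rewrite /ball /=; apply: lt_trans ke; rewrite -kE.
      by rewrite -(subrK (ratr q1) x.1) -addrA (le_lt_trans (ler_normD _ _)) // ltrD.
    by rewrite -(subrK (ratr q2) x.2) -addrA (le_lt_trans (ler_normD _ _)) // ltrD.
  by rewrite pickleK; split; rewrite /ball /= distrC.
apply: bigcup_measurable => n _; case: (unpickle n) => // ?; exact: measurable0.
Qed.

Lemma continuous_measurable2 (f : R * R -> R) : continuous f ->
  measurable_fun [set: RR] (f : RR -> R).
Proof.
move=> /continuousP cf; apply: (measurability _ (RGenOpens.measurableE R)).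
move=> _ [_ [a [b ->] <-]]; rewrite setTI; apply: open_measurable2.
by apply: cf; exact: interval_open.
Qed.

Lemma affine_preimage_measure (c b : R) (A : set (measurableTypeR R)) : c != 0 -> measurable A ->
  mu A = (`|c|%:E * mu ((fun x : measurableTypeR R => (c * x + b)%R : measurableTypeR R) @^-1` A))%E.
Proof.
move=> c0 mA.
pose phi (x : measurableTypeR R) : measurableTypeR R := c * x + b.
have mphi : measurable_fun setT phi.
  by apply: measurable_funD => //; apply: measurable_funM.
have [m' H] : exists m' : {measure set (measurableTypeR R) -> \bar R},
    forall X, m' X = (`|c|%:E * mu (phi @^-1` X))%E.
  by exists (mscale (NngNum (normr_ge0 c))
    (measure_function_pushforward__canonical__measure_function_Measure mu mphi)).
rewrite -[RHS](H A).
apply: (@lebesgue_measure_unique R m') => // _ [[p q]] _ <-; rewrite H /=.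
have [c_gt0|c_lt0|/eqP] := ltgtP c 0; last by rewrite (negbTE c0).
- have -> : phi @^-1` `]p, q] = `[(q - b) / c, (p - b) / c[%classic.
    apply/seteqP; split => x; rewrite /= !in_itv /= /phi.
      by rewrite ler_ndivrMr // ltr_ndivlMr // ltrBlDr lerBrDr mulrC andbC.
    by rewrite ler_ndivrMr // ltr_ndivlMr // ltrBlDr lerBrDr mulrC andbC.
  rewrite !lebesgue_measure_itv /= !lte_fin ltr_nM2r ?invr_lt0 // ltrD2r.
  case: ifPn => _; last by rewrite mule0.
  by rewrite -!EFinB -EFinM ltr0_norm //; congr EFin; field.
- have -> : phi @^-1` `]p, q] = `](p - b) / c, (q - b) / c]%classic.
    apply/seteqP; split => x; rewrite /= !in_itv /= /phi.
      by rewrite ler_pdivlMr // ltr_pdivrMr // ltrBlDr lerBrDr mulrC.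
    by rewrite ler_pdivlMr // ltr_pdivrMr // ltrBlDr lerBrDr mulrC.
  rewrite !lebesgue_measure_itv /= !lte_fin ltr_pM2r ?invr_gt0 // ltrD2r.
  case: ifPn => _; last by rewrite mule0.
  by rewrite -!EFinB -EFinM gtr0_norm //; congr EFin; field.
Qed.

Lemma ge0_integral_affine (c b : R) (f : R -> \bar R) : c != 0 ->
  measurable_fun setT f -> (forall x, 0 <= f x)%E ->
  (\int[mu]_x f x = `|c|%:E * \int[mu]_x f (c * x + b)%R)%E.
Proof.
move=> c0 mf f0.
pose phi (x : measurableTypeR R) : measurableTypeR R := c * x + b.
have mphi : measurable_fun setT phi.
  by apply: measurable_funD => //; apply: measurable_funM.
have := @ge0_integral_pushforward _ _ _ _ R phi mphi mu setT f measurableT mf (fun x _ => f0 x).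
rewrite preimage_setT => <-.
rewrite -(@ge0_integral_mscale _ _ _
  (measure_function_pushforward__canonical__measure_function_Measure mu mphi) setT measurableT (NngNum (normr_ge0 c)) f) //.
apply: eq_measure_integral => A mA _.
exact: affine_preimage_measure.
Qed.

Definition aff (a d e : R * R) (p : R * R) : R * R :=
  (a.1 + p.1 * d.1 + p.2 * e.1, a.2 + p.1 * d.2 + p.2 * e.2).

Lemma measurable_aff a d e : measurable_fun [set: RR] (aff a d e : RR -> RR).
Proof.
by apply: measurable_fun_pair; apply: measurable_funD;
  [apply: measurable_funD => //; apply: measurable_funM => //; exact: measurable_fst
  |apply: measurable_funM => //; exact: measurable_snd
  |apply: measurable_funD => //; apply: measurable_funM => //; exact: measurable_fst
  |apply: measurable_funM => //; exact: measurable_snd].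
Qed.

(** Change of variables for affine maps. When d.1 is nonzero the map is a
    composition of two maps that each act on one coordinate, so that Tonelli's
    theorem reduces the claim to the line; otherwise the axes are exchanged. *)
Lemma ge0_integral_aff (a d e : R * R) (f : R * R -> \bar R) :
  d.1 * e.2 - d.2 * e.1 != 0 ->
  measurable_fun [set: RR] (f : RR -> _) -> (forall x, 0 <= f x)%E ->
  (\int[leb2]_x f x = `|d.1 * e.2 - d.2 * e.1|%:E * \int[leb2]_x f (aff a d e x))%E.
Proof.
wlog d0 : d e / d.1 != 0.
  have [d0|/= H] := eqVneq d.1 0; last exact.
  move=> H D0 mf f0.
  have e0 : e.1 != 0 by apply: contra D0 => /eqP ->; rewrite d0 mul0r mulr0 subrr.
  have D1 : e.1 * d.2 - e.2 * d.1 != 0.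
    by apply: contra D0; rewrite d0 !(mulr0, mul0r) subr0 sub0r oppr_eq0 mulrC.
  rewrite (H e d e0 D1 mf f0) distrC (mulrC e.2) (mulrC e.1); congr (_ * _)%E.
  have mF := measurableT_comp mf (measurable_aff a e d).
  have mG := measurableT_comp mf (measurable_aff a d e).
  rewrite (fubini_tonelli1 _ mF (fun x => f0 _)).
  rewrite (fubini_tonelli2 _ mG (fun x => f0 _)).
  rewrite /fubini_F /fubini_G /=.
  apply: eq_integral => x _; apply: eq_integral => y _; congr f.
  by rewrite /aff /=; congr pair; ring.
move=> D0 mf f0.
set D := (X in X != 0) in D0 *.
pose H (p : RR) := f (p.1, D / d.1 * p.2 + (a.2 + (p.1 - a.1) / d.1 * d.2)).
have mH : measurable_fun setT H.
  apply: (measurableT_comp mf); apply: measurable_fun_pair; first exact: measurable_fst.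
  apply: measurable_funD; first by apply: measurable_funM => //; exact: measurable_snd.
  apply: measurable_funD => //; apply: measurable_funM => //; apply: measurable_funM => //.
  by apply: measurable_funB => //; exact: measurable_fst.
have H0 p : (0 <= H p)%E by exact: f0.
have mG := measurableT_comp mf (measurable_aff a d e).
rewrite (fubini_tonelli2 _ mG (fun x => f0 _)) /fubini_G /=.
rewrite (fubini_tonelli1 _ mf f0) /fubini_F /=.
have Dd : D / d.1 != 0 by rewrite mulf_neq0 // invr_eq0.
have -> : (fun x => \int[mu]_y f (x, y))%E = (fun x => `|D / d.1|%:E * \int[mu]_y H (x, y))%E.
  apply/funext => x.
  rewrite (ge0_integral_affine (a.2 + (x - a.1) / d.1 * d.2) Dd) //.
  exact: measurableT_comp mf (pair1_measurable _).
rewrite ge0_integralZl //; first last.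
- by move=> x _; apply: integral_ge0.
- exact: (measurable_fun_fubini_tonelli_F (m2 := mu) _ mH H0).
have -> : (\int[mu]_x \int[mu]_y H (x, y) = \int[mu]_y \int[mu]_x H (x, y))%E.
  exact: (fubini_tonelli _ mH H0).
have -> : (fun y => \int[mu]_x H (x, y))%E =
    (fun y => `|d.1|%:E * \int[mu]_x f (aff a d e (x, y)))%E.
  apply/funext => y.
  rewrite (ge0_integral_affine (a.1 + y * e.1) d0) //; last exact: measurableT_comp mH (pair2_measurable _).
  congr (_ * _)%E; apply: eq_integral => x _; rewrite /H /aff /=; congr f; congr pair.
    by rewrite mulrC; ring.
  by rewrite /D; field.
rewrite ge0_integralZl //; first last.
- by move=> x _; apply: integral_ge0.
- exact: (measurable_fun_fubini_tonelli_G (m1 := mu) _ mG (fun x => f0 _)).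
by rewrite muleA -EFinM -normrM divfK.
Qed.

End plane_measure.

(** * Integrals over rectangles in a frame *)

Section rect_integral.
Context {R : realType}.
Local Notation mu := (@lebesgue_measure R).
Local Notation leb2 := (mu \x mu)%E.
Local Notation RR := (measurableTypeR R * measurableTypeR R)%type.

Lemma ge0_muleBr (k : R) (A B : \bar R) : 0 < k -> (0 <= A -> 0 <= B ->
  k%:E * A - k%:E * B = k%:E * (A - B))%E.
Proof.
move=> k0; have k0' : (0 < k%:E)%E by rewrite lte_fin.
case: A => [a| |] //; case: B => [b| |] // _ _.
- by congr EFin; rewrite /= mulrBr.
- by rewrite /= gt0_muley // gt0_muleNy.
- by rewrite /= gt0_muley.
- by rewrite /= gt0_muley // gt0_muleNy.
Qed.

Lemma integral_aff (a d e : R * R) (f : R * R -> \bar R) :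
  d.1 * e.2 - d.2 * e.1 != 0 -> measurable_fun [set: RR] (f : RR -> _) ->
  (\int[leb2]_x f x = `|d.1 * e.2 - d.2 * e.1|%:E * \int[leb2]_x f (aff a d e x))%E.
Proof.
move=> D0 mf; rewrite integralE [in RHS]integralE.
rewrite (@ge0_integral_aff _ a d e f^\+%E D0) //; last exact: measurable_funepos.
rewrite (@ge0_integral_aff _ a d e f^\-%E D0) //; last exact: measurable_funeneg.
rewrite ge0_muleBr ?normr_gt0 //; [|exact: integral_ge0..].
by congr (_ * (_ - _))%E; apply: eq_integral => x _; rewrite ?funeposE ?funenegE.
Qed.

Lemma integrable_prod (f g : R -> R) :
  mu.-integrable setT (EFin \o f) -> mu.-integrable setT (EFin \o g) ->
  leb2.-integrable [set: RR] (fun p => (f p.1 * g p.2)%:E).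
Proof.
move=> fi gi.
have mf : measurable_fun setT f by apply/measurable_EFinP; exact: measurable_int fi.
have mg : measurable_fun setT g by apply/measurable_EFinP; exact: measurable_int gi.
have mfg : measurable_fun [set: RR] (fun p => (f p.1 * g p.2)%:E).
  apply/measurable_EFinP/measurable_funM.
    exact: measurableT_comp mf measurable_fst.
  exact: measurableT_comp mg measurable_snd.
apply/integrable12ltyP => //.
under eq_integral => x _.
  under eq_integral do rewrite /= normrM EFinM.
  rewrite ge0_integralZl //; last by apply/measurable_EFinP/measurableT_comp.
  over.
rewrite ge0_integralZr //; last first.
- by apply: integral_ge0.
- by apply/measurable_EFinP/measurableT_comp.
have [_ fo] := integrableP _ _ _ fi.
have [_ go] := integrableP _ _ _ gi.
by apply: lte_mul_pinfty => //; [exact: integral_ge0|rewrite ge0_fin_numE //; exact: integral_ge0].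
Qed.

Lemma integral_prod (f g : R -> R) :
  mu.-integrable setT (EFin \o f) -> mu.-integrable setT (EFin \o g) ->
  \int[leb2]_p (f p.1 * g p.2) = (\int[mu]_x f x) * (\int[mu]_x g x).
Proof.
move=> fi gi; have fgi := integrable_prod fi gi.
rewrite {1}/Rintegral -integral12_prod_meas1 //.
have gfin := integrable_fin_num measurableT gi.
have ffin := integrable_fin_num measurableT fi.
have -> : (\int[mu]_x fubini_F mu (fun p => (f p.1 * g p.2)%:E) x =
    \int[mu]_x ((f x)%:E * \int[mu]_y (g y)%:E))%E.
  apply: eq_integral => x _; rewrite /fubini_F /=.
  under eq_integral do rewrite EFinM.
  by rewrite integralZl.
by rewrite -(fineK gfin) integralZr // -(fineK ffin) -EFinM.
Qed.

Section rect.
Variables (a d e : R * R) (inv : R * R -> R * R).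
Let D := `|d.1 * e.2 - d.2 * e.1|.
Hypothesis D0 : d.1 * e.2 - d.2 * e.1 != 0.
Hypothesis FK : forall p, inv (aff a d e p) = p.
Hypothesis minv : measurable_fun [set: RR] (inv : RR -> RR).

Lemma measurable_rect (I J : set (measurableTypeR R)) : measurable I -> measurable J ->
  measurable (inv @^-1` (I `*` J) : set RR).
Proof. by move=> mI mJ; rewrite -[X in measurable X]setTI; apply: minv => //; exact: measurableX. Qed.

Variables (I J : set (measurableTypeR R)) (f g : R -> R).
Hypotheses (mI : measurable I) (mJ : measurable J).
Hypotheses (fi : mu.-integrable I (EFin \o f)) (gi : mu.-integrable J (EFin \o g)).

Let h (x : R * R) := f (inv x).1 * g (inv x).2.

Let patchE : (EFin \o h) \_ (inv @^-1` (I `*` J)) =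
  (fun x => ((f \_ I) (inv x).1 * (g \_ J) (inv x).2)%:E).
Proof.
apply/funext => x; rewrite /patch /h /= /preimage /mem_set.
have -> : (x \in [set t | (I `*` J) (inv t)]) = ((inv x).1 \in I) && ((inv x).2 \in J).
  by apply/idP/andP; rewrite !inE /= => -[].
by case: ifPn => /= [/andP[-> ->] //|/nandP[/negbTE->|/negbTE->]]; rewrite ?mul0r ?mulr0.
Qed.

Let fi' : mu.-integrable setT (EFin \o (f \_ I)).
Proof. by rewrite -restrict_EFin; apply/(integrable_mkcond _ mI). Qed.
Let gi' : mu.-integrable setT (EFin \o (g \_ J)).
Proof. by rewrite -restrict_EFin; apply/(integrable_mkcond _ mJ). Qed.

Let mpatch : measurable_fun [set: RR] (fun x => ((f \_ I) (inv x).1 * (g \_ J) (inv x).2)%:E).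
Proof.
have H := measurable_int _ (integrable_prod fi' gi').
exact: measurableT_comp H minv.
Qed.

Lemma integrable_rect :
  leb2.-integrable (inv @^-1` (I `*` J)) (EFin \o h).
Proof.
apply/(integrable_mkcond _ (measurable_rect mI mJ)); rewrite patchE.
apply/integrableP; split=> //.
rewrite (@integral_aff a d e _ D0); last exact: measurableT_comp mpatch.
have [_ H] := integrableP _ _ _ (integrable_prod fi' gi').
apply: lte_mul_pinfty => //.
by under eq_integral do rewrite /= FK.
Qed.

(** Here [inv] gives the coordinates in the frame, and its values on the
    rectangle separate the variables. *)
Lemma Rintegral_rect :
  \int[leb2]_(x in inv @^-1` (I `*` J)) h x = D * ((\int[mu]_(x in I) f x) * (\int[mu]_(x in J) g x)).
Proof.
rewrite {1}/Rintegral integral_mkcond patchE (@integral_aff a d e _ D0) //.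
under [X in fine (_ * X)]eq_integral do rewrite /= FK.
have fgi := integrable_prod fi' gi'.
have H := integral_prod fi' gi'.
rewrite fineM //=; last exact: integrable_fin_num fgi.
by rewrite -[fine (integral _ _ _)]/(Rintegral leb2 setT _) H -!Rintegral_mkcond.
Qed.

End rect.

Lemma measure_rect (a d e : R * R) (inv : R * R -> R * R) (I J : set (measurableTypeR R)) :
  d.1 * e.2 - d.2 * e.1 != 0 -> (forall p, inv (aff a d e p) = p) ->
  measurable_fun [set: RR] (inv : RR -> RR) ->
  measurable I -> measurable J ->
  leb2 (inv @^-1` (I `*` J) : set RR) = (`|d.1 * e.2 - d.2 * e.1|%:E * (mu I * mu J))%E.
Proof.
move=> D0 FK minv mI mJ.
have mS : measurable (inv @^-1` (I `*` J) : set RR) by exact: measurable_rect.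
rewrite -[LHS]mul1e -integral_cst // integral_mkcond (@integral_aff a d e _ D0); last first.
  by apply/(measurable_restrictT _ mS).
congr (_ * _)%E.
rewrite -[RHS]product_measure1E // -[RHS]mul1e -integral_cst; last exact: measurableX.
rewrite [RHS]integral_mkcond; apply: eq_integral => p _; rewrite /patch /= /preimage.
by congr (if _ then _ else _); apply/idP/idP; rewrite !inE /= FK.
Qed.

End rect_integral.

(** * Products of ridge functions and Green's formula *)

Section plane_calculus.
Context {R : realType}.
Local Notation mu := (@lebesgue_measure R).
Local Notation leb2 := (mu \x mu)%E.
Local Notation RR := (measurableTypeR R * measurableTypeR R)%type.
Implicit Types (v w x : R * R) (c : R) (K : set (R * R)).

Definition ridge v c (f : R -> R) x := f (dot v x + c).

Lemma dotDr v x y : dot v (x + y) = dot v x + dot v y.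
Proof. by rewrite /dot /=; ring. Qed.
Lemma dotZr v (k : R) x : dot v (k *: x) = k * dot v x.
Proof. by rewrite /dot /= /GRing.scale /=; ring. Qed.

Lemma is_derive_ridge v c f x w : smooth1 f ->
  is_derive x w (ridge v c f) (dot v w * ridge v c f^`1 x).
Proof.
move=> sf.
have := is_derive_affine (dot v w) (dot v x + c) 0 sf; rewrite mulr0 add0r => -[dg eg].
have E : (fun h : R => h^-1 *: ((ridge v c f \o shift x) (h *: w) - ridge v c f x)) =
  (fun h : R => h^-1 *: (((fun y => f (dot v w * y + (dot v x + c))) \o shift 0) (h *: 1) -
     (fun y => f (dot v w * y + (dot v x + c))) 0)).
  apply/funext => h; rewrite /ridge /= /shift /= dotDr dotZr addr0 mulr0 add0r.
  by rewrite -addrA /GRing.scale /= mulr1 (mulrC h (dot v w)).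
by apply: DeriveDef; [rewrite /derivable E|rewrite /derive E].
Qed.

Lemma continuous_dot v c : continuous (fun x => dot v x + c).
Proof.
move=> x; apply: cvgD; last exact: cvg_cst.
by apply: cvgD; (apply: cvgM; [exact: cvg_cst|]); [exact: cvg_fst|exact: cvg_snd].
Qed.

Lemma continuous_ridge v c f : continuous f -> continuous (ridge v c f).
Proof.
by move=> cf x; apply: (continuous_comp (@continuous_dot v c x)); exact: cf.
Qed.

Section tensor.
Variables (v v' : R * R) (c c' : R).

Definition ten f g x := ridge v c f x * ridge v' c' g x.

(** Products of two ridge functions are not stable under derivation, but
    their sums are; this yields smoothness in the sense of iterated partial
    derivatives. *)
Inductive sum_ten : (R * R -> R) -> Prop :=
| SumTen1 f g : smooth1 f -> smooth1 g -> sum_ten (ten f g)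
| SumTenD F G : sum_ten F -> sum_ten G -> sum_ten (fun x => F x + G x).

Lemma is_derive_ten f g x w : smooth1 f -> smooth1 g ->
  is_derive x w (ten f g) (dot v w * ten f^`1 g x + dot v' w * ten f g^`1 x).
Proof.
move=> sf sg; have h1 := is_derive_ridge v c x w sf; have h2 := is_derive_ridge v' c' x w sg.
apply: (is_derive_eq (is_deriveM h1 h2)); rewrite /GRing.scale /= /ten; ring.
Qed.

Lemma sum_ten_derive F w : sum_ten F ->
  (forall x, derivable F x w) /\ sum_ten ('D_w F).
Proof.
elim=> {F} [f g sf sg|F G _ [dF sF] _ [dG sG]].
  split; first by move=> x; have [] := is_derive_ten x w sf sg.
  have -> : 'D_w (ten f g) = (fun x => ten (fun y => dot v w * f^`1 y) g x +
       ten f (fun y => dot v' w * g^`1 y) x).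
    apply/funext => x; have [_ ->] := is_derive_ten x w sf sg.
    by rewrite /ten /ridge; ring.
  have sZ k h : smooth1 h -> smooth1 (fun y => k * h y).
    by move=> sh; apply: smooth1M => //; exact: smooth1_cst.
  by apply: SumTenD; apply: SumTen1 => //; apply: sZ; exact: smooth1_derive.
split; first by move=> x; exact: derivableD.
rewrite (_ : 'D_w _ = fun x => 'D_w F x + 'D_w G x); first exact: SumTenD.
by apply/funext => x; rewrite deriveD.
Qed.

Lemma sum_ten_continuous F : sum_ten F -> continuous F.
Proof.
elim=> {F} [f g sf sg|F G _ cF _ cG] x; last by apply: cvgD; [exact: cF|exact: cG].
by apply: cvgM; exact/continuous_ridge/smooth1_continuous.
Qed.

Lemma sum_ten_smooth F : sum_ten F -> smooth F.
Proof.
move=> sF s dir g; have sg : sum_ten g.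
  by rewrite {}/g; elim: s => //= i s ih; exact: (sum_ten_derive (dir i) ih).2.
split; first exact: sum_ten_continuous.
by move=> i; have [] := sum_ten_derive (dir i) sg.
Qed.

Lemma derive2_ten f g w : smooth1 f -> smooth1 g ->
  'D_w ('D_w (ten f g)) = fun x => dot v w ^+ 2 * ten f^`1^`1 g x +
     2 * (dot v w * dot v' w) * ten f^`1 g^`1 x + dot v' w ^+ 2 * ten f g^`1^`1 x.
Proof.
move=> sf sg.
have E (h k : R -> R) : smooth1 h -> smooth1 k ->
   'D_w (ten h k) = (fun x => dot v w * ten h^`1 k x + dot v' w * ten h k^`1 x).
  by move=> sf' sg'; apply/funext => x; have [_ ->] := is_derive_ten x w sf' sg'.
have [sf' sg'] := (smooth1_derive sf, smooth1_derive sg).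
rewrite (E f g sf sg); apply/funext => x.
have h1 := is_derive_ten x w sf' sg; have h2 := is_derive_ten x w sf sg'.
have h3 := @is_deriveZ _ _ _ _ (dot v w) _ _ _ h1.
have h4 := @is_deriveZ _ _ _ _ (dot v' w) _ _ _ h2.
have [_ ->] := is_deriveD h3 h4.
rewrite /GRing.scale /=; ring.
Qed.

Lemma laplacian_ten f g x : smooth1 f -> smooth1 g -> dot v v' = 0 ->
  laplacian (ten f g) x = dot v v * ten f^`1^`1 g x + dot v' v' * ten f g^`1^`1 x.
Proof.
move=> sf sg vv'.
have H w := congr1 (fun h => h x) (derive2_ten w sf sg).
have -> : laplacian (ten f g) x =
    'D_((1, 0) : R * R) ('D_((1, 0) : R * R) (ten f g)) x +
    'D_((0, 1) : R * R) ('D_((0, 1) : R * R) (ten f g)) x by [].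
transitivity (dot v v * ten f^`1^`1 g x + dot v' v' * ten f g^`1^`1 x +
  2 * ten f^`1 g^`1 x * dot v v'); last by rewrite vv' mulr0 addr0.
rewrite !H /dot /=; ring.
Qed.

End tensor.

(** Off a closed set that carries f, f vanishes near each point. *)
Lemma near0_derive K (f : R * R -> R) w : closed K ->
  (forall x, ~ K x -> f x = 0) -> forall x, ~ K x -> 'D_w f x = 0.
Proof.
move=> cK f0 x nK.
have H : \forall y \near x, cst 0 y = f y.
  have : \forall y \near x, (~` K) y.
    by apply: open_nbhs_nbhs; split => //; exact: closed_openC.
  by apply: filterS => y /= /f0 ->.
by have [_ ->] := near_eq_is_derive H (is_derive_cst (0 : R) x w).
Qed.

Lemma continuous_compact_bound (f : R * R -> R) K : continuous f -> compact K ->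
  exists B : R, 0 < B /\ forall x, K x -> `|f x| < B.
Proof.
move=> cf cK; have := continuous_compact (continuous_subspaceT cf) cK.
move=> /compact_bounded [B [_ HB]].
have B1 : B < `|B| + 2^-1 by rewrite (le_lt_trans (ler_norm _)) // ltrDl.
exists (`|B| + 1); split; first by rewrite ltr_wpDl.
move=> x Kx; apply: (@le_lt_trans _ _ (`|B| + 2^-1)); last by rewrite ltrD2l; lra.
by apply: HB => //; exists x.
Qed.

Lemma compact_box K : compact K ->
  exists M : R, 0 < M /\ forall x, K x -> `|x.1| < M /\ `|x.2| < M.
Proof.
move=> cK.
have [M1 [M10 H1]] := continuous_compact_bound (f := fst) (fun x => cvg_fst) cK.
have [M2 [M20 H2]] := continuous_compact_bound (f := snd) (fun x => cvg_snd) cK.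
exists (M1 + M2); split; first exact: addr_gt0.
by move=> x Kx; split; [apply: (lt_trans (H1 x Kx))|apply: (lt_trans (H2 x Kx))]; lra.
Qed.

Definition box (M : R) : set (R * R) := `[- M, M] `*` `[- M, M].

Lemma continuous_integrable (f : R * R -> R) K : compact K -> continuous f ->
  (forall x, ~ K x -> f x = 0) -> leb2.-integrable [set: RR] (EFin \o f).
Proof.
move=> cK cf f0.
have mf := continuous_measurable2 cf.
have [M [M0 KM]] := compact_box cK.
have mB : measurable (box M : set RR) by apply: measurableX; exact: measurable_itv.
have fB : f = f \_ (box M).
  apply/funext => x; rewrite /patch; case: ifPn => // xM; apply: f0 => /KM[h1 h2].
  move: xM; rewrite notin_setE; apply; split => /=; rewrite in_itv /=;
    by rewrite -ler_norml ltW.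
rewrite fB -restrict_EFin; apply/(integrable_mkcond _ mB).
apply: measurable_bounded_integrable => //.
- apply: (@le_lt_trans _ _ ((mu \x mu) (box M : set RR))%E) => //.
  rewrite product_measure1E //= lebesgue_measure_itv /=.
  by case: ifP => _; rewrite ?mul0e // -EFinB -EFinM ltry.
- exact: measurable_funTS.
- have [B [B0 HB]] := continuous_compact_bound cf cK.
  exists B; split; first exact: num_real.
  move=> y By x _ /=; have [Kx|/f0 ->] := pselect (K x); last first.
    by rewrite normr0 ltW // (lt_trans B0).
  by rewrite ltW // (lt_trans (HB x Kx)).
Qed.

Lemma derive_dir1 (g : R * R -> R) (x y : R) :
  (derivable g (x, y) ((1, 0) : R * R) -> derivable (fun s => g (s, y)) x 1) /\
  'D_((1, 0) : R * R) g (x, y) = (fun s => g (s, y))^`1 x.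
Proof.
have E : (fun h : R => h^-1 *: ((g \o shift (x, y)) (h *: ((1, 0) : R * R)) - g (x, y))) =
  (fun h : R => h^-1 *: (((fun s => g (s, y)) \o shift x) (h *: (1 : R)) - g (x, y))).
  apply/funext => h /=; congr (h^-1 *: (g _ - _)).
  by apply: injective_projections; rewrite /= ?scaler0 ?add0r.
by rewrite derive1E /derivable /derive E.
Qed.

Lemma derive_dir2 (g : R * R -> R) (x y : R) :
  (derivable g (x, y) ((0, 1) : R * R) -> derivable (fun s => g (x, s)) y 1) /\
  'D_((0, 1) : R * R) g (x, y) = (fun s => g (x, s))^`1 y.
Proof.
have E : (fun h : R => h^-1 *: ((g \o shift (x, y)) (h *: ((0, 1) : R * R)) - g (x, y))) =
  (fun h : R => h^-1 *: (((fun s => g (x, s)) \o shift y) (h *: (1 : R)) - g (x, y))).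
  apply/funext => h /=; congr (h^-1 *: (g _ - _)).
  by apply: injective_projections; rewrite /= ?scaler0 ?add0r.
by rewrite derive1E /derivable /derive E.
Qed.

Lemma integral_derive_compact (f : R -> R) (M : R) : 0 < M ->
  (forall x : R, derivable f x 1) -> continuous f^`1 ->
  (forall x : R, M <= `|x| -> f x = 0) -> (forall x : R, M <= `|x| -> f^`1 x = 0) ->
  (\int[mu]_x (f^`1 x)%:E = 0)%E.
Proof.
move=> M0 df cf' f0 f0'.
have -> : (\int[mu]_x (f^`1 x)%:E = \int[mu]_(x in `[(- M)%R, M]) (f^`1 x)%:E)%E.
  rewrite [RHS]integral_mkcond; apply: eq_integral => x _; rewrite /patch.
  case: ifPn => //; rewrite notin_setE /= in_itv /= -ler_norml => /negP.
  by rewrite -ltNge => /ltW /f0' ->.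
have cf : continuous f by move=> x; exact/differentiable_continuous/derivable1_diffP.
have MM : - M < M by lra.
have fM : f M = 0 by apply: f0; rewrite ler_norm.
have fNM : f (- M) = 0 by apply: f0; rewrite normrN ler_norm.
rewrite (continuous_FTC2 MM (continuous_subspaceT cf') _ (fun (x : R) _ => erefl)).
- by rewrite fM fNM subee.
- split; first by move=> x _; exact: df.
    exact/cvg_at_right_filter/cf.
  exact/cvg_at_left_filter/cf.
Qed.

Lemma pair_cvg1 (x y : R) : (fun s : R => (s, y)) @ x --> (x, y).
Proof.
have h1 : (fun s : R => s) @ x --> x by exact: cvg_id.
have h2 : (fun=> y) @ x --> y by exact: cvg_cst.
exact: (cvg_pair h1 h2).
Qed.

Lemma pair_cvg2 (x y : R) : (fun s : R => (y, s)) @ x --> (y, x).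
Proof.
have h1 : (fun s : R => s) @ x --> x by exact: cvg_id.
have h2 : (fun=> y) @ x --> y by exact: cvg_cst.
exact: (cvg_pair h2 h1).
Qed.

Section vanish_integral.
Variables (g : R * R -> R) (K : set (R * R)).
Hypotheses (cK : compact K) (g0 : forall x, ~ K x -> g x = 0).

(** Fubini's theorem reduces this to the fundamental theorem of calculus on
    lines, where g vanishes at both ends. *)
Lemma integral_dir1 : (forall x, derivable g x ((1, 0) : R * R)) ->
  continuous ('D_((1, 0) : R * R) g) ->
  \int[leb2]_x 'D_((1, 0) : R * R) g x = 0.
Proof.
move=> dg cg.
have clK : closed K by apply: compact_closed cK.
have g0' := near0_derive ((1, 0) : R * R) clK g0.
have [M [M0 KM]] := compact_box cK.
have gi := continuous_integrable cK cg g0'.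
rewrite /Rintegral -integral21_prod_meas1 // integral0_eq // => y _.
rewrite /fubini_G /=.
under eq_integral do rewrite (derive_dir1 g _ _).2.
apply: (integral_derive_compact M0).
- by move=> x; apply: (derive_dir1 g x y).1.
- move=> x; rewrite (_ : (fun _ => _)^`1 = (fun s => 'D_((1, 0) : R * R) g (s, y))).
    have h : (fun s : R => (s, y)) @ x --> (x, y) by exact: pair_cvg1.
    exact: (continuous_comp h (cg (x, y))).
  by apply/funext => s; rewrite (derive_dir1 g _ _).2.
- by move=> x xM; apply: g0 => /KM[/= h _]; move: xM; rewrite leNgt h.
- move=> x xM; rewrite -(derive_dir1 g _ _).2.
  by apply: g0' => /KM[/= h _]; move: xM; rewrite leNgt h.
Qed.

Lemma integral_dir2 : (forall x, derivable g x ((0, 1) : R * R)) ->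
  continuous ('D_((0, 1) : R * R) g) ->
  \int[leb2]_x 'D_((0, 1) : R * R) g x = 0.
Proof.
move=> dg cg.
have clK : closed K by apply: compact_closed cK.
have g0' := near0_derive ((0, 1) : R * R) clK g0.
have [M [M0 KM]] := compact_box cK.
have gi := continuous_integrable cK cg g0'.
rewrite /Rintegral -integral12_prod_meas1 // integral0_eq // => y _.
rewrite /fubini_F /=.
under eq_integral do rewrite (derive_dir2 g _ _).2.
apply: (integral_derive_compact M0).
- by move=> x; apply: (derive_dir2 g y x).1.
- move=> x; rewrite (_ : (fun _ => _)^`1 = (fun s => 'D_((0, 1) : R * R) g (y, s))).
    have h : (fun s : R => (y, s)) @ x --> (y, x) by exact: pair_cvg2.
    exact: (continuous_comp h (cg (y, x))).
  by apply/funext => s; rewrite (derive_dir2 g _ _).2.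
- by move=> x xM; apply: g0 => /KM[/= _ h]; move: xM; rewrite leNgt h.
- move=> x xM; rewrite -(derive_dir2 g _ _).2.
  by apply: g0' => /KM[/= _ h]; move: xM; rewrite leNgt h.
Qed.
End vanish_integral.

Lemma smooth_dir (f : R * R -> R) : smooth f ->
  [/\ continuous f, (forall x, derivable f x ((1, 0) : R * R)),
     (forall x, derivable f x ((0, 1) : R * R)),
     smooth ('D_((1, 0) : R * R) f) & smooth ('D_((0, 1) : R * R) f)].
Proof.
move=> sf; split.
- by have [] := sf [::].
- by have [_ /(_ true)] := sf [::].
- by have [_ /(_ false)] := sf [::].
- by move=> s; have := sf (rcons s true); rewrite /= foldr_rcons.
- by move=> s; have := sf (rcons s false); rewrite /= foldr_rcons.
Qed.

Lemma Rintegral_opp_of_sum0 (A B C D : R * R -> R) :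
  leb2.-integrable [set: RR] (EFin \o A) -> leb2.-integrable [set: RR] (EFin \o B) ->
  leb2.-integrable [set: RR] (EFin \o C) -> leb2.-integrable [set: RR] (EFin \o D) ->
  \int[leb2]_x C x = 0 -> \int[leb2]_x D x = 0 ->
  (forall x, A x + B x = C x + D x) ->
  \int[leb2]_x A x = - \int[leb2]_x B x.
Proof.
move=> iA iB iC iD C0 D0 E; apply/eqP; rewrite -addr_eq0 -RintegralD //.
under eq_Rintegral do rewrite E.
by rewrite RintegralD // C0 D0 addr0.
Qed.

(** The fields f d_i g have compact support, hence their divergence
    integrates to zero. *)
Lemma green_compact (f g : R * R -> R) K : compact K -> smooth f -> smooth g ->
  (forall x, ~ K x -> f x = 0) ->
  \int[leb2]_x dot (grad f x) (grad g x) = - \int[leb2]_x (f x * laplacian g x).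
Proof.
move=> cK sf sg f0.
have clK : closed K by apply: compact_closed cK.
have [cf d1f d2f s1f s2f] := smooth_dir sf.
have [cg d1g d2g s1g s2g] := smooth_dir sg.
have [c1f _ _ _ _] := smooth_dir s1f; have [c2f _ _ _ _] := smooth_dir s2f.
have [c1g d11g _ s11g _] := smooth_dir s1g; have [c2g _ d22g _ s22g] := smooth_dir s2g.
have [c11g _ _ _ _] := smooth_dir s11g; have [c22g _ _ _ _] := smooth_dir s22g.
pose D1 (h : R * R -> R) := 'D_((1, 0) : R * R) h.
pose D2 (h : R * R -> R) := 'D_((0, 1) : R * R) h.
pose h1 x := f x * D1 g x; pose h2 x := f x * D2 g x.
have E1 : D1 h1 = (fun x => D1 f x * D1 g x + f x * D1 (D1 g) x).
  apply/funext => x; apply: (etrans (deriveM (d1f x) (d11g x))).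
  by rewrite addrC; congr (_ + _); exact: mulrC.
have E2 : D2 h2 = (fun x => D2 f x * D2 g x + f x * D2 (D2 g) x).
  apply/funext => x; apply: (etrans (deriveM (d2f x) (d22g x))).
  by rewrite addrC; congr (_ + _); exact: mulrC.
have cE1 : continuous (D1 h1).
  by rewrite E1 => x; apply: cvgD; apply: cvgM; [exact: c1f|exact: c1g|exact: cf|exact: c11g].
have cE2 : continuous (D2 h2).
  by rewrite E2 => x; apply: cvgD; apply: cvgM; [exact: c2f|exact: c2g|exact: cf|exact: c22g].
have h10 x : ~ K x -> h1 x = 0 by move=> /f0; rewrite /h1 => ->; rewrite mul0r.
have h20 x : ~ K x -> h2 x = 0 by move=> /f0; rewrite /h2 => ->; rewrite mul0r.
have I1 : \int[leb2]_x D1 h1 x = 0 := integral_dir1 cK h10 (fun x => derivableM (d1f x) (d11g x)) cE1.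
have I2 : \int[leb2]_x D2 h2 x = 0 := integral_dir2 cK h20 (fun x => derivableM (d2f x) (d22g x)) cE2.
have i1 : leb2.-integrable [set: RR] (EFin \o D1 h1) := continuous_integrable cK cE1 (near0_derive _ clK h10).
have i2 : leb2.-integrable [set: RR] (EFin \o D2 h2) := continuous_integrable cK cE2 (near0_derive _ clK h20).
have cfl : continuous (fun x => f x * laplacian g x).
  by move=> x; apply: cvgM; [exact: cf|apply: cvgD; [exact: c11g|exact: c22g]].
have il : leb2.-integrable setT (EFin \o (fun x => f x * laplacian g x)).
  by apply: (continuous_integrable cK cfl) => x /f0 ->; rewrite mul0r.
have cd : continuous (fun x => dot (grad f x) (grad g x)).
  by move=> x; apply: cvgD; apply: cvgM; [exact: c1f|exact: c1g|exact: c2f|exact: c2g].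
have id : leb2.-integrable setT (EFin \o (fun x => dot (grad f x) (grad g x))).
  apply: (continuous_integrable cK cd) => x nK.
  by rewrite /dot /grad /= (near0_derive _ clK f0 nK) (near0_derive _ clK f0 nK) !mul0r addr0.
apply: (Rintegral_opp_of_sum0 id il i1 i2 I1 I2) => x.
rewrite E1 E2.
change ((D1 f x * D1 g x + D2 f x * D2 g x) + f x * (D1 (D1 g) x + D2 (D2 g) x) =
  (D1 f x * D1 g x + f x * D1 (D1 g) x) + (D2 f x * D2 g x + f x * D2 (D2 g) x)).
move: (f x) (D1 f x) (D1 g x) (D1 (D1 g) x) (D2 f x) (D2 g x) (D2 (D2 g) x).
by move=> *; ring.
Qed.
End plane_calculus.

(** * The Gagliardo seminorm *)

Section integral_bounds.
Context {R : realType}.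
Local Notation mu := (@lebesgue_measure R).
Local Notation leb2 := (mu \x mu)%E.
Local Notation RR := (measurableTypeR R * measurableTypeR R)%type.

(** Monotonicity for nonnegative functions that need not be measurable: the
    integral is a supremum over simple functions below the integrand. It makes
    the Gagliardo seminorm monotone in its domain without any regularity of the
    function. *)
Lemma ge0_le_integral_any d (T : measurableType d) (m : {measure set T -> \bar R})
    (A B : set T) (f g : T -> \bar R) :
  (forall x, A x -> 0 <= f x)%E -> (forall x, B x -> 0 <= g x)%E ->
  A `<=` B -> (forall x, A x -> f x <= g x)%E ->
  (\int[m]_(x in A) f x <= \int[m]_(x in B) g x)%E.
Proof.
move=> f0 g0 AB fg; rewrite !ge0_integralE //.
apply: le_ereal_sup => _ [h /= hf <-]; exists h => //= x.
apply: (le_trans (hf x)); rewrite /patch.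
case: ifPn => [/set_mem Ax|_].
  by rewrite ifT ?fg // inE; exact: AB.
by case: ifPn => // /set_mem; exact: g0.
Qed.

Lemma integrable_cst_fin d (T : measurableType d) (m : {measure set T -> \bar R})
    (S : set T) (c : R) : measurable S -> (m S < +oo)%E ->
  m.-integrable S (EFin \o (fun=> c)).
Proof.
move=> mS Sfin; apply: measurable_bounded_integrable => //.
by exists `|c|; split; [exact: num_real|move=> y cy x _ /=; exact: ltW].
Qed.

Section cauchy_schwarz.
Variables (d : measure_display) (T : measurableType d) (m : {measure set T -> \bar R}).
Variables (S : set T) (w : T -> R).
Hypotheses (mS : measurable S) (Sfin : (m S < +oo)%E) (mw : measurable_fun S w).
Hypothesis w2 : (\int[m]_(x in S) ((w x) ^+ 2)%:E < +oo)%E.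

Lemma integrable_sqr : m.-integrable S (fun x => ((w x) ^+ 2)%:E).
Proof.
apply/integrableP; split; first exact/measurable_EFinP/measurable_funX.
by under eq_integral do rewrite /= ger0_norm ?sqr_ge0 //.
Qed.

Lemma integrable_of_sqr : m.-integrable S (EFin \o w).
Proof.
have i1 : m.-integrable S (fun x => (1 + (w x) ^+ 2)%:E).
  have := integrableD mS (integrable_cst_fin 1 mS Sfin) integrable_sqr.
  by apply: eq_integrable.
apply: (le_integrable mS _ _ i1); first exact/measurable_EFinP.
move=> x _; rewrite /= lee_fin [leRHS]ger0_norm ?addr_ge0 ?sqr_ge0 //.
rewrite ler_norml; apply/andP; split; nra.
Qed.

Lemma Rintegral_norm_sqr_le :
  (\int[m]_(x in S) `|w x|) ^+ 2 <= fine (m S) * \int[m]_(x in S) (w x) ^+ 2.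
Proof.
have iw := integrable_of_sqr; have iw2 := integrable_sqr.
have ia : m.-integrable S (EFin \o (fun x => `|w x|)) by exact: integrable_norm.
have ic c : m.-integrable S (EFin \o (fun=> c : R)) by exact: integrable_cst_fin.
set a := \int[m]_(x in S) `|w x|; set A := \int[m]_(x in S) (w x) ^+ 2.
set M := fine (m S).
have M0 : 0 <= M by exact: fine_ge0.
(* the quadratic polynomial in l that is the integral of (l - |w|)^2 *)
have key (l : R) : 2 * l * a <= l ^+ 2 * M + A.
  rewrite /a -RintegralZl // -(Rintegral_cst _ mS) // -RintegralD //.
  apply: le_Rintegral => //.
  - by have := integrableZl mS (2 * l) ia; apply: eq_integrable.
  - by have := integrableD mS (ic (l ^+ 2)) iw2; apply: eq_integrable.
  - move=> x _ /=; rewrite -[w x ^+ 2]real_normK ?num_real //.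
    have := sqr_ge0 (l - `|w x|); nra.
have [M0'|Mn0] := eqVneq M 0.
  have a0 : 0 <= a by apply: Rintegral_ge0.
  have [->|an0] := eqVneq a 0; first by rewrite expr0n M0' mul0r.
  have A0 : 0 <= A by apply: Rintegral_ge0 => x _; exact: sqr_ge0.
  have := key ((A + 1) / a); rewrite M0' mulr0 add0r -mulrA divfK // => h.
  by exfalso; lra.
have Mp : 0 < M by rewrite lt_neqAle eq_sym Mn0.
have := key (a / M); rewrite -(ler_pM2r Mp).
have -> : 2 * (a / M) * a * M = 2 * a ^+ 2 by field.
have -> : ((a / M) ^+ 2 * M + A) * M = a ^+ 2 + M * A by field.
by lra.
Qed.

End cauchy_schwarz.

Lemma measurable_enorm : measurable_fun [set: RR] (@enorm R : RR -> R).
Proof.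
apply: continuous_measurable2 => x.
have h : (fun z : R * R => dot z z) @ x --> dot x x.
  by apply: cvgD; apply: cvgM; do ?[exact: cvg_fst|exact: cvg_snd].
exact: (continuous_comp h (@sqrt_continuous R _)).
Qed.

Lemma measurable_kernel (p : R) :
  measurable_fun [set: (RR * RR)%type] (fun z => enorm ((z.1 : R * R) - z.2) `^ p).
Proof.
apply: (measurableT_comp (measurable_powR p)).
have m11 := measurableT_comp (@measurable_fst _ _ (measurableTypeR R) (measurableTypeR R)) (@measurable_fst _ _ RR RR).
have m12 := measurableT_comp (@measurable_snd _ _ (measurableTypeR R) (measurableTypeR R)) (@measurable_fst _ _ RR RR).
have m21 := measurableT_comp (@measurable_fst _ _ (measurableTypeR R) (measurableTypeR R)) (@measurable_snd _ _ RR RR).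
have m22 := measurableT_comp (@measurable_snd _ _ (measurableTypeR R) (measurableTypeR R)) (@measurable_snd _ _ RR RR).
have H : measurable_fun setT (fun z : RR * RR => ((z.1.1 - z.2.1, z.1.2 - z.2.2) : RR)).
  by apply: measurable_fun_pair; apply: measurable_funB.
exact: measurableT_comp measurable_enorm H.
Qed.

Lemma gagliardo_ge0 (t : R) (G : set (R * R)) (f : R * R -> R) : (0 <= gagliardo t G f)%E.
Proof.
apply: integral_ge0 => x _; apply: integral_ge0 => y _.
by rewrite lee_fin mulr_ge0 ?sqr_ge0 // invr_ge0 powR_ge0.
Qed.

Lemma le_gagliardo (t : R) (S G : set (R * R)) (f : R * R -> R) : S `<=` G ->
  (gagliardo t S f <= gagliardo t G f)%E.
Proof.
have k0 (x y : R * R) : (0 <= ((f x - f y) ^+ 2 / enorm (x - y) `^ (2 + 2 * t))%:E)%E.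
  by rewrite lee_fin mulr_ge0 ?sqr_ge0 // invr_ge0 powR_ge0.
move=> SG; apply: ge0_le_integral_any => // [x _|x _|x Sx].
- by apply: integral_ge0 => y _; exact: k0.
- by apply: integral_ge0 => y _; exact: k0.
- by apply: ge0_le_integral_any => // y _; exact: k0.
Qed.

(** The plane is exhausted by squares; this is what Tonelli's theorem needs
    when it is applied to the product of two planes. *)
Lemma leb2_sigma_finite_measure :
  exists m : {sigma_finite_measure set RR -> \bar R}, forall A, m A = leb2 A.
Proof.
have sf : sigma_finite setT (leb2 : set RR -> \bar R).
  exists (fun n => `[(- n%:R)%R, n%:R] `*` `[(- n%:R)%R, n%:R]).
    apply/seteqP; split => // x _.
    exists (Num.bound (`|x.1| + `|x.2|)) => //.
    have := archi_boundP (addr_ge0 (normr_ge0 x.1) (normr_ge0 x.2)).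
    set N := _%:R => h; split; rewrite /= in_itv /= -ler_norml ltW //; apply: le_lt_trans h.
      by rewrite lerDl.
    by rewrite lerDr.
  move=> n; split; first by apply: measurableX; exact: measurable_itv.
  rewrite product_measure1E //= lebesgue_measure_itv /=.
  by case: ifP => _; rewrite ?mul0e // -EFinB -EFinM ltry.
pose m := HB.pack_for (SigmaFiniteMeasure.type RR R) (Measure.sort (leb2 : {measure set RR -> \bar R}))
  (Measure_isSigmaFinite.Build _ RR R leb2 sf).
by exists m.
Qed.

Section sum_gagliardo.
Variables (t : R) (Om : set (R * R)) (w : R * R -> R).
Hypotheses (mOm : measurable (Om : set RR)) (mw : measurable_fun (Om : set RR) (w : RR -> R)).

Let K (x y : R * R) := ((w x - w y) ^+ 2 / enorm (x - y) `^ (2 + 2 * t))%:E.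

Let K0 x y : (0 <= K x y)%E.
Proof. by rewrite lee_fin mulr_ge0 ?sqr_ge0 // invr_ge0 powR_ge0. Qed.

Let H (x : R * R) : \bar R := (\int[leb2]_(y in Om) K x y)%E.

Let H0 x : (0 <= H x)%E. Proof. by apply: integral_ge0 => y _; exact: K0. Qed.

Let mH : measurable_fun (Om : set RR) (H : RR -> _).
Proof.
pose wO : RR -> R := w \_ Om.
have mwO : measurable_fun setT wO by apply/(measurable_restrictT _ mOm).
pose K' (z : RR * RR) : \bar R :=
  (((wO z.1 - wO z.2) ^+ 2 / enorm ((z.1 : R * R) - z.2) `^ (2 + 2 * t)) * \1_Om z.2)%:E.
have mK' : measurable_fun setT K'.
  apply/measurable_EFinP; apply: measurable_funM; last first.
    apply: (measurableT_comp _ measurable_snd); exact: measurable_indic.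
  apply: measurable_funM.
    apply: measurable_funX; apply: measurable_funB.
      exact: measurableT_comp mwO measurable_fst.
    exact: measurableT_comp mwO measurable_snd.
  under [X in measurable_fun _ X]funext do rewrite -powRN.
  exact: measurable_kernel.
have K'0 z : (0 <= K' z)%E.
  by rewrite lee_fin mulr_ge0 // mulr_ge0 ?sqr_ge0 // invr_ge0 powR_ge0.
have [m mE] := leb2_sigma_finite_measure.
have := measurable_fun_fubini_tonelli_F (m2 := m) _ mK' K'0.
move=> /(measurable_funTS (D := Om)); apply: eq_measurable_fun => x /set_mem Ox.
rewrite /fubini_F /H [RHS]integral_mkcond.
transitivity (\int[leb2]_y K' (x, y))%E.
  by apply: eq_measure_integral => A mA _; exact: mE.
apply: eq_integral => y _.
rewrite /patch /K' /K /wO /patch /= indicE (mem_set Ox).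
by case: ifP => _; rewrite ?mulr1 ?mulr0.
Qed.

(** The double integral over S i x S i is at most the one over S i x Om, and
    a point x is counted at most k times. *)
Lemma sum_gagliardo_le (I : finType) (S : I -> set (R * R)) (k : nat) :
  (forall i, measurable (S i : set RR)) -> (forall i, S i `<=` Om) ->
  (forall x, \sum_i \1_(S i) x <= k%:R :> R) ->
  (\sum_i gagliardo t (S i) w <= k%:R%:E * gagliardo t Om w)%E.
Proof.
move=> mS SO Sk.
have t0 i x : (0 <= (\1_(S i) x)%:E * H x)%E.
  by apply: mule_ge0 (H0 x); rewrite lee_fin indicE ler0n.
apply: (@le_trans _ _ (\sum_i \int[leb2]_(x in Om) ((\1_(S i) x)%:E * H x))%E).
  apply: lee_sum => i _.
  apply: ge0_le_integral_any => [x _|x _||x Sx].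
  - by apply: integral_ge0 => y _; exact: K0.
  - exact: t0.
  - exact: SO.
  - rewrite indicE mem_set // mul1e.
    by apply: ge0_le_integral_any => // y _; exact: K0.
have mi i : measurable_fun Om (fun x : RR => (\1_(S i) x)%:E * H x)%E.
  apply: emeasurable_funM => //; apply/measurable_EFinP.
  exact: (@measurable_indic _ RR R Om (S i) (mS i)).
rewrite -ge0_integral_sum; [|exact: mOm|exact: mi|by move=> i x _; exact: t0].
rewrite -ge0_integralZl; [|exact: mOm|exact: mH|by move=> x _; exact: H0|by rewrite lee_fin].
apply: ge0_le_integral_any => [x _|x _||x Ox].
- by apply: sume_ge0 => i _; exact: t0.
- by apply: mule_ge0 (H0 x); rewrite lee_fin.
- by [].
rewrite -ge0_sume_distrl; last by move=> i _; rewrite lee_fin.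
by rewrite sumEFin; apply: lee_wpmul2r; [exact: H0|rewrite lee_fin].
Qed.

End sum_gagliardo.

Section mean_zero.
Variables (t M D : R) (S : set (R * R)) (w psi : R * R -> R).
Hypotheses (mS : measurable (S : set RR)) (Sfin : (leb2 (S : set RR) < +oo)%E).
Hypotheses (mw : measurable_fun (S : set RR) (w : RR -> R)).
Hypotheses (w2 : (L2sq S w < +oo)%E).
Hypotheses (mpsi : measurable_fun (S : set RR) (psi : RR -> R)).
Hypotheses (M0 : 0 < M) (psiM : forall x, S x -> `|psi x| <= M).
Hypotheses (psi0 : \int[leb2]_(x in S) psi x = 0).
Hypotheses (t0 : 0 < t) (D0 : 0 < D) (SD : forall x y, S x -> S y -> enorm (x - y) <= D).

Let iw : leb2.-integrable S (EFin \o w).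
Proof. exact: integrable_of_sqr. Qed.

Let ic c : leb2.-integrable S (EFin \o (fun=> c : R)).
Proof. exact: integrable_cst_fin. Qed.

Lemma integrableM_bounded f : leb2.-integrable S (EFin \o f) ->
  leb2.-integrable S (EFin \o (fun x => f x * psi x)).
Proof.
move=> fi; have mf : measurable_fun S f by apply/measurable_EFinP; exact: measurable_int fi.
apply: (le_integrable mS _ _ (integrableZl mS M fi)).
  by apply/measurable_EFinP; exact: measurable_funM.
move=> x Sx; rewrite /= lee_fin !normrM (ger0_norm (ltW M0)) mulrC.
by rewrite ler_wpM2r // psiM.
Qed.

(** For each x in S the integral of w psi equals that of (w - w x) psi. By the
    Cauchy-Schwarz inequality its square is at most M^2 |S| times the integral
    of (w - w x)^2, in which a factor |x - y|^-p costs D^p. Averaging over x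
    gives the seminorm, and the factors |S| cancel. *)
Lemma mean_zero_gagliardo :
  (((\int[leb2]_(x in S) (w x * psi x)) ^+ 2)%:E <=
    (M ^+ 2 * D `^ (2 + 2 * t))%:E * gagliardo t S w)%E.
Proof.
set I := \int[leb2]_(x in S) _.
set m := fine (leb2 (S : set RR)).
have mE : leb2 (S : set RR) = m%:E by rewrite fineK // ge0_fin_numE.
have m0 : 0 <= m by exact: fine_ge0.
have [mz|mn] := eqVneq m 0.
  have -> : I = 0.
    have Im : measurable_fun (S : set RR) (EFin \o (fun x => w x * psi x)).
      exact: measurable_int (integrableM_bounded iw).
    by rewrite /I /Rintegral null_set_integral // [LHS]mE mz.
  by rewrite expr0n mule_ge0 ?gagliardo_ge0 // lee_fin mulr_ge0 ?sqr_ge0 ?powR_ge0.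
have mp : 0 < m by rewrite lt_neqAle eq_sym mn.
set p := 2 + 2 * t; have p0 : 0 < p by rewrite /p addr_gt0 // mulr_gt0.
set k := M ^+ 2 * m * D `^ p.
have k0 : 0 < k by rewrite /k !mulr_gt0 // ?exprn_gt0 // powR_gt0.
have main x : S x -> ((I ^+ 2 / k)%:E <=
    \int[leb2]_(y in S) ((w x - w y) ^+ 2 / enorm (x - y) `^ p)%:E)%E.
  move=> Sx; set g := fun y => w x - w y.
  have ig : leb2.-integrable S (EFin \o g).
    by have := integrableB mS (ic (w x)) iw; apply: eq_integrable.
  have mg : measurable_fun (S : set RR) (g : RR -> R).
    by apply/measurable_EFinP; exact: measurable_int ig.
  (* as psi has mean zero, w may be replaced by w - w x *)
  have IE : I = - \int[leb2]_(y in S) (g y * psi y).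
    rewrite /g; under [in RHS]eq_Rintegral do rewrite mulrBl.
    rewrite RintegralB //; first last.
    - exact: integrableM_bounded.
    - exact: (integrableM_bounded (ic (w x))).
    rewrite RintegralZl // ?psi0 ?mulr0 ?sub0r ?opprK //.
    by have := integrableM_bounded (ic 1); apply: eq_integrable => // z _; rewrite /= mul1r.
  have g2 : (\int[leb2]_(y in S) ((g y) ^+ 2)%:E < +oo)%E.
    have i2 : leb2.-integrable S (EFin \o (fun y => 2 * (w x) ^+ 2 + 2 * (w y) ^+ 2)).
      have h := integrableZl mS 2 (integrable_sqr mw w2).
      by have := integrableD mS (ic (2 * (w x) ^+ 2)) h; apply: eq_integrable.
    have i3 : leb2.-integrable S (EFin \o (fun y => g y ^+ 2)).
      apply: (le_integrable mS _ _ i2); first exact/measurable_EFinP/measurable_funX.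
      move=> y _; rewrite /= lee_fin ger0_norm ?sqr_ge0 //.
      apply: le_trans (ler_norm _); rewrite /g; have := sqr_ge0 (w x + w y); nra.
    have := integrable_lty mS i3.
    by [].
  have cs := Rintegral_norm_sqr_le mS Sfin mg g2.
  have Ile : `|I| <= M * \int[leb2]_(y in S) `|g y|.
    rewrite IE normrN (le_trans (le_normr_Rintegral mS _)) //.
      exact: integrableM_bounded.
    rewrite -RintegralZl //; last exact: integrable_norm.
    apply: le_Rintegral => //.
    - apply: integrable_norm; exact: integrableM_bounded.
    - by have := integrableZl mS M (integrable_norm ig); apply: eq_integrable.
    - by move=> y Sy; rewrite normrM mulrC ler_wpM2r // psiM.
  have I2 : I ^+ 2 <= M ^+ 2 * m * \int[leb2]_(y in S) (g y) ^+ 2.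
    rewrite -[I ^+ 2]real_normK ?num_real //.
    apply: (@le_trans _ _ ((M * \int[leb2]_(y in S) `|g y|) ^+ 2)).
      have G0 : 0 <= M * \int[leb2]_(y in S) `|g y|.
        by apply: mulr_ge0; [exact: ltW|exact: Rintegral_ge0].
      by rewrite ler_sqr // nnegrE.
    by rewrite exprMn -mulrA ler_wpM2l ?sqr_ge0.
  apply: (@le_trans _ _ (\int[leb2]_(y in S) ((D `^ p)^-1%:E * (g y ^+ 2)%:E))%E).
    have ig2 := integrable_sqr mg g2.
    rewrite integralZl //.
    rewrite -(fineK (integrable_fin_num mS ig2)) -EFinM lee_fin.
    rewrite ler_pdivrMr //; apply: (le_trans I2).
    rewrite /k -[X in X <= _]mul1r le_eqVlt; apply/orP; left; apply/eqP.
    rewrite -[\int[leb2]_(y in S) _]/(fine _); set X := fine _.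
    by field; rewrite gt_eqF // powR_gt0.
  apply: ge0_le_integral_any => // [y _|y _|y Sy].
  - by rewrite -EFinM lee_fin; apply: mulr_ge0; rewrite ?invr_ge0 ?powR_ge0 ?sqr_ge0.
  - by rewrite lee_fin mulr_ge0 ?sqr_ge0 // invr_ge0 powR_ge0.
  rewrite -EFinM lee_fin mulrC /g.
  have [<-|xy] := eqVneq x y; first by rewrite subrr expr0n !mul0r.
  have e0 : 0 < enorm (x - y).
    rewrite sqrtr_gt0 /dot -!expr2 lt_neqAle addr_ge0 ?sqr_ge0 // andbT eq_sym.
    rewrite paddr_eq0 ?sqr_ge0 // !sqrf_eq0 /= !subr_eq0.
    by apply: contra xy => /andP[/eqP h1 /eqP h2]; apply/eqP/injective_projections.
  rewrite ler_wpM2l ?sqr_ge0 // lef_pV2 ?posrE ?powR_gt0 //.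
  apply: ge0_ler_powR; [exact: ltW|by rewrite nnegrE ltW|by rewrite nnegrE ltW|exact: SD].
have : (\int[leb2]_(x in S) (I ^+ 2 / k)%:E <= gagliardo t S w)%E.
  apply: ge0_le_integral_any => //.
  - by move=> x _; rewrite lee_fin divr_ge0 ?sqr_ge0 // ltW.
  - by move=> x _; apply: integral_ge0 => y _; rewrite lee_fin mulr_ge0 ?sqr_ge0 // invr_ge0 powR_ge0.
rewrite integral_cst // [X in (_ * X)%E]mE -EFinM.
have -> : I ^+ 2 / k * m = I ^+ 2 / (M ^+ 2 * D `^ p).
  rewrite /k; field; rewrite mn !gt_eqF // ?powR_gt0 //.
have c0 : 0 < M ^+ 2 * D `^ p by rewrite mulr_gt0 ?exprn_gt0 // powR_gt0.
move=> h; have := lee_wpmul2l (ltW c0 : (0 <= (M ^+ 2 * D `^ p)%:E)%E) h.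
by rewrite -EFinM mulrCA divff ?mulr1 // gt_eqF.
Qed.

End mean_zero.
End integral_bounds.

(** * The very weak form of the equation *)

Section weak_formula.
Context {R : realType}.
Local Notation mu := (@lebesgue_measure R).
Local Notation leb2 := (mu \x mu)%E.
Local Notation RR := (measurableTypeR R * measurableTypeR R)%type.
Implicit Types (Om : set (R * R)) (u phi : R * R -> R).

Lemma pderiv0 i j : pderiv i j (fun=> 0 : R) = (fun=> 0).
Proof.
have H k (w : R * R) : iter k (fun g => 'D_w g) (fun=> 0 : R) = (fun=> 0).
  by elim: k => //= k ->; apply/funext => x; exact: derive_cst.
by rewrite /pderiv !H.
Qed.

Lemma L2sq0 Om : L2sq Om (fun=> 0) = 0%E.
Proof. by apply: integral0_eq => x _; rewrite expr0n. Qed.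

Lemma gagliardo0 (t : R) Om : gagliardo t Om (fun=> 0) = 0%E.
Proof.
apply: integral0_eq => x _; apply: integral0_eq => y _.
by rewrite subrr expr0n mul0r.
Qed.

Lemma hnorm0 n (t : R) Om : hnorm n t Om (fun=> 0) = 0%E.
Proof.
rewrite /hnorm big1 => [|i _]; last by apply: big1 => j _; rewrite pderiv0 L2sq0.
rewrite big1 => [|i _]; last by rewrite pderiv0 gagliardo0.
by rewrite adde0 poweR0r // gt_eqF // invr_gt0.
Qed.

Lemma H0_cvg_cst n (t : R) Om phi : test_fun Om phi -> H0_cvg n t Om (fun=> phi) phi.
Proof.
move=> tphi; have E : phi \- phi = (fun=> 0) by apply/funext => x; rewrite /= subrr.
split => //.
- by move=> e e0; exists 0%N => j k _ _; rewrite E hnorm0 lte_fin.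
- by rewrite E L2sq0; exact: cvg_cst.
Qed.

Lemma bounded_box Om : bounded_set Om -> exists M : R, 0 < M /\ Om `<=` box M.
Proof.
move=> [M [_ HM]]; exists (`|M| + 1); split; first by rewrite ltr_wpDl.
have M1 : M < `|M| + 1 by rewrite (le_lt_trans (ler_norm _)) // ltrDl.
move=> x Ox; have /= H := HM _ M1 x Ox.
by split; rewrite /= in_itv /= -ler_norml; apply: le_trans H;
  rewrite [leRHS]/Num.norm /= le_max lexx ?orbT.
Qed.

Lemma measure_box (M : R) : (leb2 (box M : set RR) < +oo)%E.
Proof.
rewrite product_measure1E //= lebesgue_measure_itv /=.
by case: ifP => _; rewrite ?mul0e // -EFinB -EFinM ltry.
Qed.

Lemma measurable_box (M : R) : measurable (box M : set RR).
Proof. by apply: measurableX; exact: measurable_itv. Qed.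

Lemma bounded_measure Om : measurable (Om : set RR) -> bounded_set Om ->
  (leb2 (Om : set RR) < +oo)%E.
Proof.
move=> mO /bounded_box[M [_ OM]]; apply: (le_lt_trans _ (measure_box M)).
apply: le_measure => //; rewrite ?inE //; exact: measurable_box.
Qed.

Definition support (phi : R * R -> R) := closure [set x | phi x != 0].

Lemma notin_support phi x : ~ support phi x -> phi x = 0.
Proof.
move=> h; apply/eqP/negP => /negP n0; apply: h; exact: subset_closure.
Qed.

Lemma laplacian_support phi x : ~ support phi x -> laplacian phi x = 0.
Proof.
have cs : closed (support phi) by exact: closed_closure.
move=> nx; rewrite /laplacian /pderiv /=.
have h1 := near0_derive ((1, 0) : R * R) cs (@notin_support phi).
have h2 := near0_derive ((0, 1) : R * R) cs (@notin_support phi).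
by rewrite (near0_derive _ cs h1 nx) (near0_derive _ cs h2 nx) addr0.
Qed.

Lemma continuous_laplacian phi : smooth phi -> continuous (laplacian phi).
Proof.
move=> sp; have [_ _ _ s1 s2] := smooth_dir sp.
have [_ _ _ s11 _] := smooth_dir s1; have [_ _ _ _ s22] := smooth_dir s2.
have [c1 _ _ _ _] := smooth_dir s11; have [c2 _ _ _ _] := smooth_dir s22.
by move=> x; apply: cvgD; [exact: c1|exact: c2].
Qed.

Lemma Rintegral_supp Om (f : R * R -> R) : (forall x, ~ Om x -> f x = 0) ->
  \int[leb2]_(x in Om) f x = \int[leb2]_x f x.
Proof.
move=> f0; rewrite Rintegral_mkcond; congr (Rintegral _ _ _).
apply/funext => x; rewrite /patch; case: ifPn => // /negP h.
by rewrite f0 // => Ox; apply: h; rewrite inE.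
Qed.

Lemma Bform_test Om v phi : test_fun Om v -> test_fun Om phi ->
  Bform Om v phi = - \int[leb2]_(x in Om) (v x * laplacian phi x).
Proof.
move=> [sv cv vO] [sp _ _].
have f0 x : ~ Om x -> v x = 0 by move=> nO; apply: notin_support => /vO.
have g0 x : ~ Om x -> dot (grad v x) (grad phi x) = 0.
  move=> nO; have nK : ~ support v x by move=> /vO.
  have cs : closed (support v) by exact: closed_closure.
  rewrite /dot /grad /=.
  rewrite (near0_derive ((1, 0) : R * R) cs (@notin_support v) nK).
  by rewrite (near0_derive ((0, 1) : R * R) cs (@notin_support v) nK) !mul0r addr0.
have fl0 x : ~ Om x -> v x * laplacian phi x = 0 by move=> nO; rewrite f0 // mul0r.
rewrite /Bform (Rintegral_supp g0) (Rintegral_supp fl0).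
exact: (green_compact cv sv sp (@notin_support v)).
Qed.

Lemma L2sq_test Om v : measurable (Om : set RR) -> (leb2 (Om : set RR) < +oo)%E ->
  test_fun Om v -> (L2sq Om v < +oo)%E.
Proof.
move=> mO Ofin [sv cv vO]; have [cv' _ _ _ _] := smooth_dir sv.
have c2 : continuous (fun x => v x ^+ 2).
  by move=> x; exact: (continuous_comp (cv' x) (@exprn_continuous R 2 _)).
have i2 : leb2.-integrable [set: RR] (EFin \o (fun x => v x ^+ 2)).
  by apply: (continuous_integrable cv c2) => x /notin_support ->; rewrite expr0n.
have := integrable_lty measurableT i2.
apply: le_lt_trans; apply: ge0_le_integral_any => //.
- by move=> x _; rewrite lee_fin sqr_ge0.
- by move=> x _; rewrite /= lee_fin sqr_ge0.
Qed.

(** Approximating u by test functions v_k, Green's formula turns the form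
    B(v_k, phi) into minus the integral of v_k times the Laplacian of phi, and
    the latter passes to the limit because v_k tends to u in L^2. Hence the
    extended form tests u against Laplacians only. *)
Lemma weak_laplacian (th : R) Om u phi (b : R) :
  open Om -> bounded_set Om -> H0 0 (1 - th) Om u -> test_fun Om phi ->
  Bext th Om u phi b ->
  (L2sq Om u < +oo)%E /\ \int[leb2]_(x in Om) (u x * laplacian phi x) = - b.
Proof.
move=> oO bO [mu_u [vk Hvk]] tphi /(_ vk (fun=> phi) Hvk (H0_cvg_cst 1 th tphi)) cvb.
have mO := open_measurable2 oO; have Ofin := bounded_measure mO bO.
have [tvk _ cv0] := Hvk.
have mvk k : measurable_fun (Om : set RR) (vk k : RR -> R).
  have [/smooth_dir[cv _ _ _ _] _ _] := tvk k.
  by apply: measurable_funTS; exact: continuous_measurable2.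
have [sp cp _] := tphi; have cl := continuous_laplacian sp.
have ml : measurable_fun (Om : set RR) (laplacian phi : RR -> R).
  by apply: measurable_funTS; exact: continuous_measurable2.
have [B [B0 HB]] := continuous_compact_bound cl cp.
have lB x : Om x -> `|laplacian phi x| <= B.
  move=> _; have [/HB/ltW //|/laplacian_support ->] := pselect (support phi x).
  by rewrite normr0 ltW.
pose wk k x := vk k x - u x.
have mwk k : measurable_fun (Om : set RR) (wk k : RR -> R) by exact: measurable_funB.
have [fin fc] := (fine_cvgP _ _).1 cv0.
set I := \int[leb2]_(x in Om) _.
set m := fine (leb2 (Om : set RR)).
have m0 : 0 <= m by exact: fine_ge0.
have k0 : forall k, L2sq Om (wk k) \is a fin_num -> (L2sq Om (wk k) < +oo)%E.
  by move=> k; rewrite ge0_fin_numE //; apply: integral_ge0 => x _; rewrite lee_fin sqr_ge0.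
have u2 : (L2sq Om u < +oo)%E.
  have [k /k0 fk] := filter_ex fin.
  have i1 := integrable_sqr (mwk k) fk.
  have i2 := integrable_sqr (mvk k) (L2sq_test mO Ofin (tvk k)).
  have i3 : leb2.-integrable Om (EFin \o (fun x => 2 * (vk k x) ^+ 2 + 2 * (wk k x) ^+ 2)).
    have h := integrableD mO (integrableZl mO 2 i2) (integrableZl mO 2 i1).
    by move: h; apply: eq_integrable.
  have i4 : leb2.-integrable Om (EFin \o (fun x => u x ^+ 2)).
    apply: (le_integrable mO _ _ i3); first exact/measurable_EFinP/measurable_funX.
    move=> x _; rewrite /= lee_fin ger0_norm ?sqr_ge0 //.
    apply: le_trans (ler_norm _); rewrite /wk.
    have := sqr_ge0 (2 * vk k x - u x); nra.
  have := integrable_lty mO i4.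
  by [].
split=> //.
have bound k : L2sq Om (wk k) \is a fin_num ->
    (Bform Om (vk k) phi + I) ^+ 2 <= B ^+ 2 * m * fine (L2sq Om (wk k)).
  move=> /k0 fk.
  have iv := integrable_of_sqr mO Ofin (mvk k) (L2sq_test mO Ofin (tvk k)).
  have iu := integrable_of_sqr mO Ofin mu_u u2.
  have iw := integrable_of_sqr mO Ofin (mwk k) fk.
  have -> : Bform Om (vk k) phi + I = - \int[leb2]_(x in Om) (wk k x * laplacian phi x).
    rewrite Bform_test // /I /wk; under [in RHS]eq_Rintegral do rewrite mulrBl.
    rewrite (RintegralB mO).
    - by rewrite opprB addrC.
    - exact: (integrableM_bounded mO ml B0 lB iv).
    - exact: (integrableM_bounded mO ml B0 lB iu).
  have iwl := integrableM_bounded mO ml B0 lB iw.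
  have Ile : `|\int[leb2]_(x in Om) (wk k x * laplacian phi x)| <=
      B * \int[leb2]_(x in Om) `|wk k x|.
    rewrite (le_trans (le_normr_Rintegral mO iwl)) //.
    rewrite -RintegralZl //; last exact: integrable_norm.
    apply: (le_Rintegral mO).
    - exact: integrable_norm iwl.
    - by have := integrableZl mO B (integrable_norm iw); apply: eq_integrable.
    - by move=> y Oy; rewrite normrM mulrC ler_wpM2r // lB.
  rewrite sqrrN -[X in X <= _]real_normK ?num_real //.
  apply: (@le_trans _ _ ((B * \int[leb2]_(x in Om) `|wk k x|) ^+ 2)).
    have G0 : 0 <= B * \int[leb2]_(x in Om) `|wk k x|.
      by apply: mulr_ge0; [exact: ltW|exact: Rintegral_ge0].
    by rewrite ler_sqr // nnegrE.
  rewrite exprMn -mulrA; apply: ler_wpM2l; first exact: sqr_ge0.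
  exact: (Rintegral_norm_sqr_le mO Ofin (mwk k) fk).
have c1 : (fun k => (Bform Om (vk k) phi + I) ^+ 2) @ \oo --> (b + I) ^+ 2.
  have c0 : (fun k => Bform Om (vk k) phi + I) @ \oo --> b + I by apply: cvgD cvb _; exact: cvg_cst.
  exact: (cvgM c0 c0).
have c2 : (fun k => (Bform Om (vk k) phi + I) ^+ 2) @ \oo --> (0 : R).
  apply: (@squeeze_cvgr _ _ _ _ (fun=> 0) (fun k => B ^+ 2 * m * fine (L2sq Om (wk k)))).
  - near=> k; rewrite sqr_ge0 /= bound //; near: k; exact: fin.
  - exact: cvg_cst.
  - rewrite -[X in _ --> X](mulr0 (B ^+ 2 * m)); apply: cvgM => //; exact: cvg_cst.
have bI : (b + I) ^+ 2 = 0 by exact: (cvg_unique (@Rhausdorff R) c1 c2).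
by move/eqP: bI; rewrite sqrf_eq0 addrC addr_eq0 => /eqP.
Unshelve. all: by end_near. Qed.

End weak_formula.

(** * Orthogonal frames and barycentric coordinates *)

Section frame.
Context {R : realType}.
Local Notation RR := (measurableTypeR R * measurableTypeR R)%type.
Implicit Types (a d e x y z : R * R).

Definition cross x y : R := x.1 * y.2 - x.2 * y.1.
(** Dividing by the squared length makes the coordinate along d of the point
    a + d equal to 1. *)
Definition dual_vec d : R * R := (dot d d)^-1 *: d.
Definition coord a d x : R := dot (dual_vec d) x + - dot (dual_vec d) a.

Lemma coordE a d x : coord a d x = dot d (x - a) / dot d d.
Proof. by rewrite /coord /dual_vec /dot /= /GRing.scale /=; ring. Qed.

Lemma dotC x y : dot x y = dot y x.
Proof. by rewrite /dot mulrC (mulrC x.2). Qed.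

Lemma dot_ge0 x : 0 <= dot x x.
Proof. by rewrite /dot -!expr2 addr_ge0 ?sqr_ge0. Qed.

Lemma dot_eq0 x : dot x x = 0 -> x = 0.
Proof.
move=> /eqP; rewrite /dot -!expr2 paddr_eq0 ?sqr_ge0 // !sqrf_eq0 => /andP[/eqP h1 /eqP h2].
exact: injective_projections.
Qed.

Lemma lagrange x y : cross x y ^+ 2 = dot x x * dot y y - dot x y ^+ 2.
Proof. rewrite /cross /dot; ring. Qed.

Section axes.
Variables (a d e : R * R).
Hypotheses (de : dot d e = 0) (ee : dot e e = dot d d) (d0 : 0 < dot d d).

Definition inv_frame x : R * R := (coord a d x, coord a e x).

(** Two orthogonal axes of equal length span a square. *)
Lemma cross_frame : `|cross d e| = dot d d.
Proof.
apply/eqP; rewrite -(@eqrXn2 _ 2) ?normr_ge0 ?ltW //.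
by rewrite real_normK ?num_real // lagrange de ee expr0n subr0 expr2.
Qed.

Lemma cross_frame_neq0 : cross d e != 0.
Proof. by rewrite -normr_gt0 cross_frame. Qed.

Lemma inv_frameK p : inv_frame (aff a d e p) = p.
Proof.
have E : aff a d e p - a = p.1 *: d + p.2 *: e.
  by rewrite /aff; apply: injective_projections; rewrite /= /GRing.scale /=; ring.
apply: injective_projections; rewrite /inv_frame /= coordE E dotDr !dotZr.
  by rewrite de mulr0 addr0 mulfK // gt_eqF.
by rewrite (dotC e d) de mulr0 add0r ee mulfK // gt_eqF.
Qed.

Lemma affK x : aff a d e (inv_frame x) = x.
Proof.
have D0 := cross_frame_neq0.
have E1 : dot d d != 0 by rewrite gt_eqF.
(* the components of x - a orthogonal to both axes vanish *)
have E := inv_frameK (inv_frame x).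
set y := aff _ _ _ _ in E *.
have [h1 h2] : dot d (y - x) = 0 /\ dot e (y - x) = 0.
  move: E; rewrite /inv_frame => -[].
  rewrite !coordE ee => /(divIf E1) k1 /(divIf E1) k2.
  split; [move: k1|move: k2]; rewrite /dot /= => k; lra.
have c1 : cross d e * (y - x).1 = 0.
  transitivity (e.2 * dot d (y - x) - d.2 * dot e (y - x)); first by rewrite /cross /dot; ring.
  by rewrite h1 h2 !mulr0 subr0.
have c2 : cross d e * (y - x).2 = 0.
  transitivity (d.1 * dot e (y - x) - e.1 * dot d (y - x)); first by rewrite /cross /dot; ring.
  by rewrite h1 h2 !mulr0 subr0.
apply/eqP; rewrite -subr_eq0; apply/eqP; apply: injective_projections => /=.
  by move/eqP: c1; rewrite mulf_eq0 (negbTE D0) /= => /eqP.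
by move/eqP: c2; rewrite mulf_eq0 (negbTE D0) /= => /eqP.
Qed.

Lemma continuous_coord b : continuous (coord a b).
Proof. exact: continuous_dot. Qed.

Lemma measurable_inv_frame : measurable_fun [set: RR] (inv_frame : RR -> RR).
Proof.
exact: (measurable_fun_pair (continuous_measurable2 (@continuous_coord d))
  (continuous_measurable2 (@continuous_coord e))).
Qed.

(** A frame of orthogonal axes of equal length is a similarity. *)
Lemma dot_frame x y :
  dot (x - y) (x - y) = dot d d * ((coord a d x - coord a d y) ^+ 2 + (coord a e x - coord a e y) ^+ 2).
Proof.
have [p ->] : exists p, x = aff a d e p by exists (inv_frame x); rewrite affK.
have [q ->] : exists q, y = aff a d e q by exists (inv_frame y); rewrite affK.
have E1 r : coord a d (aff a d e r) = r.1 := congr1 fst (inv_frameK r).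
have E2 r : coord a e (aff a d e r) = r.2 := congr1 snd (inv_frameK r).
rewrite !E1 !E2.
transitivity ((p.1 - q.1) ^+ 2 * dot d d + (p.2 - q.2) ^+ 2 * dot e e
  + 2 * (p.1 - q.1) * (p.2 - q.2) * dot d e).
  by rewrite /aff /dot /=; ring.
by rewrite de ee mulr0 addr0; ring.
Qed.

End axes.

Implicit Types (T : triangle R) (k : 'I_3).

Lemma ord3E k : [/\ k + 1 + 1 = k + 2, k + 1 + 2 = k, k + 2 + 1 = k & k + 2 + 2 = k + 1].
Proof. by case: k => [[|[|[|//]]] ik]; split; apply/val_inj. Qed.

Lemma sum3E k (V : zmodType) (F : 'I_3 -> V) : \sum_j F j = F k + F (k + 1) + F (k + 2).
Proof.
have E (i j : 'I_3) : val i = val j -> F i = F j by move=> /val_inj ->.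
rewrite !big_ord_recr big_ord0 /= add0r.
case: k => [[|[|[|//]]] ik].
- by congr (_ + _ + _); apply: E.
- rewrite [RHS]addrC addrA; congr (_ + _ + _); exact: E.
- rewrite -[RHS]addrA [RHS]addrC; congr (_ + _ + _); exact: E.
Qed.

Lemma ord3_cases k j : [\/ j = k, j = k + 1 | j = k + 2].
Proof.
case: k => [[|[|[|//]]] ik]; case: j => [[|[|[|//]]] ij];
  by [apply: Or31; apply: val_inj|apply: Or32; apply: val_inj|apply: Or33; apply: val_inj].
Qed.

Lemma tri_detE T k : tri_det T = cross (T (k + 2) - T (k + 1)) (T k - T (k + 1)).
Proof.
have E (i j : 'I_3) : val i = val j -> T i = T j by move=> /val_inj ->.
rewrite /tri_det /cross.
case: k => [[|[|[|//]]] ik].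
- have -> : T (Ordinal ik + 2) = T 2 by exact: E.
  have -> : T (Ordinal ik + 1) = T 1 by exact: E.
  have -> : T (Ordinal ik) = T 0 by exact: E.
  by ring.
- have -> : T (Ordinal ik + 2) = T 0 by exact: E.
  have -> : T (Ordinal ik + 1) = T 2 by exact: E.
  have -> : T (Ordinal ik) = T 1 by exact: E.
  by ring.
- have -> : T (Ordinal ik + 2) = T 1 by exact: E.
  have -> : T (Ordinal ik + 1) = T 0 by exact: E.
  have -> : T (Ordinal ik) = T 2 by exact: E.
  by ring.
Qed.

(** The barycentric coordinate of x at the vertex k, as a ratio of areas. *)
Definition bary T k x := cross (T (k + 2) - T (k + 1)) (x - T (k + 1)) / tri_det T.

(** For a nondegenerate triangle this is the interior of [tri_set]. *)
Definition tri_int T : set (R * R) := [set x | forall k, 0 < bary T k x].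

Lemma bary_affine T (lam : 'I_3 -> R) k : tri_det T != 0 -> \sum_j lam j = 1 ->
  bary T k (\sum_j lam j *: T j) = lam k.
Proof.
move=> D0; rewrite !(sum3E k) => l1; rewrite /bary.
have <- : lam k * tri_det T = cross (T (k + 2) - T (k + 1))
    (lam k *: T k + lam (k + 1) *: T (k + 1) + lam (k + 2) *: T (k + 2) - T (k + 1)).
  have -> : lam (k + 1) = 1 - lam k - lam (k + 2) by rewrite -l1; ring.
  by rewrite (tri_detE T k) /cross /= /GRing.scale /=; ring.
by rewrite mulfK.
Qed.

Lemma sum_bary T x : tri_det T != 0 -> \sum_j bary T j x = 1.
Proof.
move=> D0; rewrite (sum3E 0) /bary.
have [-> -> -> ->] := ord3E 0; rewrite !add0r.
move: D0; rewrite /tri_det /cross => D0; move: (D0) => D1.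
by field.
Qed.

Lemma bary_sum T x : tri_det T != 0 -> \sum_j bary T j x *: T j = x.
Proof.
move=> D0; rewrite (sum3E 0) /bary.
have [-> -> -> ->] := ord3E 0; rewrite !add0r.
move: D0; rewrite /tri_det /cross => D0.
by apply: injective_projections; rewrite /= /GRing.scale /=; field.
Qed.

Lemma tri_setE T x : tri_det T != 0 -> tri_set T x <-> forall k, 0 <= bary T k x.
Proof.
move=> D0; split=> [[lam [l0 l1 ->]] k|h]; first by rewrite bary_affine.
by exists (bary T ^~ x); rewrite sum_bary // bary_sum.
Qed.

Lemma tri_int_sub T : tri_det T != 0 -> tri_int T `<=` tri_set T.
Proof. by move=> D0 x h; apply/tri_setE => // k; exact: ltW. Qed.

Lemma continuous_bary T k : continuous (bary T k).
Proof.
move=> x; apply: cvgM; last exact: cvg_cst.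
by apply: cvgB; apply: cvgM; do ?[exact: cvg_cst|apply: cvgB; do ?[exact: cvg_cst|exact: cvg_fst|exact: cvg_snd]].
Qed.

Lemma open_tri_int T : open (tri_int T).
Proof.
pose P k := bary T k @^-1` `]0, +oo[.
have oP k : open (P k).
  by move/continuousP: (@continuous_bary T k); apply; exact: interval_open.
have -> : tri_int T = P 0 `&` P (0 + 1) `&` P (0 + 2).
  apply/seteqP; split => x; rewrite /P /= !in_itv /= !andbT; first by move=> h; split; [split|].
  by move=> [[h0 h1] h2] k; case: (ord3_cases 0 k) => ->.
by apply: openI => //; exact: openI.
Qed.

Lemma measurable_tri_set T : tri_det T != 0 -> measurable (tri_set T : set RR).
Proof.
move=> D0.
have -> : tri_set T = \bigcap_(k in [set: 'I_3]) (bary T k @^-1` `[0, +oo[).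
  apply/seteqP; split => x.
    by move=> /(tri_setE _ D0) h k _; rewrite /= in_itv /= andbT.
  by move=> h; apply/tri_setE => // k; have := h k I; rewrite /= in_itv /= andbT.
apply: fin_bigcap_measurable; first exact: finite_finset.
move=> k _; rewrite -[X in measurable X]setTI.
by apply: continuous_measurable2 => //; exact: continuous_bary.
Qed.

Lemma edge_bary T k x : tri_det T != 0 -> edge T k x -> bary T k x = 0.
Proof.
move=> D0 [s _ ->]; rewrite /bary /cross /= /GRing.scale /=.
by rewrite [X in X / _](_ : _ = 0) ?mul0r //; ring.
Qed.

Lemma vertex_bary T k : tri_det T != 0 -> bary T (k + 1) (T k) = 0.
Proof.
move=> D0; rewrite /bary; have [-> -> _ _] := ord3E k.
by rewrite [X in X / _](_ : _ = 0) ?mul0r // /cross; ring.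
Qed.

End frame.

(** * Triangles in the frame of an edge *)

Section triangle_frame.
Context {R : realType}.
Local Notation mu := (@lebesgue_measure R).
Local Notation leb2 := (mu \x mu)%E.
Local Notation RR := (measurableTypeR R * measurableTypeR R)%type.
Implicit Types (T : triangle R) (k : 'I_3) (x : R * R).

(** The frame of the edge k of T: the axis along the edge, and the same vector
    turned by a right angle towards the triangle. In the coordinates s and t of
    this frame the edge is the segment from (0, 0) to (1, 0). *)
Definition fd T k : R * R := T (k + 2) - T (k + 1).
Definition fe T k : R * R := Num.sg (tri_det T) *: ((- (fd T k).2, (fd T k).1) : R * R).
Definition fs T k x : R := coord (T (k + 1)) (fd T k) x.
Definition ft T k x : R := coord (T (k + 1)) (fe T k) x.
(** The coordinates of the vertex opposite to the edge k; together with the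
    length of the edge they determine T up to an isometry. *)
Definition zs T k : R := fs T k (T k).
Definition zt T k : R := ft T k (T k).

(** A quantitative form of nondegeneracy in the frames of the three edges: the
    opposite vertex stays in a fixed compact set, and both angles at the ends of
    the edge have tangent at least tau or are not acute. *)
Definition fat (tau : R) T := forall k : 'I_3,
  [/\ 0 < zt T k, tau * zs T k <= zt T k, tau * (1 - zs T k) <= zt T k,
      tau * `|zs T k| <= 1 & tau * zt T k <= 1].

Section one.
Variables (T : triangle R) (k : 'I_3).
Hypothesis D0 : tri_det T != 0.
Let a := T (k + 1).
Let d := fd T k.
Let e := fe T k.

Lemma fd_fe : dot d e = 0.
Proof. by rewrite /dot /e /fe /= /GRing.scale /=; ring. Qed.

Lemma sgr_sqr : Num.sg (tri_det T) ^+ 2 = 1.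
Proof. by rewrite sqr_sg D0. Qed.

Lemma fe_fe : dot e e = dot d d.
Proof.
rewrite -[RHS]mul1r -sgr_sqr /dot /e /fe /= /GRing.scale /= -/d; ring.
Qed.

Lemma fd_gt0 : 0 < dot d d.
Proof.
rewrite lt_neqAle dot_ge0 andbT eq_sym; apply: contra D0 => /eqP/dot_eq0 d0.
by rewrite (tri_detE T k) -/(fd T k) -/d d0 /cross !mul0r subrr.
Qed.

Lemma cross_fd_fe : cross d e = Num.sg (tri_det T) * dot d d.
Proof. by rewrite /cross /dot /e /fe /= /GRing.scale /= -/d; ring. Qed.

Let affx x : x = aff a d e (fs T k x, ft T k x).
Proof. by rewrite (affK a fd_fe fe_fe fd_gt0 x). Qed.

Lemma cross_aff (p q r : R * R) :
  cross (aff a d e p - aff a d e r) (aff a d e q - aff a d e r) =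
  cross (p - r) (q - r) * cross d e.
Proof. by rewrite /cross /aff /=; ring. Qed.

Let fs_a : aff a d e (0, 0) = T (k + 1).
Proof. by rewrite /aff /= !mul0r !addr0 -surjective_pairing. Qed.

Let fs_b : aff a d e (1, 0) = T (k + 2).
Proof. by apply: injective_projections; rewrite /aff /d /fd /a /=; ring. Qed.

Lemma tri_det_frame : tri_det T = zt T k * cross d e.
Proof.
rewrite (tri_detE T k) {1}(affx (T k)) -fs_b -fs_a cross_aff /cross /= -/(zt T k); ring.
Qed.

Lemma zt_gt0 : 0 < zt T k.
Proof.
have E := tri_det_frame; rewrite cross_fd_fe in E.
have : 0 < Num.sg (tri_det T) * tri_det T by rewrite -normrEsg normr_gt0.
move: E sgr_sqr; move: (Num.sg _) => s -> s2.
have -> : s * (zt T k * (s * dot d d)) = s ^+ 2 * (zt T k * dot d d) by ring.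
by rewrite s2 mul1r pmulr_lgt0 // fd_gt0.
Qed.

Lemma cross_fd_fe_neq0 : cross d e != 0.
Proof. by apply: contra D0 => /eqP h; rewrite tri_det_frame h mulr0. Qed.

Lemma bary_k x : bary T k x = ft T k x / zt T k.
Proof.
rewrite /bary {1}(affx x) -fs_b -fs_a cross_aff tri_det_frame.
move: (cross d e) cross_fd_fe_neq0 => c c0; rewrite /cross /=.
by field; rewrite c0 gt_eqF // zt_gt0.
Qed.

Lemma bary_k1 x : bary T (k + 1) x = 1 - fs T k x - ft T k x * (1 - zs T k) / zt T k.
Proof.
rewrite /bary; have [-> -> _ _] := ord3E k.
rewrite {1}(affx x) {1}(affx (T k)) -fs_b cross_aff tri_det_frame.
move: (cross d e) cross_fd_fe_neq0 => c c0; rewrite /cross /= -/(zt T k) -/(zs T k).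
by field; rewrite c0 gt_eqF // zt_gt0.
Qed.

Lemma bary_k2 x : bary T (k + 2) x = fs T k x - ft T k x * zs T k / zt T k.
Proof.
rewrite /bary; have [_ _ -> ->] := ord3E k.
rewrite {1}(affx x) {1 2}(affx (T k)) -fs_a cross_aff tri_det_frame.
move: (cross d e) cross_fd_fe_neq0 => c c0; rewrite /cross /= -/(zt T k) -/(zs T k).
by field; rewrite c0 gt_eqF // zt_gt0.
Qed.

Lemma dot_diff x y : dot (x - y) (x - y) =
  dot d d * ((fs T k x - fs T k y) ^+ 2 + (ft T k x - ft T k y) ^+ 2).
Proof. exact: dot_frame fd_fe fe_fe fd_gt0 x y. Qed.

Lemma fs_base : [/\ fs T k (T (k + 1)) = 0, ft T k (T (k + 1)) = 0,
  fs T k (T (k + 2)) = 1 & ft T k (T (k + 2)) = 0].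
Proof.
have E p := inv_frameK a fd_fe fe_fe fd_gt0 p.
have := E (0, 0); have := E (1, 0); rewrite fs_a fs_b /inv_frame => -[h1 h2] [h3 h4].
by split.
Qed.

(** A strip along the middle of an edge, of height proportional to the edge,
    lies in every fat triangle with that edge. *)
Lemma fat_tri_int tau x : 0 < tau -> fat tau T ->
  1 / 8 < fs T k x < 7 / 8 -> 0 < ft T k x < tau / 8 -> tri_int T x.
Proof.
move=> t0 /(_ k)[z0 zA zB _ _] /andP[s1 s2] /andP[ft0 ft1] j.
have aux (u q : R) : tau * u <= zt T k -> 1 / 8 < q -> ft T k x * u < q * zt T k.
  move=> uz q8; apply: (@lt_le_trans _ _ (8^-1 * zt T k)); last by rewrite ler_pM2r //; lra.
  have [u0|u0] := leP u 0.
    apply: (@le_lt_trans _ _ 0); last by rewrite mulr_gt0.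
    by rewrite mulr_ge0_le0 // ltW.
  apply: (@lt_le_trans _ _ (tau / 8 * u)); first by rewrite ltr_pM2r.
  by rewrite mulrAC mulrC ler_pM2l.
case: (ord3_cases k j) => ->.
- by rewrite bary_k divr_gt0.
- by rewrite bary_k1 subr_gt0 ltr_pdivrMr // aux //; lra.
- by rewrite bary_k2 subr_gt0 ltr_pdivrMr // aux //; lra.
Qed.

(** The barycentric coordinates are at most 1, so the coordinates in the frame
    are controlled by those of the opposite vertex. *)
Lemma fat_tri_set tau x : 0 < tau <= 1 -> fat tau T -> tri_set T x ->
  tau * `|fs T k x| <= 1 /\ tau * `|ft T k x| <= 1.
Proof.
move=> /andP[t0 t1] /(_ k)[z0 _ _ zA zB] /(tri_setE _ D0) h.
have := h k; have := h (k + 1); have := h (k + 2).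
rewrite bary_k bary_k1 bary_k2.
set s := fs T k x; set t := ft T k x; set Z := zt T k in z0 zB *; set S := zs T k in zA *.
have -> : t * (1 - S) / Z = (t / Z) * (1 - S) by field; rewrite gt_eqF.
have -> : t * S / Z = (t / Z) * S by field; rewrite gt_eqF.
have tE : t = (t / Z) * Z by field; rewrite gt_eqF.
set l := t / Z in tE *; rewrite tE => h1 h2 h3.
have l1 : l <= 1 by nra.
move: zA; rewrite -{1}(gtr0_norm t0) -normrM ler_norml => /andP[S1 S2].
split; rewrite -{1}(gtr0_norm t0) -normrM ler_norml; apply/andP; split; nra.
Qed.

End one.

Lemma rect_measure T k (I J : set (measurableTypeR R)) : tri_det T != 0 ->
  measurable I -> measurable J ->
  leb2 ((fun x => (fs T k x, ft T k x)) @^-1` (I `*` J) : set RR) =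
  ((dot (fd T k) (fd T k))%:E * (mu I * mu J))%E.
Proof.
move=> D0 mI mJ.
have h1 := fd_fe T k; have h2 := fe_fe k D0; have h3 := fd_gt0 k D0.
rewrite -(cross_frame h1 h2 h3).
apply: (measure_rect (a := T (k + 1)) (cross_frame_neq0 h1 h2 h3) _ _ mI mJ).
- exact: (inv_frameK (T (k + 1)) h1 h2 h3).
- exact: measurable_inv_frame.
Qed.

(** All sizes in a fat triangle are comparable: its area is at most that of a
    square of side 2/tau times any of the edges. *)
Lemma mesh_size_le tau T k : 0 < tau <= 1 -> tri_det T != 0 -> fat tau T ->
  mesh_size T <= 2 / tau * Num.sqrt (dot (fd T k) (fd T k)).
Proof.
move=> t01 D0 fT; have /andP[t0 t1] := t01.
have d0 := fd_gt0 k D0.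
set L : R := tau^-1.
pose I : set (measurableTypeR R) := [set` `[(- L), L]].
have L0 : 0 < L by rewrite invr_gt0.
have mI : measurable I by exact: measurable_itv.
have muI : mu I = (2 * L)%:E.
  rewrite /I lebesgue_measure_itv /= lte_fin ifT; last by lra.
  by rewrite -EFinB; congr EFin; ring.
have sub : tri_set T `<=` (fun x => (fs T k x, ft T k x)) @^-1` (I `*` I).
  move=> x /(fat_tri_set k D0 t01 fT)[h1 h2].
  by split; rewrite /= /I /= in_itv /= -ler_norml -[leRHS]mulr1 ler_pdivlMl.
have mB := rect_measure k D0 mI mI; rewrite muI in mB.
have le : (leb2 (tri_set T : set RR) <= (dot (fd T k) (fd T k) * (2 * L * (2 * L)))%:E)%E.
  rewrite EFinM EFinM -mB; apply: le_measure => //; rewrite inE.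
    exact: measurable_tri_set.
  rewrite -[X in measurable X]setTI.
  have := measurable_inv_frame (T (k + 1)) (fd T k) (fe T k).
  by apply => //; exact: measurableX.
rewrite /mesh_size.
have -> : 2 / tau * Num.sqrt (dot (fd T k) (fd T k)) =
   Num.sqrt (dot (fd T k) (fd T k) * (2 * L * (2 * L))).
  rewrite sqrtrM ?dot_ge0 // -expr2 sqrtr_sqr gtr0_norm ?mulr_gt0 // mulrC //.
rewrite ler_wsqrtr //.
by rewrite -lee_fin fineK // ge0_fin_numE // (le_lt_trans le) // ltry.
Qed.

Lemma enorm_gt0 x : (0 < enorm x) = (0 < dot x x).
Proof. exact: sqrtr_gt0. Qed.

Lemma enorm_sqr x : enorm x ^+ 2 = dot x x.
Proof. by rewrite sqr_sqrtr // dot_ge0. Qed.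

Lemma dot_le_enorm x y : `|dot x y| <= enorm x * enorm y.
Proof.
rewrite -ler_sqr ?nnegrE ?mulr_ge0 ?sqrtr_ge0 //.
rewrite real_normK ?num_real // exprMn !enorm_sqr.
by rewrite -subr_ge0 -lagrange sqr_ge0.
Qed.

Lemma vertex_dirs T k : tri_det T != 0 ->
  [/\ 0 < enorm (T (k + 1) - T k), 0 < enorm (T (k + 2) - T k) &
   cross (T (k + 1) - T k) (T (k + 2) - T k) != 0].
Proof.
move=> D0.
have c0 : cross (T (k + 1) - T k) (T (k + 2) - T k) != 0.
  have <- : tri_det T = cross (T (k + 1) - T k) (T (k + 2) - T k).
    by rewrite (tri_detE T k) /cross /=; ring.
  exact: D0.
split=> //; rewrite enorm_gt0 lt_neqAle dot_ge0 andbT eq_sym;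
  apply: contra c0 => /eqP/dot_eq0 ->; rewrite /cross /= ?mul0r ?mulr0 ?subrr //.
Qed.

Lemma cos_angle T k : tri_det T != 0 ->
  cos (angle T k) * (enorm (T (k + 1) - T k) * enorm (T (k + 2) - T k)) =
  dot (T (k + 1) - T k) (T (k + 2) - T k).
Proof.
move=> D0; have [h1 h2 _] := vertex_dirs k D0.
rewrite /angle acosK; first by rewrite divfK // gt_eqF // mulr_gt0.
by rewrite in_itv /= -ler_norml normrM normfV (gtr0_norm (mulr_gt0 h1 h2))
  ler_pdivrMr ?mulr_gt0 // mul1r dot_le_enorm.
Qed.

Lemma angle_gt0 T k : tri_det T != 0 -> 0 < angle T k.
Proof.
move=> D0; have [h1 h2 c0] := vertex_dirs k D0.
rewrite /angle; set y := _ / _.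
have h := dot_le_enorm (T (k + 1) - T k) (T (k + 2) - T k).
have y1 : `|y| <= 1.
  by rewrite /y normrM normfV (gtr0_norm (mulr_gt0 h1 h2)) ler_pdivrMr ?mulr_gt0 // mul1r.
apply: acos_gt0; move: y1; rewrite ler_norml => /andP[-> y1] /=.
rewrite lt_neqAle y1 andbT; apply: contra c0 => /eqP y1'.
rewrite -sqrf_eq0 lagrange -!enorm_sqr -exprMn.
have -> : dot (T (k + 1) - T k) (T (k + 2) - T k) = y * (enorm (T (k + 1) - T k) * enorm (T (k + 2) - T k)).
  by rewrite /y divfK // gt_eqF // mulr_gt0.
by rewrite y1' mul1r subrr.
Qed.

Lemma angle_le_pi T k : tri_det T != 0 -> angle T k <= pi.
Proof.
move=> D0; have [h1 h2 c0] := vertex_dirs k D0.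
apply: acos_lepi; rewrite -ler_norml normrM normfV (gtr0_norm (mulr_gt0 h1 h2)).
by rewrite ler_pdivrMr ?mulr_gt0 // mul1r dot_le_enorm.
Qed.

(** The minimal angle of a mesh is acute, except for the empty mesh, to which
    [shape_coef] assigns pi; cutting the cosine off at 0 keeps the value at most 1. *)
Definition fatness (sigma : R) : R := 1 - Num.max (cos sigma) 0.

Lemma shape_coef_le m (K : 'I_m -> triangle R) i k : shape_coef K <= angle (K i) k.
Proof.
rewrite /shape_coef; apply: (@bigmin_inf _ _ _ _ i) => //.
exact: bigmin_le.
Qed.

(** The minimum of finitely many positive angles. *)
Lemma shape_coef_bounds m (K : 'I_m -> triangle R) : (forall i, tri_det (K i) != 0) ->
  0 < shape_coef K <= pi.
Proof.
move=> D0; apply/andP; split.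
  apply/bigmin_gtP; split=> [|i _]; first exact: pi_gt0.
  by apply/bigmin_gtP; split=> [|k _]; [exact: pi_gt0|exact: angle_gt0].
exact: bigmin_le_id.
Qed.

Lemma fatness_bounds (sigma : R) : 0 < sigma <= pi -> 0 < fatness sigma <= 1.
Proof.
move=> /andP[s0 sp]; rewrite /fatness.
have c1 : cos sigma < 1.
  rewrite -cos0 ltr_cos ?in_itv /= ?lexx ?pi_ge0 ?sp ?(ltW s0) //.
by case: (leP (cos sigma) 0) => h; apply/andP; split; lra.
Qed.

(** A cosine bounded away from 1 at the two ends of an edge bounds the height
    of the opposite vertex from below, and at the opposite vertex it bounds its
    distance from above: from far away the edge is seen under a small angle. *)
Lemma fat_of_angle (kap : R) T : 0 <= kap < 1 -> tri_det T != 0 ->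
  (forall k, cos (angle T k) <= kap) -> fat (1 - kap) T.
Proof.
move=> /andP[k0 k1] D0 H k.
have Z0 := zt_gt0 k D0.
have d0 := fd_gt0 k D0.
have HH j : dot (T (j + 1) - T j) (T (j + 2) - T j) <=
    kap * (enorm (T (j + 1) - T j) * enorm (T (j + 2) - T j)).
  rewrite -cos_angle // ler_wpM2r // mulr_ge0 ?sqrtr_ge0 //.
have sq (u v : R * R) (c : R) : dot u v <= kap * (enorm u * enorm v) -> 0 <= dot u v ->
   dot u v ^+ 2 <= kap ^+ 2 * (dot u u * dot v v).
  move=> h h0; rewrite -!enorm_sqr -!exprMn ler_sqr // nnegrE.
  by rewrite mulr_ge0 // mulr_ge0 ?sqrtr_ge0.
have [b1 b2 b3 b4] := fs_base k D0.
have pol x y : dot (x - y) (x - y) = _ := dot_diff k D0 x y.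
have polar (u v : R * R) : 2 * dot u v = dot u u + dot v v - dot (u - v) (u - v).
  by rewrite /dot /=; ring.
set S := zs T k; set Z := zt T k in Z0 *; set r := dot (fd T k) (fd T k) in d0 pol.
have NA : dot (T k - T (k + 1)) (T k - T (k + 1)) = r * (S ^+ 2 + Z ^+ 2).
  by rewrite pol b1 b2 !subr0.
have NB : dot (T k - T (k + 2)) (T k - T (k + 2)) = r * ((S - 1) ^+ 2 + Z ^+ 2).
  by rewrite pol b3 b4 !subr0.
have NAB : dot (T (k + 2) - T (k + 1)) (T (k + 2) - T (k + 1)) = r by [].
have sym (x y : R * R) : dot (x - y) (x - y) = dot (y - x) (y - x).
  by rewrite /dot /=; ring.
have dA : dot (T (k + 2) - T (k + 1)) (T k - T (k + 1)) = r * S.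
  have := polar (T (k + 2) - T (k + 1)) (T k - T (k + 1)).
  have -> : T (k + 2) - T (k + 1) - (T k - T (k + 1)) = T (k + 2) - T k.
    by rewrite opprB addrA subrK.
  rewrite NAB NA (sym (T (k + 2))) NB; lra.
have dB : dot (T k - T (k + 2)) (T (k + 1) - T (k + 2)) = r * (1 - S).
  have := polar (T k - T (k + 2)) (T (k + 1) - T (k + 2)).
  have -> : T k - T (k + 2) - (T (k + 1) - T (k + 2)) = T k - T (k + 1).
    by rewrite opprB addrA subrK.
  rewrite NB (sym (T (k + 1))) NAB NA; lra.
have dC : 2 * dot (T (k + 1) - T k) (T (k + 2) - T k) =
    r * (S ^+ 2 + Z ^+ 2) + r * ((S - 1) ^+ 2 + Z ^+ 2) - r.
  rewrite polar (sym (T (k + 1))) NA (sym (T (k + 2))) NB.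
  have -> : T (k + 1) - T k - (T (k + 2) - T k) = T (k + 1) - T (k + 2).
    by rewrite opprB addrA subrK.
  by rewrite (sym (T (k + 1))) NAB.
have [e1 e2 e3 e4] := ord3E k.
have key (s : R) : 0 < s -> (r * s) ^+ 2 <= kap ^+ 2 * (r * (r * (s ^+ 2 + Z ^+ 2))) ->
    (1 - kap) * s <= Z.
  move=> s0 h.
  have h' : s ^+ 2 <= kap ^+ 2 * (s ^+ 2 + Z ^+ 2).
    rewrite -(ler_pM2l (exprn_gt0 2 d0)); apply: (le_trans _ (le_trans h _)).
      by rewrite exprMn.
    by rewrite le_eqVlt; apply/orP; left; apply/eqP; ring.
  rewrite leNgt; apply/negP => lt.
  have lt2 : Z ^+ 2 < ((1 - kap) * s) ^+ 2 by rewrite ltr_sqr ?nnegrE ?ltW // mulr_gt0 // subr_gt0.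
  have kk : kap ^+ 2 <= kap by nra.
  have s2 : 0 < s ^+ 2 by rewrite exprn_gt0.
  have q : kap ^+ 2 * (s ^+ 2 + Z ^+ 2) <= kap * (s ^+ 2 + Z ^+ 2).
    by rewrite ler_wpM2r // addr_ge0 ?sqr_ge0.
  have : kap * Z ^+ 2 <= Z ^+ 2 by rewrite ler_piMl ?sqr_ge0 // ltW.
  rewrite exprMn in lt2.
  have : (1 - kap) ^+ 2 * s ^+ 2 <= (1 - kap) * s ^+ 2 by rewrite ler_wpM2r ?(ltW s2) //; nra.
  nra.
(* the angle at the vertex itself bounds the vertex away from infinity *)
have W : (1 - kap) * (S ^+ 2 + Z ^+ 2 + (S - 1) ^+ 2 + Z ^+ 2) <= 1.
  have h := HH k.
  have am : 2 * (enorm (T (k + 1) - T k) * enorm (T (k + 2) - T k)) <=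
      r * (S ^+ 2 + Z ^+ 2) + r * ((S - 1) ^+ 2 + Z ^+ 2).
    rewrite -NA -NB (sym (T k)) (sym (T k) (T (k + 2))) -!enorm_sqr.
    have := sqr_ge0 (enorm (T (k + 1) - T k) - enorm (T (k + 2) - T k)); lra.
  rewrite -(ler_pM2l d0); nra.
have S2 := sqr_ge0 S; have Z2 := sqr_ge0 Z; have SS2 := sqr_ge0 (S - 1).
have tau1 : 0 < 1 - kap by rewrite subr_gt0.
split=> //.
- have [s0|s0] := leP S 0; first by apply: le_trans (ltW Z0); rewrite mulr_ge0_le0 // ltW.
  apply: key => //; rewrite -dA -NAB -NA.
  have := HH (k + 1); rewrite e1 e2 => h; apply: (sq _ _ 0 h).
  by rewrite dA mulr_ge0 // ltW.
- have [s0|s0] := leP (1 - S) 0; first by apply: le_trans (ltW Z0); rewrite mulr_ge0_le0 // ltW.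
  apply: key => //; rewrite -dB.
  have -> : r * (r * ((1 - S) ^+ 2 + Z ^+ 2)) = dot (T k - T (k + 2)) (T k - T (k + 2)) *
     dot (T (k + 1) - T (k + 2)) (T (k + 1) - T (k + 2)).
    by rewrite NB (sym (T (k + 1))) NAB; ring.
  have := HH (k + 2); rewrite e3 e4 => h; apply: (sq _ _ 0 h).
  by rewrite dB mulr_ge0 // ltW.
- rewrite -(gtr0_norm tau1) -normrM -[leRHS]normr1 -ler_sqr ?nnegrE // !real_normK ?num_real //.
  by rewrite exprMn expr1n; nra.
- rewrite -(gtr0_norm Z0) -(gtr0_norm tau1) -normrM -[leRHS]normr1 -ler_sqr ?nnegrE // !real_normK ?num_real //.
  by rewrite exprMn expr1n; nra.
Qed.

Lemma fat_shape m (K : 'I_m -> triangle R) i : (forall i, tri_det (K i) != 0) ->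
  fat (fatness (shape_coef K)) (K i).
Proof.
move=> D0; have /andP[s0 sp] := shape_coef_bounds D0.
have /andP[f0 f1] := fatness_bounds (shape_coef_bounds D0).
apply: fat_of_angle => //.
  by rewrite le_max lexx orbT /=; move: f0; rewrite /fatness subr_gt0.
move=> k; rewrite le_max; apply/orP; left.
rewrite leNgt; apply/negP; rewrite ltr_cos ?in_itv /= ?sp ?(ltW s0) ?angle_le_pi ?(ltW (angle_gt0 _ _)) //.
by rewrite ltNge shape_coef_le.
Qed.

End triangle_frame.

(** * Conforming triangulations of Lipschitz domains *)

Section mesh.
Context {R : realType}.
Implicit Types (T : triangle R) (k : 'I_3) (x : R * R) (Om : set (R * R)).

Lemma continuous_enorm : continuous (@enorm R).
Proof.
move=> x; have h : (fun z : R * R => dot z z) @ x --> dot x x.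
  by apply: cvgD; apply: cvgM; do ?[exact: cvg_fst|exact: cvg_snd].
exact: (continuous_comp h (@sqrt_continuous R _)).
Qed.

(** A Lipschitz domain lies locally on one side of its boundary, so that no
    boundary point is interior to the closure. Hence open subsets of the closed
    triangles, or of a union of them, are contained in the domain. *)
Lemma lipschitz_interior_closure Om : open Om -> lipschitz_boundary Om ->
  interior (closure Om) `<=` Om.
Proof.
move=> oO lO p ip; apply: contrapT => nO.
have bp : boundary Om p.
  by split; [exact: interior_subset ip|rewrite ((interior_id Om).1 oO)].
have [e [gam [L [r [e1 r0 Lg H]]]]] := lO p bp.
pose f : R * R := (- e.2, e.1).
have ee : dot e e = 1 by rewrite -enorm_sqr e1 expr1n.
have fe0 : dot f e = 0 by rewrite /dot /f /=; ring.
have ff : dot f f = 1 by rewrite -ee /dot /f /=; ring.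
have cg : continuous gam.
  move=> y; apply/cvgrPdist_lt => eps eps0; near=> z.
  have h : `|gam y - gam z| <= L * `|y - z|.
    exact: (Lg (y, z)).
  apply: (le_lt_trans h); apply: (@le_lt_trans _ _ ((`|L| + 1) * `|y - z|)).
    by rewrite ler_wpM2r // (le_trans (ler_norm _)) // lerDl.
  rewrite -ltr_pdivlMl ?ltr_wpDl // mulrC; near: z.
  apply: cvgr_dist_lt => //; rewrite divr_gt0 // ltr_wpDl //.
have pf : dot p f <= gam (dot p e).
  rewrite leNgt; apply/negP => h; apply: nO; apply/(H p) => //.
  by rewrite subrr /enorm /dot /= !mulr0 addr0 sqrtr0.
(* below the graph, q s is an interior point of the complement that tends to p *)
pose q (s : R) := p - s *: f.
have cq : q @ (0 : R) --> p.
  rewrite -[X in _ --> X](subr0 p) -(scale0r f).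
  apply: cvgB; first exact: cvg_cst.
  by apply: cvgZr_tmp; exact: cvg_id.
have n1 : \forall s \near (0 : R), closure Om (q s) := cq _ ip.
have n2 : \forall s \near (0 : R), enorm (q s - p) < r.
  have c : (fun s => enorm (q s - p)) @ (0 : R) --> enorm (p - p).
    have h : (fun s => q s - p) @ (0 : R) --> p - p by apply: cvgB => //; exact: cvg_cst.
    exact: (continuous_cvg _ (@continuous_enorm _) h).
  apply: (cvgr_lt (enorm (p - p)) c).
  by rewrite subrr /enorm /dot /= !mulr0 addr0 sqrtr0.
have [s [[c1 c2] s0]] : exists s, (closure Om (q s) /\ enorm (q s - p) < r) /\ 0 < s.
  have h : \forall s \near (0 : R)^'+, (closure Om (q s) /\ enorm (q s - p) < r) /\ 0 < s.
    apply: filterI; last exact: nbhs_right_gt.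
    by apply: cvg_within; exact: filterI.
  exact: (@filter_ex _ _ (at_right_proper_filter (0 : R)) _ h).
have hq : dot (q s) f - gam (dot (q s) e) < 0.
  have -> : dot (q s) e = dot p e.
    transitivity (dot p e - s * dot f e); first by rewrite /q /dot /= /GRing.scale /=; ring.
    by rewrite fe0 mulr0 subr0.
  have -> : dot (q s) f = dot p f - s.
    transitivity (dot p f - s * dot f f); first by rewrite /q /dot /= /GRing.scale /=; ring.
    by rewrite ff mulr1.
  lra.
have cdot (v : R * R) : continuous (fun x => dot x v).
  move=> x; have := @continuous_dot R v 0 x.
  by under [X in X @ _ --> _ -> _]funext do rewrite addr0 dotC; rewrite addr0 (dotC v).
have nq : \forall x \near q s, ~ Om x.
  have ch : (fun x => dot x f - gam (dot x e)) @ q s --> dot (q s) f - gam (dot (q s) e).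
    apply: cvgB; first exact: cdot.
    exact: (continuous_comp (cdot e (q s)) (cg _)).
  have n3 := cvgr_lt _ ch _ hq.
  have ce : (fun x => enorm (x - p)) @ q s --> enorm (q s - p).
    have h : (fun x => x - p) @ q s --> q s - p by apply: cvgB; [exact: cvg_id|exact: cvg_cst].
    exact: (continuous_cvg _ (@continuous_enorm _) h).
  have n4 := cvgr_lt _ ce _ c2.
  near=> x.
  have h3 : dot x f - gam (dot x e) < 0 by near: x; exact: n3.
  have h4 : enorm (x - p) < r by near: x; exact: n4.
  by move=> /(H x h4); rewrite -/f => h5; move: h3; rewrite subr_lt0 ltNge ltW.
by have [x [Ox nOx]] := c1 _ nq.
Unshelve. all: by end_near. Qed.

Lemma segment_endpoints (a b a' b' : R * R) : a != b ->
  segment a b = segment a' b' -> (a' = a /\ b' = b) \/ (a' = b /\ b' = a).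
Proof.
move=> ab E.
have sA (u v : R * R) : segment u v u.
  by exists 0; [rewrite lexx ler01|rewrite subr0 scale1r scale0r addr0].
have sB (u v : R * R) : segment u v v.
  by exists 1; [rewrite ler01 lexx|rewrite subrr scale0r scale1r add0r].
have [s s01 sE] : segment a b a' by rewrite E.
have [r r01 rE] : segment a b b' by rewrite E.
have [p p01 pE] : segment a' b' a by rewrite -E.
have [q q01 qE] : segment a' b' b by rewrite -E.
have key (w : R) : w *: (b - a) = 0 -> w = 0.
  move=> /eqP; rewrite scaler_eq0 => /orP[/eqP //|].
  by rewrite subr_eq0 eq_sym (negbTE ab).
have h1 : (1 - p) * s + p * r = 0.
  apply: key; rewrite -[RHS](subrr a) {2}pE sE rE.
  by apply: injective_projections; rewrite /= /GRing.scale /=; ring.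
have h2 : (1 - q) * s + q * r = 1.
  apply/eqP; rewrite -subr_eq0; apply/eqP; apply: key; rewrite -[RHS](subrr b) {2}qE sE rE.
  by apply: injective_projections; rewrite /= /GRing.scale /=; ring.
move: s01 r01 p01 q01 => /andP[s0 s1] /andP[r0 r1] /andP[p0 p1] /andP[q0 q1].
have : (s = 0 /\ r = 1) \/ (s = 1 /\ r = 0).
  have : (1 - p) * s == 0 /\ p * r == 0.
    have : 0 <= (1 - p) * s by rewrite mulr_ge0 // subr_ge0.
    have : 0 <= p * r by rewrite mulr_ge0.
    by move=> ? ?; split; apply/eqP; lra.
  rewrite !mulf_eq0 subr_eq0 => -[/orP[/eqP p1'|/eqP s0'] pr].
    move: pr; rewrite -p1' oner_eq0 /= => /eqP r0'; right; split => //.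
    by move: h2; rewrite r0' mulr0 addr0; nra.
  by left; split=> //; move: h2; rewrite s0' mulr0 add0r; nra.
move=> [[s' r']|[s' r']]; [left|right]; rewrite sE rE s' r';
  by split; rewrite ?subr0 ?subrr ?scale1r ?scale0r ?add0r ?addr0.
Qed.

Lemma outer_normalE T k : outer_normal T k = - (enorm (fd T k))^-1 *: fe T k.
Proof.
by rewrite /outer_normal /fe -/(fd T k); apply: injective_projections; rewrite /= /GRing.scale /=; ring.
Qed.

(** An edge determines its frame up to the signs of the two axes. With equal
    normals both triangles would contain the same points near the midpoint of
    the edge, so disjointness forces opposite normals. *)
Lemma neighbor_frame tau T T' k k' : 0 < tau -> tri_det T != 0 -> tri_det T' != 0 ->
  fat tau T -> fat tau T' -> edge T k = edge T' k' ->
  (forall x, tri_int T x -> ~ tri_set T' x) ->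
  [/\ fe T' k' = - fe T k, dot (fd T' k') (fd T' k') = dot (fd T k) (fd T k),
      forall x, ft T' k' x = - ft T k x &
      (forall x, fs T' k' x = fs T k x) \/ (forall x, fs T' k' x = 1 - fs T k x)].
Proof.
move=> t0 D0 D0' fT fT' E disj.
have r0 := fd_gt0 k D0.
have ab : T (k + 1) != T (k + 2).
  apply/eqP => ab; move: r0; rewrite /fd ab subrr /dot /= mulr0 addr0 ltxx //.
have s2 := sgr_sqr D0; have s2' := sgr_sqr D0'.
have sg_cases : Num.sg (tri_det T') = Num.sg (tri_det T) \/ Num.sg (tri_det T') = - Num.sg (tri_det T).
  have : (Num.sg (tri_det T') - Num.sg (tri_det T)) * (Num.sg (tri_det T') + Num.sg (tri_det T)) == 0.
    by rewrite -subr_sqr s2 s2' subrr.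
  by rewrite mulf_eq0 subr_eq0 addr_eq0 => /orP[/eqP|/eqP]; [left|right].
have dfe : dot (fe T k) (fd T k) = 0 by rewrite dotC fd_fe.
have bE : T (k + 2) = T (k + 1) + fd T k by rewrite /fd [RHS]addrC subrK.
have dcase : (fd T' k' = fd T k /\ T' (k' + 1) = T (k + 1)) \/
    (fd T' k' = - fd T k /\ T' (k' + 1) = T (k + 2)).
  have [[h1 h2]|[h1 h2]] := segment_endpoints ab E; [left|right]; rewrite /fd h1 h2 //.
  by rewrite opprB.
have dd : dot (fd T' k') (fd T' k') = dot (fd T k) (fd T k).
  by case: dcase => -[-> _] //; rewrite /dot /=; ring.
have fsE : (forall x, fs T' k' x = fs T k x) \/ (forall x, fs T' k' x = 1 - fs T k x).
  case: dcase => -[h1 h2]; [left|right] => x; rewrite /fs !coordE h1 h2 //.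
  have -> : dot (- fd T k) (- fd T k) = dot (fd T k) (fd T k) by rewrite /dot /=; ring.
  rewrite bE; transitivity ((dot (fd T k) (fd T k) - dot (fd T k) (x - T (k + 1))) / dot (fd T k) (fd T k)).
    by congr (_ / _); rewrite /dot /=; ring.
  by rewrite mulrBl divff // gt_eqF.
have ecase : fe T' k' = fe T k \/ fe T' k' = - fe T k.
  rewrite /fe; case: dcase => -[-> _]; case: sg_cases => ->; [left|right|right|left];
    by apply: injective_projections; rewrite /= /GRing.scale /=; ring.
have ftE (h : R) : fe T' k' = h *: fe T k -> h ^+ 2 = 1 -> forall x, ft T' k' x = h * ft T k x.
  move=> hE h2 x; rewrite /ft !coordE (fe_fe _ D0) (fe_fe _ D0') dd hE mulrA; congr (_ / _).
  case: dcase => -[_ ->]; first by rewrite /dot /= /GRing.scale /=; ring.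
  rewrite bE; transitivity (h * dot (fe T k) (x - T (k + 1)) - h * dot (fe T k) (fd T k)).
    by rewrite /dot /= /GRing.scale /=; ring.
  by rewrite dfe mulr0 subr0.
case: ecase => eE; last first.
  split=> // x; rewrite (ftE (-1)) ?mulN1r ?scaleN1r ?sqrrN ?expr1n //.
exfalso.
have tE x : ft T' k' x = ft T k x by rewrite (ftE 1) ?mul1r ?scale1r ?expr1n.
(* with equal normals, this point near the midpoint would lie in both triangles *)
pose x := aff (T (k + 1)) (fd T k) (fe T k) (2^-1, tau / 16).
have := inv_frameK (T (k + 1)) (fd_fe T k) (fe_fe k D0) r0 (2^-1, tau / 16).
rewrite -/x /inv_frame -/(fs T k x) -/(ft T k x) => -[sx tx].
have i1 : tri_int T x by apply: (fat_tri_int D0 t0 fT (k := k)); rewrite ?sx ?tx; lra.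
apply: (disj x i1); apply: tri_int_sub => //.
apply: (fat_tri_int D0' t0 fT' (k := k')); rewrite ?tE ?tx; last lra.
by case: fsE => ->; rewrite sx; lra.
Qed.

Section conforming.
Variables (Om : set (R * R)) (m : nat) (K : 'I_m -> triangle R).
Hypothesis cK : conforming_triangulation Om K.

Lemma conforming_det i : tri_det (K i) != 0. Proof. by case: cK => /(_ i). Qed.

(** Two triangles that meet do so in a vertex or an edge, where a barycentric
    coordinate vanishes. *)
Lemma tri_int_disjoint i j x : i != j -> tri_int (K i) x -> ~ tri_set (K j) x.
Proof.
move=> ij ix jx; have D0 := conforming_det i.
have ixx : tri_set (K i) x by exact: tri_int_sub.
have [_ _ /(_ _ _ ij)] := cK.
have xx : (tri_set (K i) `&` tri_set (K j)) x by [].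
case=> [E|[k [k' [_ E]]]|[k [k' [_ E]]]]; move: xx; rewrite E //.
  move=> /= xE; have := ix (k + 1); rewrite xE vertex_bary //; first by rewrite ltxx.
by move=> /(edge_bary D0) h; have := ix k; rewrite h ltxx.
Qed.

Lemma tri_set_closure i : tri_set (K i) `<=` closure Om.
Proof. by have [_ -> _] := cK => x h; exists i. Qed.

End conforming.
End mesh.

(** * Polynomials in a frame *)

Section frame_polynomials.
Context {R : realType}.
Implicit Types (f g : R -> R -> R) (x : R * R).

(** Degrees are bounded in each variable separately: multiplication by an affine
    function then raises both bounds by one. *)
Definition bipol n m f := exists c : nat -> nat -> R,
  forall s t, f s t = \sum_(i < n) \sum_(j < m) c i j * s ^+ i * t ^+ j.

Lemma bipol_le n m n' m' f : (n <= n')%N -> (m <= m')%N -> bipol n m f -> bipol n' m' f.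
Proof.
move=> nn mm [c cE].
exists (fun i j => if (i < n)%N && (j < m)%N then c i j else 0) => s t.
rewrite cE (big_ord_widen n' (fun i => \sum_(j < m) c i j * s ^+ i * t ^+ j) nn) big_mkcond /=.
apply: eq_bigr => i _; case: ifP => _ /=; last by rewrite big1 // => j _; rewrite !mul0r.
rewrite (big_ord_widen m' (fun j => c i j * s ^+ i * t ^+ j) mm) big_mkcond /=.
by apply: eq_bigr => j _; case: ifP => _; rewrite ?mul0r.
Qed.

Lemma bipol0 n m : bipol n m (fun _ _ => 0).
Proof.
by exists (fun _ _ => 0) => s t; rewrite big1 // => i _; rewrite big1 // => j _; rewrite !mul0r.
Qed.

Lemma bipol1 : bipol 1 1 (fun _ _ => 1).
Proof.
by exists (fun _ _ => 1) => s t; rewrite big_ord1 big_ord1 !expr0 !mulr1.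
Qed.

Lemma bipolD n m f g : bipol n m f -> bipol n m g -> bipol n m (fun s t => f s t + g s t).
Proof.
move=> [c cE] [b bE]; exists (fun i j => c i j + b i j) => s t; rewrite cE bE -big_split.
apply: eq_bigr => i _; rewrite -big_split; apply: eq_bigr => j _ /=; ring.
Qed.

Lemma bipolZ n m (k : R) f : bipol n m f -> bipol n m (fun s t => k * f s t).
Proof.
move=> [c cE]; exists (fun i j => k * c i j) => s t; rewrite cE mulr_sumr.
apply: eq_bigr => i _; rewrite mulr_sumr; apply: eq_bigr => j _ /=; ring.
Qed.

Lemma bipolMs n m f : bipol n m f -> bipol n.+1 m (fun s t => s * f s t).
Proof.
move=> [c cE]; exists (fun i j => if i is i'.+1 then c i' j else 0) => s t.
rewrite cE mulr_sumr big_ord_recl /= [X in _ = X + _]big1 ?add0r; last by move=> j _; rewrite !mul0r.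
apply: eq_bigr => i _; rewrite mulr_sumr; apply: eq_bigr => j _ /=.
rewrite ?lift0 exprS; ring.
Qed.

Lemma bipolMt n m f : bipol n m f -> bipol n m.+1 (fun s t => t * f s t).
Proof.
move=> [c cE]; exists (fun i j => if j is j'.+1 then c i j' else 0) => s t.
rewrite cE mulr_sumr; apply: eq_bigr => i _; rewrite mulr_sumr big_ord_recl /= !mul0r add0r.
apply: eq_bigr => j _ /=; rewrite ?lift0 exprS; ring.
Qed.

Lemma bipolMaff n (a b c : R) f : bipol n n f ->
  bipol n.+1 n.+1 (fun s t => (a + s * b + t * c) * f s t).
Proof.
move=> bf.
have h0 : bipol n.+1 n.+1 (fun s t => a * f s t) by apply: bipolZ; apply: bipol_le bf.
have h1 : bipol n.+1 n.+1 (fun s t => b * (s * f s t)).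
  by apply: bipolZ; apply: bipol_le (bipolMs bf).
have h2 : bipol n.+1 n.+1 (fun s t => c * (t * f s t)).
  by apply: bipolZ; apply: bipol_le (bipolMt bf).
have [d dE] := bipolD (bipolD h0 h1) h2.
by exists d => s t; rewrite -dE; ring.
Qed.

Lemma bipol_monomial (a d e : R * R) i j :
  bipol (i + j).+1 (i + j).+1
    (fun s t => (aff a d e (s, t)).1 ^+ i * (aff a d e (s, t)).2 ^+ j).
Proof.
elim: i => [|i [c IH]] /=.
  elim: j => [|j [c IH]] /=.
    by have [c cE] := bipol1; exists c => s t; rewrite -cE !expr0 mulr1.
  have [d' dE] := @bipolMaff j.+1 a.2 d.2 e.2 _ (ex_intro _ c (fun s t => erefl)).
  by exists d' => s t; rewrite -dE -IH !expr0 !mul1r exprS.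
have [d' dE] := @bipolMaff (i + j).+1 a.1 d.1 e.1 _ (ex_intro _ c (fun s t => erefl)).
by exists d' => s t; rewrite -dE -IH exprS mulrA.
Qed.

Lemma bipol_sum n m N (F : nat -> R -> R -> R) (P : pred nat) :
  (forall i, (i < N)%N -> P i -> bipol n m (F i)) ->
  bipol n m (fun s t => \sum_(i < N | P i) F i s t).
Proof.
elim: N => [|N IH] H.
  by have [c cE] := bipol0 n m; exists c => s t; rewrite big_ord0 -cE.
have [|c cE] := IH; first by move=> i iN; apply: H; exact: ltnW.
case PN: (P N); last first.
  by exists c => s t; rewrite -cE big_mkcond big_ord_recr /= PN addr0 -big_mkcond.
have [b bE] := bipolD (ex_intro _ c cE) (H N (ltnSn _) PN).
by exists b => s t; rewrite -bE big_mkcond big_ord_recr /= PN -big_mkcond.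
Qed.

(** An affine change of coordinates preserves polynomials; the total degree
    bounds the degree in each of the new variables. *)
Lemma poly2_frame (a d e : R * R) l p : poly2 l p ->
  bipol l.+1 l.+1 (fun s t => p (aff a d e (s, t))).
Proof.
move=> [c cE].
suff [b bE] : bipol l.+1 l.+1 (fun s t => \sum_(i < l.+1) \sum_(j < l.+1 | (i + j <= l)%N)
    c i j * ((aff a d e (s, t)).1 ^+ i * (aff a d e (s, t)).2 ^+ j)).
  exists b => s t; rewrite -bE cE; apply: eq_bigr => i _; apply: eq_bigr => j _.
  by rewrite mulrA.
apply: (@bipol_sum l.+1 l.+1 l.+1 (fun i s t => \sum_(j < l.+1 | (i + j <= l)%N)
    c i j * ((aff a d e (s, t)).1 ^+ i * (aff a d e (s, t)).2 ^+ j)) predT) => i il _.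
apply: (@bipol_sum l.+1 l.+1 l.+1 (fun j s t =>
    c i j * ((aff a d e (s, t)).1 ^+ i * (aff a d e (s, t)).2 ^+ j)) (fun j => i + j <= l)%N) => j jl ij.
by apply: bipolZ; apply: bipol_le (bipol_monomial a d e i j).
Qed.

Lemma is_derive_sumn n (F : nat -> R * R -> R) (dF : nat -> R) x (w : R * R) :
  (forall i, is_derive x w (F i) (dF i)) ->
  is_derive x w (fun y => \sum_(i < n) F i y) (\sum_(i < n) dF i).
Proof.
move=> H; elim: n => [|n IH].
  under [X in is_derive _ _ X _]funext do rewrite big_ord0.
  by rewrite big_ord0; exact: is_derive_cst.
under [X in is_derive _ _ X _]funext do rewrite big_ord_recr /=.
by rewrite big_ord_recr /=; apply: is_deriveD.
Qed.

Lemma derive_sumn n (F : nat -> R * R -> R) (w : R * R) :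
  (forall i x, derivable (F i) x w) ->
  'D_w (fun y => \sum_(i < n) F i y) = fun x => \sum_(i < n) 'D_w (F i) x.
Proof.
move=> H; apply/funext => x.
have D i : is_derive x w (F i) ('D_w (F i) x) by apply: DeriveDef.
by have [_ ->] := is_derive_sumn n D.
Qed.

Lemma laplacian_sumn n (F : nat -> R * R -> R) x : (forall i, smooth (F i)) ->
  laplacian (fun y => \sum_(i < n) F i y) x = \sum_(i < n) laplacian (F i) x.
Proof.
move=> H; rewrite /laplacian /pderiv /= big_split /=.
have d1 i y : derivable (F i) y ((1, 0) : R * R) by have [_ ? _ _ _] := smooth_dir (H i).
have d2 i y : derivable (F i) y ((0, 1) : R * R) by have [_ _ ? _ _] := smooth_dir (H i).
have d11 i y : derivable ('D_((1, 0) : R * R) (F i)) y ((1, 0) : R * R).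
  by have [_ _ _ s _] := smooth_dir (H i); have [_ ? _ _ _] := smooth_dir s.
have d22 i y : derivable ('D_((0, 1) : R * R) (F i)) y ((0, 1) : R * R).
  by have [_ _ _ _ s] := smooth_dir (H i); have [_ _ ? _ _] := smooth_dir s.
have E1 := congr1 (@^~ x) (derive_sumn n d11).
have E2 := congr1 (@^~ x) (derive_sumn n d22).
congr (_ + _).
  by rewrite (derive_sumn n d1); exact: E1.
by rewrite (derive_sumn n d2); exact: E2.
Qed.

Lemma sum_ten_sumn v v' (c c' : R) n (F : nat -> R * R -> R) :
  (forall i, sum_ten v v' c c' (F i)) -> sum_ten v v' c c' (fun x => \sum_(i < n) F i x).
Proof.
move=> H; elim: n => [|n IH].
  have -> : (fun x => \sum_(i < 0) F i x) = ten v v' c c' (fun=> 0) (fun=> 0).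
    by apply/funext => x; rewrite big_ord0 /ten /ridge mul0r.
  by apply: SumTen1; exact: smooth1_cst.
have -> : (fun x => \sum_(i < n.+1) F i x) = (fun x => \sum_(i < n) F i x + F n x).
  by apply/funext => x; rewrite big_ord_recr.
exact: SumTenD.
Qed.

Section poly_in_frame.
Variables (a d e : R * R).
Hypotheses (de : dot d e = 0) (ee : dot e e = dot d d) (d0 : 0 < dot d d).
Let r := dot d d.
Let v := dual_vec d.
Let v' := dual_vec e.
Let c1 := - dot v a.
Let c2 := - dot v' a.

Lemma tenE (f g : R -> R) x : ten v v' c1 c2 f g x = f (coord a d x) * g (coord a e x).
Proof. by []. Qed.

Lemma dual_dot : [/\ dot v v = r^-1, dot v' v' = r^-1, dot v v' = 0,
   dot v e = 0 & dot v' e = 1].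
Proof.
have r0 : r != 0 by rewrite gt_eqF.
have dZ (k h : R) x y : dot (k *: x) (h *: y) = k * h * dot x y.
  by rewrite /dot /= /GRing.scale /=; ring.
have dZl (k : R) x y : dot (k *: x) y = k * dot x y.
  by rewrite /dot /= /GRing.scale /=; ring.
rewrite /v /v' /dual_vec !dZ !dZl ee de -/r; split; rewrite ?mulr0 //; try by field.
Qed.

Lemma laplacian_frame (f g : R -> R) x : smooth1 f -> smooth1 g ->
  laplacian (ten v v' c1 c2 f g) x =
  r^-1 * (f^`1^`1 (coord a d x) * g (coord a e x) + f (coord a d x) * g^`1^`1 (coord a e x)).
Proof.
have [h1 h2 h3 _ _] := dual_dot.
by move=> sf sg; rewrite laplacian_ten // h1 h2 !tenE mulrDr.
Qed.

Variables (n : nat) (c : nat -> nat -> R).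

Definition frame_pol (x : R * R) : R :=
  \sum_(i < n) \sum_(j < n) c i j * coord a d x ^+ i * coord a e x ^+ j.

Let F i j := ten v v' c1 c2 (fun s => c i j * s ^+ i) (fun t => t ^+ j).

Lemma smooth_coef i j : smooth1 (fun s : R => c i j * s ^+ i).
Proof. by apply: smooth1M; [exact: smooth1_cst|exact: smooth1Xn]. Qed.

Let sF i j : sum_ten v v' c1 c2 (F i j).
Proof. by apply: SumTen1; [exact: smooth_coef|exact: smooth1Xn]. Qed.

Let frame_polE : frame_pol = fun x => \sum_(i < n) (fun y => \sum_(j < n) F i j y) x.
Proof. by []. Qed.

Lemma derive1Zn (k : R) i (s : R) : (fun s => k * s ^+ i)^`1 s = k * (i%:R * s ^+ i.-1).
Proof.
rewrite (@derive1M R (fun=> k) (fun s => s ^+ i) s (smooth1_cst k) (smooth1Xn i)).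
by rewrite derive1Xn derive1E derive_cst mul0r add0r.
Qed.

Lemma derive2Xn j (t : R) : (fun t : R => t ^+ j)^`1^`1 t = j%:R * (j.-1%:R * t ^+ j.-2).
Proof.
have -> : (fun t : R => t ^+ j)^`1 = (fun t => j%:R * t ^+ j.-1).
  by apply/funext => y; rewrite derive1Xn.
by rewrite derive1Zn.
Qed.

Lemma derive2Zn (k : R) i (s : R) :
  (fun s => k * s ^+ i)^`1^`1 s = k * (i%:R * (i.-1%:R * s ^+ i.-2)).
Proof.
have -> : (fun s : R => k * s ^+ i)^`1 = (fun s => (k * i%:R) * s ^+ i.-1).
  by apply/funext => y; rewrite derive1Zn mulrA.
by rewrite derive1Zn -mulrA.
Qed.

Lemma laplacian_frame_pol x :
  laplacian frame_pol x = r^-1 * \sum_(i < n) \sum_(j < n)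
    (c i j * (i%:R * (i.-1%:R * coord a d x ^+ i.-2)) * coord a e x ^+ j +
     c i j * coord a d x ^+ i * (j%:R * (j.-1%:R * coord a e x ^+ j.-2))).
Proof.
rewrite frame_polE (laplacian_sumn n (F := fun i y => \sum_(j < n) F i j y)); last first.
  move=> i; apply: (@sum_ten_smooth _ v v' c1 c2).
  exact: (@sum_ten_sumn v v' c1 c2 n (F i)).
rewrite mulr_sumr; apply: eq_bigr => i _.
rewrite laplacian_sumn; last by move=> j; exact: sum_ten_smooth (sF i j).
rewrite mulr_sumr; apply: eq_bigr => j _.
rewrite laplacian_frame; [|exact: smooth_coef|exact: smooth1Xn].
by rewrite derive2Zn derive2Xn.
Qed.

(** On the axis along d only the terms of degree 1 in the other coordinate
    contribute to the derivative across that axis. *)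
Lemma grad_frame_pol x (k : R) : (1 < n)%N -> coord a e x = 0 ->
  dot (grad frame_pol x) (k *: e) = k * \sum_(i < n) c i 1%N * coord a d x ^+ i.
Proof.
move=> n1 x0; have [_ _ _ h1 h2] := dual_dot.
have D i j w := is_derive_ten v v' c1 c2 x w (smooth_coef i j) (smooth1Xn j).
have Dx (w : R * R) : 'D_w frame_pol x = \sum_(i < n) \sum_(j < n)
    (dot v w * ten v v' c1 c2 (fun s => c i j * s ^+ i)^`1 (fun t => t ^+ j) x +
     dot v' w * ten v v' c1 c2 (fun s => c i j * s ^+ i) (fun t => t ^+ j)^`1 x).
  have H := is_derive_sumn n (fun i => is_derive_sumn n (fun j => D i j w)).
  by have [_ E] := H; exact: E.
have E (A B : nat -> nat -> R) (p q u u' : R) :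
    \sum_(i < n) \sum_(j < n) (p * A i j + q * B i j) * u +
    \sum_(i < n) \sum_(j < n) (p * A i j + q * B i j) * u' =
    \sum_(i < n) \sum_(j < n) (p * A i j + q * B i j) * (u + u').
  rewrite -big_split; apply: eq_bigr => i _; rewrite -big_split; apply: eq_bigr => j _ /=; ring.
rewrite /dot /grad /= !Dx.
set A := fun i j : nat => ten v v' c1 c2 (fun s => c i j * s ^+ i)^`1 (fun t => t ^+ j) x.
set B := fun i j : nat => ten v v' c1 c2 (fun s => c i j * s ^+ i) (fun t => t ^+ j)^`1 x.
transitivity (\sum_(i < n) \sum_(j < n) (k * dot v e * A i j + k * dot v' e * B i j)).
  rewrite !mulr_suml -big_split; apply: eq_bigr => i _.
  rewrite !mulr_suml -big_split; apply: eq_bigr => j _ /=.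
  by rewrite -/(A i j) -/(B i j) /dot /= /GRing.scale /=; ring.
rewrite h1 h2 mulr0 mulr1 mulr_sumr; apply: eq_bigr => i _.
rewrite (bigD1 (Ordinal n1)) //= big1 ?addr0.
  by rewrite mul0r add0r /B tenE derive1Xn /= x0 expr0 !mulr1.
move=> j j1; rewrite mul0r add0r /B tenE derive1Xn x0.
case: j j1 => -[|[|j]] jn //= _; first by rewrite mul0r !mulr0.
by rewrite expr0n /= !mulr0.
Qed.

End poly_in_frame.
End frame_polynomials.

(** * Families of test functions *)

Section families.
Context {R : realType}.
Local Notation mu := (@lebesgue_measure R).
Implicit Types (a b A B : R) (f g : R -> R).

Lemma test1_continuous a b f : test1 a b f -> continuous f.
Proof. by case=> /smooth1_continuous. Qed.

Lemma mom_test1_derive2 a b A B f j : A < B -> A <= a -> b <= B -> test1 a b f ->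
  mom A B f^`1^`1 j = j%:R * (j.-1%:R * mom A B f j.-2).
Proof.
move=> AB Aa bB tf; have tf' := test1_derive tf.
by rewrite (mom_test1_derive1 _ AB Aa bB tf') (mom_test1_derive1 _ AB Aa bB tf) mulrN opprK.
Qed.

(** The functions dual to the monomials up to degree l: pairing with them
    reads off the coefficients of a polynomial. *)
Lemma dual_family a b A B l : A <= a -> a < b -> b <= B ->
  exists chi : nat -> R -> R, forall i, test1 a b (chi i) /\
    forall j, (j <= l)%N -> mom A B (chi i) j = (j == i)%:R.
Proof.
move=> Aa ab bB.
have H i : exists f, test1 a b f /\ forall j, (j <= l)%N -> mom A B f j = (j == i)%:R.
  by have [f [tf fm]] := exists_moments l.+1 (fun j => (j == i)%:R) Aa ab bB; exists f.
by have [chi Hchi] := boolp.choice H; exists chi.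
Qed.

Lemma test1_bounded a b f : test1 a b f -> exists C : R, 0 < C /\ forall x, `|f x| <= C.
Proof.
move=> tf; have cf := test1_continuous tf; have [_ f0] := tf.
have := continuous_compact (continuous_subspaceT cf) (@segment_compact R a b).
move=> /compact_bounded [C [_ HC]].
have C1 : C < `|C| + 1 by rewrite (le_lt_trans (ler_norm _)) // ltrDl.
exists (`|C| + 1); split; first by rewrite ltr_wpDl.
move=> x; have [/andP[ax xb]|/f0 ->] := boolP (a < x < b).
  by apply: HC => //; exists x => //; rewrite /= in_itv /= !ltW.
by rewrite normr0 addr_ge0.
Qed.

Lemma common_bound (I : finType) (P : I -> R -> Prop) :
  (forall i C D, C <= D -> P i C -> P i D) ->
  (forall i, exists C, 0 < C /\ P i C) -> exists C, 0 < C /\ forall i, P i C.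
Proof.
move=> mono H; have [F HF] := boolp.choice H.
have le i : F i <= 1 + \sum_j F j.
  rewrite (bigD1 i) //= addrCA lerDl addr_ge0 // sumr_ge0 // => j _.
  by have [/ltW] := HF j.
exists (1 + \sum_j F j); split.
  by rewrite ltr_wpDr // sumr_ge0 // => j _; have [/ltW] := HF j.
by move=> i; have [_] := HF i; exact: mono.
Qed.

Lemma mom0 A B f j : (forall x, A <= x <= B -> f x = 0) -> mom A B f j = 0.
Proof.
move=> f0; rewrite /mom /Rintegral integral0_eq // => x.
by rewrite /= in_itv /= => /f0 ->; rewrite mul0r.
Qed.

(** A profile across an edge, of height 1 and slope 0 on the edge. On each side
    it is orthogonal to polynomials of degree at most l, and integrating by
    parts twice shows that its second derivative sees only their derivative at
    0, with opposite signs on the two sides. *)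
Lemma exists_profile (h : R) l : 0 < h -> exists g,
  [/\ test1 (- (h / 2)) (h / 2) g,
    forall j, (j <= l)%N -> mom 0 h g j = 0,
    forall j, (j <= l)%N -> mom (- h) 0 g j = 0,
    forall j, (j <= l)%N -> mom 0 h g^`1^`1 j = (j == 1)%:R &
    forall j, (j <= l)%N -> mom (- h) 0 g^`1^`1 j = - (j == 1)%:R].
Proof.
move=> h0; have h2 : 0 < h / 2 by rewrite divr_gt0.
have tb := test1_bump (- (h / 2)) (h / 2).
set b0 := bump (- (h / 2)) (h / 2) in tb.
have b00 : 0 < b0 0.
  by rewrite /b0 /bump mulr_gt0 // flat1_gt0; lra.
pose g0 x := (b0 0)^-1 * b0 x.
have tg0 : test1 (- (h / 2)) (h / 2) g0 by exact: test1Z.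
have g00 : g0 0 = 1 by rewrite /g0 mulVf // gt_eqF.
have b0' : b0^`1 0 = 0.
  pose u x : R := flat 1 (1 * x + - - (h / 2)).
  pose w x : R := flat 1 (-1 * x + h / 2).
  have su : smooth1 u by exact/smooth1_affine/smooth1_flat.
  have sw : smooth1 w by exact/smooth1_affine/smooth1_flat.
  have -> : b0 = (fun x => u x * w x).
    by apply/funext => x; rewrite /b0 /bump /u /w mul1r mulN1r opprK (addrC (- x)).
  rewrite derive1M // /u /w !derive1_affine; do ?exact: smooth1_flat.
  by rewrite !mulr0 !add0r opprK; ring.
have g0' : g0^`1 0 = 0.
  have := @derive1M R (fun=> (b0 0)^-1) b0 0 (smooth1_cst _) tb.1.
  have c0 : (fun=> (b0 0)^-1 : R)^`1 0 = 0 by rewrite derive1E; exact: derive_cst.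
  by rewrite b0' mulr0 addr0 c0 mul0r.
have [|||fp [tfp mfp]] := @exists_moments R (h / 4) (h / 2) 0 h l.+1 (fun j => - mom 0 h g0 j); try lra.
have [|||fm [tfm mfm]] := @exists_moments R (- (h / 2)) (- (h / 4)) (- h) 0 l.+1 (fun j => - mom (- h) 0 g0 j); try lra.
(* fp and fm live away from 0, on one side each, and cancel the moments of g0 *)
pose g x := g0 x + (fp x + fm x).
have tg : test1 (- (h / 2)) (h / 2) g.
  by apply: test1D => //; apply: test1D; [apply: test1_sub tfp|apply: test1_sub tfm]; lra.
have fp0 x : x <= h / 4 -> fp x = 0.
  by move=> xh; have [_] := tfp; apply; rewrite negb_and -leNgt xh.
have fm0 x : - (h / 4) <= x -> fm x = 0.
  by move=> xh; have [_] := tfm; apply; rewrite negb_and -!leNgt xh orbT.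
have fp0' : fp^`1 0 = 0.
  by have [_] := test1_derive tfp; apply; rewrite negb_and -leNgt; apply/orP; left; lra.
have fm0' : fm^`1 0 = 0.
  by have [_] := test1_derive tfm; apply; rewrite negb_and -!leNgt; apply/orP; right; lra.
have [c0 cp cm] : [/\ continuous g0, continuous fp & continuous fm].
  by split; [exact: test1_continuous tg0|exact: test1_continuous tfp|exact: test1_continuous tfm].
have cpm : continuous (fun x => fp x + fm x).
  by move=> x; apply: cvgD; [exact: cp|exact: cm].
have m1 j : (j <= l)%N -> mom 0 h g j = 0.
  move=> jl; rewrite /g !momD // mfp // (@mom0 _ _ fm) ?addr0 ?subrr // => x /andP[x0 _].
  by apply: fm0; lra.
have m2 j : (j <= l)%N -> mom (- h) 0 g j = 0.
  move=> jl; rewrite /g !momD // mfm // (@mom0 _ _ fp) ?add0r ?subrr // => x /andP[_ x0].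
  by apply: fp0; lra.
have [sg gz] := tg; have tg' := test1_derive tg; have [sg' gz'] := tg'.
have gend : [/\ g h = 0, g (- h) = 0, g^`1 h = 0 & g^`1 (- h) = 0].
  by split; [apply: gz|apply: gz|apply: gz'|apply: gz'];
    rewrite negb_and -!leNgt; apply/orP; [right|left|right|left]; lra.
have [e1 e2 e3 e4] := gend.
have g1 : g 0 = 1 by rewrite /g g00 fp0 ?fm0 ?addr0 //; lra.
have g1' : g^`1 0 = 0.
  have sp : smooth1 fp by case: tfp.
  have sm : smooth1 fm by case: tfm.
  rewrite (derive1D 0 tg0.1 (smooth1D sp sm)) g0' add0r.
  by rewrite (derive1D 0 sp sm) fp0' fm0' addr0.
exists g; split=> // j jl.
- have j2l : (j.-2 <= l)%N by rewrite (leq_trans _ jl) // (leq_trans (leq_pred _)) // leq_pred.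
  rewrite (mom_derive1 _ h0 sg') (mom_derive1 _ h0 sg) e1 e3 g1 g1' (m1 _ j2l).
  by case: j jl j2l => [|[|j]] _ _ /=; rewrite ?expr0 ?(exprS (0 : R)); ring.
- have j2l : (j.-2 <= l)%N by rewrite (leq_trans _ jl) // (leq_trans (leq_pred _)) // leq_pred.
  have nh0 : - h < 0 by lra.
  rewrite (mom_derive1 _ nh0 sg') (mom_derive1 _ nh0 sg) e2 e4 g1 g1' (m2 _ j2l).
  by case: j jl j2l => [|[|j]] _ _ /=; rewrite ?expr0 ?(exprS (0 : R)); ring.
Qed.

(** The endpoints of N + 1 consecutive intervals that fill [1/4, 3/4]; given any
    N points, one of these intervals contains none of them. *)
Definition cell N k : R := 1 / 4 + k%:R / (2 * N.+1%:R).

Lemma cell_lt N k : cell N k < cell N k.+1.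
Proof. by rewrite ltrD2l ltr_pM2r ?ltr_nat // invr_gt0 mulr_gt0. Qed.

Lemma cell_ge N k : 1 / 4 <= cell N k.
Proof. by rewrite lerDl mulr_ge0 // invr_ge0 mulr_ge0. Qed.

Lemma cell_le N k : (k <= N)%N -> cell N k.+1 <= 3 / 4.
Proof.
move=> kN; have -> : (3 / 4 : R) = 1 / 4 + 1 / 2 by lra.
rewrite lerD2l ler_pdivrMr ?mulr_gt0 //.
have -> (y : R) : 1 / 2 * (2 * y) = y by lra.
by rewrite ler_nat.
Qed.

Lemma cell_mono N j k : (j <= k)%N -> cell N j <= cell N k.
Proof. by move=> jk; rewrite lerD2l ler_pM2r ?ler_nat // invr_gt0 mulr_gt0. Qed.

(** N points cannot meet N + 1 disjoint intervals. *)
Lemma free_cell N (x : 'I_N -> R) :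
  exists k, (k <= N)%N /\ forall j, ~~ (cell N k < x j < cell N k.+1).
Proof.
apply: contrapT => nE.
have H (k : 'I_N.+1) : exists j, cell N k < x j < cell N k.+1.
  apply: contrapT => nj; apply: nE; exists k; split; first by rewrite -ltnS.
  by move=> j; apply/negP => h; apply: nj; exists j.
have [f Hf] := boolp.choice H.
have inj : injective f.
  move=> i j fij; apply: val_inj; have := Hf i; have := Hf j; rewrite fij => /andP[j1 j2] /andP[i1 i2].
  apply/eqP; rewrite eqn_leq; apply/andP; split; rewrite leqNgt; apply/negP => lt.
    by have := cell_mono N lt => h; move: (lt_trans (lt_le_trans j2 h) i1); rewrite ltxx.
  by have := cell_mono N lt => h; move: (lt_trans (lt_le_trans i2 h) j1); rewrite ltxx.
by have := leq_card f inj; rewrite !card_ord ltnn.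
Qed.

(** The cell k and the exponents range over finite sets, so that one bound C
    serves for all positions of the points to be avoided. *)
Lemma test_families N l (h : R) : 0 < h ->
  exists (chi : nat -> nat -> R -> R) (xi : nat -> R -> R) (g : R -> R) (C : R),
  [/\ 0 < C,
    forall k i, (k <= N)%N -> test1 (cell N k) (cell N k.+1) (chi k i) /\
      forall j, (j <= l)%N -> mom (1 / 4) (3 / 4) (chi k i) j = (j == i)%:R,
    forall i, test1 (h / 4) (h / 2) (xi i) /\
      forall j, (j <= l)%N -> mom 0 h (xi i) j = (j == i)%:R,
    [/\ test1 (- (h / 2)) (h / 2) g,
      forall j, (j <= l)%N -> mom 0 h g j = 0,
      forall j, (j <= l)%N -> mom (- h) 0 g j = 0,
      forall j, (j <= l)%N -> mom 0 h g^`1^`1 j = (j == 1)%:R &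
      forall j, (j <= l)%N -> mom (- h) 0 g^`1^`1 j = - (j == 1)%:R] &
    forall k i, (k <= N)%N -> (i <= l)%N ->
      (forall j s t, (j <= l)%N -> `|(chi k i)^`1^`1 s * xi j t + chi k i s * (xi j)^`1^`1 t| <= C) /\
      (forall s t, `|(chi k i)^`1^`1 s * g t + chi k i s * g^`1^`1 t| <= C)].
Proof.
move=> h0.
have Hchi k : exists c : nat -> R -> R, (k <= N)%N -> forall i, test1 (cell N k) (cell N k.+1) (c i) /\
      forall j, (j <= l)%N -> mom (1 / 4) (3 / 4) (c i) j = (j == i)%:R.
  have [kN|kN] := leqP k N; last by exists (fun _ _ => 0).
  have [c Hc] := dual_family l (cell_ge N k) (cell_lt N k) (cell_le kN).
  by exists c.
have [chi chiP] := boolp.choice Hchi.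
have [|||xi xiP] := @dual_family (h / 4) (h / 2) 0 h l; try lra.
have [g gP] := exists_profile l h0.
have prod_bound (f u f' u' : R -> R) a b a' b' : test1 a b f -> test1 a b f' -> test1 a' b' u -> test1 a' b' u' ->
    exists C, 0 < C /\ forall s t, `|f' s * u t + f s * u' t| <= C.
  move=> /test1_bounded[c1 [c10 H1]] /test1_bounded[c2 [c20 H2]] /test1_bounded[c3 [c30 H3]] /test1_bounded[c4 [c40 H4]].
  exists (c2 * c3 + c1 * c4); split; first by rewrite addr_gt0 // mulr_gt0.
  move=> s t; apply: (le_trans (ler_normD _ _)); rewrite !normrM.
  by apply: lerD; apply: ler_pM.
have D2 a b f : test1 a b f -> test1 a b f^`1^`1 by move=> tf; exact/test1_derive/test1_derive.
pose P (p : 'I_N.+1 * 'I_l.+1 * 'I_l.+1) (C : R) :=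
  (forall s t, `|(chi p.1.1 p.1.2)^`1^`1 s * xi p.2 t + chi p.1.1 p.1.2 s * (xi p.2)^`1^`1 t| <= C) /\
  (forall s t, `|(chi p.1.1 p.1.2)^`1^`1 s * g t + chi p.1.1 p.1.2 s * g^`1^`1 t| <= C).
have [||C [C0 HC]] := @common_bound _ P.
- by move=> p C D CD [k1 k2]; split=> s t; [apply: le_trans CD; exact: k1|apply: le_trans CD; exact: k2].
- move=> p; have kN : (p.1.1 <= N)%N by rewrite -ltnS.
  have [t1 _] := chiP _ kN p.1.2; have [t2 _] := xiP p.2; have [t3 _ _ _ _] := gP.
  have [C1 [C10 H1]] := prod_bound _ _ _ _ _ _ _ _ t1 (D2 _ _ _ t1) t2 (D2 _ _ _ t2).
  have [C2 [C20 H2]] := prod_bound _ _ _ _ _ _ _ _ t1 (D2 _ _ _ t1) t3 (D2 _ _ _ t3).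
  exists (C1 + C2); split; first exact: addr_gt0.
  split=> s t; [apply: (le_trans (H1 s t))|apply: (le_trans (H2 s t))]; lra.
exists chi, xi, g, C; split=> //.
- by move=> k i kN; exact: chiP.
- move=> k i kN il; split=> [j s t jl|s t].
    have [H _] := HC (Ordinal (kN : (k < N.+1)%N), Ordinal (il : (i < l.+1)%N), Ordinal (jl : (j < l.+1)%N)).
    exact: H.
  have [_ H] := HC (Ordinal (kN : (k < N.+1)%N), Ordinal (il : (i < l.+1)%N), ord0).
  exact: H.
Qed.

End families.

Section integrals_in_frame.
Context {R : realType}.
Local Notation mu := (@lebesgue_measure R).
Local Notation leb2 := (mu \x mu)%E.
Local Notation RR := (measurableTypeR R * measurableTypeR R)%type.
Implicit Types (T : triangle R) (k : 'I_3).

Definition region T k (I J : set R) : set (R * R) :=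
  [set x | I (fs T k x) /\ J (ft T k x)].

Definition tens T k (f h : R -> R) (x : R * R) : R := f (fs T k x) * h (ft T k x).

Lemma laplacian_tens T k f h x : tri_det T != 0 -> smooth1 f -> smooth1 h ->
  laplacian (tens T k f h) x = (dot (fd T k) (fd T k))^-1 *
    (f^`1^`1 (fs T k x) * h (ft T k x) + f (fs T k x) * h^`1^`1 (ft T k x)).
Proof.
move=> D0 sf sh.
exact: (laplacian_frame (T (k + 1)) (fd_fe T k) (fe_fe k D0) (fd_gt0 k D0) x sf sh).
Qed.

Section one_region.
Variables (T : triangle R) (k : 'I_3) (a b a' b' : R) (x1 x2 x3 x4 : bool).
Hypothesis D0 : tri_det T != 0.
Let I : set (measurableTypeR R) := [set` Interval (BSide x1 a) (BSide x2 b)].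
Let J : set (measurableTypeR R) := [set` Interval (BSide x3 a') (BSide x4 b')].
Let r := dot (fd T k) (fd T k).

Let mI : measurable I. Proof. exact: measurable_itv. Qed.
Let mJ : measurable J. Proof. exact: measurable_itv. Qed.

Lemma measurable_region : measurable (region T k I J : set RR).
Proof.
have := measurable_inv_frame (T (k + 1)) (fd T k) (fe T k).
by move=> /(_ measurableT _ (measurableX mI mJ)); rewrite setTI.
Qed.

Lemma region_measure_lty : (leb2 (region T k I J : set RR) < +oo)%E.
Proof.
have muI c d y z : (mu [set` Interval (BSide y c) (BSide z d)] < +oo)%E.
  by rewrite lebesgue_measure_itv /=; case: ifP => _; rewrite ?ltry.
have -> := rect_measure k D0 mI mJ.
have fI : mu I \is a fin_num by rewrite ge0_fin_numE; [exact: muI|exact: measure_ge0].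
apply: lte_mul_pinfty; [by rewrite lee_fin dot_ge0|by []|].
by apply: lte_mul_pinfty; [exact: measure_ge0|exact: fI|exact: muI].
Qed.

Lemma integrable_itv c d y z (f : R -> R) : continuous f ->
  mu.-integrable [set` Interval (BSide y c) (BSide z d)] (EFin \o f).
Proof.
move=> cf; apply: (@integrableS _ _ _ mu `[c, d]) => //; last exact: integrable_cc.
by apply: subset_itv; rewrite bnd_simp //; case: y; case: z.
Qed.

Lemma integrable_tens f h : continuous f -> continuous h ->
  leb2.-integrable (region T k I J) (EFin \o tens T k f h).
Proof.
move=> cf ch.
have h1 := fd_fe T k; have h2 := fe_fe k D0; have h3 := fd_gt0 k D0.
exact: (integrable_rect (cross_frame_neq0 h1 h2 h3) (inv_frameK (T (k + 1)) h1 h2 h3)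
  (measurable_inv_frame (T (k + 1)) (fd T k) (fe T k)) mI mJ
  (integrable_itv a b x1 x2 cf) (integrable_itv a' b' x3 x4 ch)).
Qed.

Lemma Rintegral_tens f h : continuous f -> continuous h ->
  \int[leb2]_(x in region T k I J) tens T k f h x =
  r * ((\int[mu]_(s in I) f s) * (\int[mu]_(t in J) h t)).
Proof.
move=> cf ch.
have h1 := fd_fe T k; have h2 := fe_fe k D0; have h3 := fd_gt0 k D0.
rewrite /r -(cross_frame h1 h2 h3).
exact: (Rintegral_rect (cross_frame_neq0 h1 h2 h3) (inv_frameK (T (k + 1)) h1 h2 h3)
  (measurable_inv_frame (T (k + 1)) (fd T k) (fe T k)) mI mJ
  (integrable_itv a b x1 x2 cf) (integrable_itv a' b' x3 x4 ch)).
Qed.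

Lemma Rintegral_sumn n (F : nat -> R * R -> R) (S : set (R * R)) : measurable (S : set RR) ->
  (forall i, leb2.-integrable S (EFin \o F i)) ->
  leb2.-integrable S (EFin \o (fun x => \sum_(i < n) F i x)) /\
  \int[leb2]_(x in S) (\sum_(i < n) F i x) = \sum_(i < n) \int[leb2]_(x in S) F i x.
Proof.
move=> mS H; elim: n => [|n [i1 e1]].
  have E : (fun x => \sum_(i < 0) F i x) = (fun=> 0) by apply/funext => x; rewrite big_ord0.
  rewrite E big_ord0; split; last by rewrite /Rintegral integral0_eq.
  exact: integrable0.
have E : (fun x => \sum_(i < n.+1) F i x) = (fun x => \sum_(i < n) F i x + F n x).
  by apply/funext => x; rewrite big_ord_recr.
rewrite E big_ord_recr /= -e1; split; last by rewrite RintegralD.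
by have := integrableD mS i1 (H n); apply: eq_integrable.
Qed.

Lemma Rintegral_pol_laplacian n c (f h : R -> R) : smooth1 f -> smooth1 h ->
  leb2.-integrable (region T k I J)
    (EFin \o (fun x => frame_pol (T (k + 1)) (fd T k) (fe T k) n c x * laplacian (tens T k f h) x)) /\
  \int[leb2]_(x in region T k I J)
    (frame_pol (T (k + 1)) (fd T k) (fe T k) n c x * laplacian (tens T k f h) x) =
  \sum_(i < n) \sum_(j < n) c i j *
    ((\int[mu]_(s in I) (f^`1^`1 s * s ^+ i)) * (\int[mu]_(t in J) (h t * t ^+ j)) +
     (\int[mu]_(s in I) (f s * s ^+ i)) * (\int[mu]_(t in J) (h^`1^`1 t * t ^+ j))).
Proof.
move=> sf sh; have r0 : r != 0 by rewrite gt_eqF // fd_gt0.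
have [sf2 sh2] : smooth1 f^`1^`1 /\ smooth1 h^`1^`1 by split; exact/smooth1_derive/smooth1_derive.
have cM (u : R -> R) j : smooth1 u -> continuous (fun x => u x * x ^+ j).
  by move=> su; exact/continuousMXn/smooth1_continuous.
pose G i j x := (c i j * r^-1) * (tens T k (fun s => f^`1^`1 s * s ^+ i) (fun t => h t * t ^+ j) x +
   tens T k (fun s => f s * s ^+ i) (fun t => h^`1^`1 t * t ^+ j) x).
have mS := measurable_region.
have iA i j := integrable_tens (cM _ i sf2) (cM _ j sh).
have iB i j := integrable_tens (cM _ i sf) (cM _ j sh2).
have iG i j : leb2.-integrable (region T k I J) (EFin \o G i j).
  have := integrableZl mS (c i j * r^-1) (integrableD mS (iA i j) (iB i j)).
  by apply: eq_integrable.
have GE i j : \int[leb2]_(x in region T k I J) G i j x = c i j *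
    ((\int[mu]_(s in I) (f^`1^`1 s * s ^+ i)) * (\int[mu]_(t in J) (h t * t ^+ j)) +
     (\int[mu]_(s in I) (f s * s ^+ i)) * (\int[mu]_(t in J) (h^`1^`1 t * t ^+ j))).
  rewrite /G RintegralZl //; last by have := integrableD mS (iA i j) (iB i j); apply: eq_integrable.
  rewrite RintegralD // !Rintegral_tens; try exact: cM.
  by rewrite -mulrDr mulrA divfK.
have E : (fun x => frame_pol (T (k + 1)) (fd T k) (fe T k) n c x * laplacian (tens T k f h) x) =
   (fun x => \sum_(i < n) \sum_(j < n) G i j x).
  apply/funext => x; rewrite laplacian_tens // /frame_pol mulr_suml; apply: eq_bigr => i _.
  rewrite mulr_suml; apply: eq_bigr => j _; rewrite /G /tens -/r -/(fs T k x) -/(ft T k x).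
  move: (f^`1^`1 _) (h^`1^`1 _) (f _) (h _) (fs T k x ^+ i) (ft T k x ^+ j) (c i j) r^-1 => *.
  by ring.
have iR i := Rintegral_sumn n mS (iG i).
have [i1 e1] := @Rintegral_sumn n (fun i x => \sum_(j < n) G i j x) _ mS (fun i => (iR i).1).
rewrite E; split=> //; rewrite e1; apply: eq_bigr => i _.
by rewrite (iR i).2; apply: eq_bigr => j _; exact: GE.
Qed.

End one_region.
End integrals_in_frame.

(** * Testing with Laplacians of mean zero *)

Section residual.
Context {R : realType}.
Local Notation mu := (@lebesgue_measure R).
Local Notation leb2 := (mu \x mu)%E.
Local Notation RR := (measurableTypeR R * measurableTypeR R)%type.
Implicit Types (T : triangle R) (k : 'I_3) (Om S : set (R * R)).

Lemma within_measurable Om (U : R * R -> R) : open Om -> {within closure Om, continuous U} ->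
  measurable_fun (Om : set RR) (U : RR -> R).
Proof.
move=> oO cU; have cU' : {in Om, continuous U}.
  have := continuous_subspaceW (@subset_closure _ Om) cU.
  by rewrite continuous_open_subspace.
apply: (measurability _ (RGenOpens.measurableE R)).
move=> _ [_ [a [b ->] <-]]; apply: open_measurable2.
rewrite openE => y [Oy Uy]; rewrite /interior.
have h1 : nbhs y Om by exact: open_nbhs_nbhs.
have h2 : nbhs y (U @^-1` `]a, b[).
  have /cU'/= := mem_set Oy; apply.
  by apply: open_nbhs_nbhs; split=> //; exact: interval_open.
exact: filterI h1 h2.
Qed.

Lemma within_L2sq Om (U : R * R -> R) : open Om -> bounded_set Om ->
  {within closure Om, continuous U} -> (L2sq Om U < +oo)%E.
Proof.
move=> oO bO cU; have [M [M0 OM]] := bounded_box bO.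
have mO := open_measurable2 oO; have Ofin := bounded_measure mO bO.
have cl : compact (closure Om).
  have cb : compact (box M) by apply: compact_setX; exact: segment_compact.
  have hc : closed (box M).
    by apply: compact_closed => //; exact: (@Rhausdorff (R * R)%type).
  apply: (subclosed_compact _ cb); first exact: closed_closure.
  by move=> x /(closure_subset OM); rewrite -(closure_id _).1.
have /compact_bounded [B [_ HB]] := continuous_compact cU cl.
have B1 : B < `|B| + 1 by rewrite (le_lt_trans (ler_norm _)) // ltrDl.
have i1 := integrable_cst_fin ((`|B| + 1) ^+ 2) mO Ofin.
apply: le_lt_trans (integrable_lty mO i1).
apply: ge0_le_integral_any => //.
- by move=> x _; rewrite lee_fin sqr_ge0.
- by move=> x _; rewrite /= lee_fin sqr_ge0.
move=> x Ox; rewrite /= lee_fin -real_normK ?num_real // lerXn2r ?nnegrE //.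
by apply: HB => //; exists x => //; exact: subset_closure.
Qed.

Lemma L2sq_sub Om (u U : R * R -> R) : measurable (Om : set RR) ->
  measurable_fun (Om : set RR) (u : RR -> R) -> measurable_fun (Om : set RR) (U : RR -> R) ->
  (L2sq Om u < +oo)%E -> (L2sq Om U < +oo)%E -> (L2sq Om (u \- U)%R < +oo)%E.
Proof.
move=> mO mu_u mU hu hU.
have i1 := integrableZl mO 2 (integrableD mO (integrable_sqr mu_u hu) (integrable_sqr mU hU)).
apply: le_lt_trans (integrable_lty mO i1).
apply: ge0_le_integral_any => //.
- by move=> x _; rewrite lee_fin sqr_ge0.
- by move=> x _; rewrite /= lee_fin mulr_ge0 // addr_ge0 // sqr_ge0.
move=> x _; rewrite -EFinD -EFinM lee_fin /=; have := sqr_ge0 (u x + U x).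
by move: (u x) (U x) => p q; lra.
Qed.

Lemma integrable_restrict_sqr Om S (u : R * R -> R) : measurable (Om : set RR) ->
  (leb2 (Om : set RR) < +oo)%E -> measurable_fun (Om : set RR) (u : RR -> R) ->
  (L2sq Om u < +oo)%E -> measurable (S : set RR) -> S `<=` Om ->
  leb2.-integrable S (EFin \o u).
Proof.
move=> mO Ofin mu_u hu mS SO; apply: (@integrableS _ _ _ leb2 Om) => //.
exact: integrable_of_sqr.
Qed.

(** The Galerkin error enters only through its seminorm on S: away from the
    sources u is orthogonal to the Laplacians of test functions, and these have
    mean zero on S, so that u - U may be replaced by its oscillation. The
    negligible set Nl leaves room for the common edge of two triangles. *)
Lemma residual_le (N : nat) (alpha : 'I_N -> R) (x : 'I_N -> R * R) Om (u U phi : R * R -> R) S (Nl : set (R * R))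
    (theta M D : R) :
  open Om -> bounded_set Om -> 0 < theta < 2^-1 -> weak_solution Om alpha x u ->
  {within closure Om, continuous U} ->
  test_fun Om phi -> (forall j, phi (x j) = 0) ->
  measurable (S : set RR) -> S `<=` Om -> measurable (Nl : set RR) -> leb2 (Nl : set RR) = 0%E ->
  S `<=` ~` Nl -> (forall y, ~ S y -> ~ Nl y -> laplacian phi y = 0) ->
  0 < M -> (forall y, `|laplacian phi y| <= M) ->
  0 < D -> (forall y z, S y -> S z -> enorm (y - z) <= D) ->
  \int[leb2]_(y in S) laplacian phi y = 0 ->
  (((\int[leb2]_(y in S) (U y * laplacian phi y)) ^+ 2)%:E <=
    (M ^+ 2 * D `^ (2 + 2 * (1 - theta)))%:E * gagliardo (1 - theta) S (u \- U)%R)%E.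
Proof.
move=> oO bO th ws cU tphi phi0 mS SO mN N0 SN lapS M0 lapM D0 SD lap0.
have mO := open_measurable2 oO; have Ofin := bounded_measure mO bO.
have [Hu ub] := ws _ th; have mu_u := Hu.1.
have [sp _ _] := tphi; have [cphi _ _ _ _] := smooth_dir sp.
have H1 : H0 1 theta Om phi.
  split; first by apply: measurable_funTS; exact: continuous_measurable2.
  by exists (fun=> phi); exact: H0_cvg_cst.
have [hu eu] := weak_laplacian oO bO Hu tphi (ub _ H1 (continuous_subspaceT cphi)).
have b0 : \sum_(j < N) alpha j * phi (x j) = 0.
  by rewrite big1 // => j _; rewrite phi0 mulr0.
rewrite b0 oppr0 in eu.
have mU := within_measurable oO cU; have hU := within_L2sq oO bO cU.
have Sfin : (leb2 (S : set RR) < +oo)%E.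
  by apply: le_lt_trans Ofin; apply: le_measure; rewrite ?inE.
have cl := continuous_laplacian sp.
have ml (A : set (R * R)) : measurable_fun (A : set RR) (laplacian phi : RR -> R).
  by apply: measurable_funTS; exact: continuous_measurable2.
have iM (A : set (R * R)) f : measurable (A : set RR) -> leb2.-integrable A (EFin \o f) ->
    leb2.-integrable A (EFin \o (fun y => f y * laplacian phi y)).
  by move=> mA; exact: (integrableM_bounded mA (ml A) M0 (fun y _ => lapM y)).
have iu := integrable_restrict_sqr mO Ofin mu_u hu.
have iU := integrable_restrict_sqr mO Ofin mU hU.
have uS : \int[leb2]_(y in S) (u y * laplacian phi y) = 0.
  rewrite -[RHS]eu [in RHS]/Rintegral (negligible_integral mN mO (iM _ _ mO (iu _ mO (@subset_refl _ _))) N0).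
  rewrite -/(Rintegral _ _ _) [LHS]Rintegral_mkcond [RHS]Rintegral_mkcond.
  congr Rintegral; apply/funext => y; rewrite !patchE.
  case: ifPn => [/set_mem Sy|/negP nS].
    by rewrite mem_set //; split; [exact: SO|exact: SN].
  case: ifPn => // /set_mem [Oy Ny].
  by rewrite lapS ?mulr0 // => Sy; apply: nS; exact: mem_set.
have mw : measurable_fun (S : set RR) ((u \- U)%R : RR -> R).
  apply: measurable_funB; [exact: measurable_funS mu_u|exact: measurable_funS mU].
have hw : (L2sq S (u \- U)%R < +oo)%E.
  apply: le_lt_trans (L2sq_sub mO mu_u mU hu hU).
  by apply: ge0_le_integral_any => // y _; rewrite lee_fin sqr_ge0.
have := mean_zero_gagliardo mS Sfin mw hw (ml S) M0 (fun y _ => lapM y) lap0 _ D0 SD.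
have t0 : 0 < 1 - theta by lra.
move=> /(_ _ t0); congr (_ <= _)%E; congr EFin.
have -> : \int[leb2]_(y in S) ((u \- U)%R y * laplacian phi y) = - \int[leb2]_(y in S) (U y * laplacian phi y).
  under eq_Rintegral do rewrite /= mulrBl.
  by rewrite RintegralB ?uS ?sub0r //; [exact: iM (iu _ _ _)|exact: iM (iU _ _ _)].
by rewrite sqrrN.
Qed.

(** The support is closed in the image of a compact rectangle. *)
Lemma test_fun_tens T k Om (f h : R -> R) (a b a' b' : R) : tri_det T != 0 ->
  test1 a b f -> test1 a' b' h -> region T k `[a, b]%classic `[a', b']%classic `<=` Om ->
  test_fun Om (tens T k f h).
Proof.
move=> D0 [sf f0] [sh h0] sub.
have sm : smooth (tens T k f h).
  exact: (sum_ten_smooth (SumTen1 _ _ _ _ sf sh)).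
set Q := region _ _ _ _ in sub.
have QE : Q = aff (T (k + 1)) (fd T k) (fe T k) @` (`[a, b]%classic `*` `[a', b']%classic).
  apply/seteqP; split=> [y [y1 y2]|_ [[s t] [/= hs ht] <-]].
    exists (inv_frame (T (k + 1)) (fd T k) (fe T k) y); first by split.
    exact: (affK _ (fd_fe T k) (fe_fe k D0) (fd_gt0 k D0)).
  have := inv_frameK (T (k + 1)) (fd_fe T k) (fe_fe k D0) (fd_gt0 k D0) (s, t).
  by move=> [e1 e2]; split; rewrite /fs /ft ?e1 ?e2.
have cQ : compact Q.
  rewrite QE; apply: continuous_compact.
    have caff (a0 d1 d2 : R) : continuous (fun p : R * R => a0 + p.1 * d1 + p.2 * d2).
      have -> : (fun p : R * R => a0 + p.1 * d1 + p.2 * d2) = (fun p => dot (d1, d2) p + a0).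
        by apply/funext => p; rewrite /dot /=; ring.
      exact: continuous_dot.
    by apply: continuous_subspaceT => p; apply: (cvg_pair (caff _ _ _ p) (caff _ _ _ p)).
  exact: (compact_setX (@segment_compact R a b) (@segment_compact R a' b')).
have clQ : closed Q by apply: compact_closed => //; exact: (@Rhausdorff (R * R)%type).
have supQ : closure [set y | tens T k f h y != 0] `<=` Q.
  rewrite [X in _ `<=` X](closure_id _).1 //; apply: closure_subset => y /= ny.
  have [n1 n2] : f (fs T k y) != 0 /\ h (ft T k y) != 0.
    by apply/andP; rewrite -negb_or -mulf_eq0.
  have /andP[q1 q2] : a < fs T k y < b by apply: contraNT n1 => /f0 ->.
  have /andP[q3 q4] : a' < ft T k y < b' by apply: contraNT n2 => /h0 ->.
  by split; rewrite /= in_itv /= !ltW.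
split=> //; last exact: subset_trans sub.
exact: (subclosed_compact (@closed_closure _ _) cQ supQ).
Qed.

End residual.

(** * Coefficients read off by test functions *)

Section coefficients.
Context {R : realType}.
Implicit Types (T : triangle R) (k : 'I_3) (c : nat -> nat -> R).

Lemma sum_delta n (F : nat -> R) a : (a < n)%N -> \sum_(i < n) (i == a :> nat)%:R * F i = F a.
Proof.
move=> an; rewrite (bigD1 (Ordinal an)) //= eqxx mul1r big1 ?addr0 // => i ia.
by rewrite -val_eqE /= in ia; rewrite (negPf ia) mul0r.
Qed.

Definition fpol T k l c := frame_pol (T (k + 1)) (fd T k) (fe T k) l.+1 c.

Lemma poly2_fpol T k l p : tri_det T != 0 -> poly2 l p -> exists c, p = fpol T k l c.
Proof.
move=> D0 /(poly2_frame (T (k + 1)) (fd T k) (fe T k)) [c Hc]; exists c.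
apply/funext => y; rewrite -{1}(affK (T (k + 1)) (fd_fe T k) (fe_fe k D0) (fd_gt0 k D0) y).
exact: Hc.
Qed.

(** The constant polynomial 1 turns the pairing with a Laplacian into its mean,
    which vanishes because the corresponding coefficients do. *)
Lemma fpol1 T k l y : fpol T k l (fun i j => ((i == 0%N) && (j == 0%N))%:R) y = 1.
Proof.
rewrite /fpol /frame_pol big_ord_recl /= big_ord_recl /= !expr0 !mulr1 !big1 ?addr0 //.
- by move=> i _; rewrite big1 // => j _; rewrite /= !mul0r.
- by move=> i _; rewrite /= !mul0r.
Qed.

(** The coefficients of the Laplacian of [fpol], up to the squared length of
    the edge. *)
Definition lap_coef l c a b : R := \sum_(i < l.+1) \sum_(j < l.+1) c i j *
  (i%:R * (i.-1%:R * (i.-2 == a)%:R) * (j == b :> nat)%:R +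
   (i == a :> nat)%:R * (j%:R * (j.-1%:R * (j.-2 == b)%:R))).

Lemma lap_coef1 l a b : lap_coef l (fun i j => ((i == 0%N) && (j == 0%N))%:R) a b = 0.
Proof.
rewrite /lap_coef big1 // => -[[|i] hi] _; rewrite big1 // => -[[|j] hj] _ /=; ring.
Qed.

Lemma le_pred2 l j : (j <= l)%N -> (j.-2 <= l)%N.
Proof. by move=> jl; rewrite (leq_trans _ jl) // (leq_trans (leq_pred _)) // leq_pred. Qed.

Lemma laplacian_fpol T k l c y : tri_det T != 0 ->
  laplacian (fpol T k l c) y = (dot (fd T k) (fd T k))^-1 *
    \sum_(a < l.+1) \sum_(b < l.+1) lap_coef l c a b * fs T k y ^+ a * ft T k y ^+ b.
Proof.
move=> D0; rewrite /fpol (laplacian_frame_pol _ (fd_fe T k) (fe_fe k D0) (fd_gt0 k D0)).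
congr (_ * _); symmetry; rewrite -/(fs T k y) -/(ft T k y).
set s := fs _ _ _; set t := ft _ _ _.
have swap (F : nat -> nat -> nat -> R) : \sum_(a < l.+1) \sum_(b < l.+1) \sum_(i < l.+1) F a b i =
    \sum_(i < l.+1) \sum_(a < l.+1) \sum_(b < l.+1) F a b i.
  by rewrite [RHS]exchange_big; apply: eq_bigr => a _; rewrite exchange_big.
pose G i j a b := c i j *
  (i%:R * (i.-1%:R * (i.-2 == a)%:R) * (j == b :> nat)%:R +
   (i == a :> nat)%:R * (j%:R * (j.-1%:R * (j.-2 == b)%:R))) * s ^+ a * t ^+ b.
transitivity (\sum_(a < l.+1) \sum_(b < l.+1) \sum_(i < l.+1) \sum_(j < l.+1) G i j a b).
  apply: eq_bigr => a _; apply: eq_bigr => b _; rewrite /lap_coef !mulr_suml.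
  by apply: eq_bigr => i _; rewrite !mulr_suml.
rewrite (swap (fun a b i => \sum_(j < l.+1) G i j a b)); apply: eq_bigr => i _.
rewrite (swap (fun a b j => G i j a b)); apply: eq_bigr => j _.
have [il jl] : (i < l.+1)%N /\ (j < l.+1)%N by [].
have [il2 jl2] : (i.-2 < l.+1)%N /\ (j.-2 < l.+1)%N by rewrite !ltnS !le_pred2.
transitivity (\sum_(a < l.+1) (c i j * (i%:R * (i.-1%:R * ((a == i.-2 :> nat)%:R * s ^+ a))) * t ^+ j +
   c i j * ((a == i :> nat)%:R * s ^+ a) * (j%:R * (j.-1%:R * t ^+ j.-2)))).
  apply: eq_bigr => a _; rewrite -[t ^+ j](sum_delta (fun b => t ^+ b) jl) -[t ^+ j.-2](sum_delta (fun b => t ^+ b) jl2).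
  rewrite !mulr_sumr -big_split /=; apply: eq_bigr => b _; rewrite /G !(eq_sym _ (a : nat)) !(eq_sym _ (b : nat)).
  by move: (s ^+ a) (t ^+ b) (_ == i.-2)%:R (_ == i :> nat)%:R (_ == j.-2)%:R (_ == j :> nat)%:R => *; ring.
rewrite big_split /= -!mulr_suml -!mulr_sumr.
by rewrite (sum_delta (fun a => s ^+ a) il2) (sum_delta (fun a => s ^+ a) il).
Qed.

Lemma norm_pol2_le n (q : nat -> nat -> R) (Q L s t : R) : 1 <= L -> `|s| <= L -> `|t| <= L -> 0 <= Q ->
  (forall a b, (a < n)%N -> (b < n)%N -> `|q a b| <= Q) ->
  `|\sum_(a < n) \sum_(b < n) q a b * s ^+ a * t ^+ b| <= n%:R * n%:R * (Q * (L ^+ n * L ^+ n)).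
Proof.
move=> L1 sL tL Q0 qQ; have L0 : 0 <= L by lra.
have pw (r : R) (a : 'I_n) : `|r| <= L -> `|r ^+ a| <= L ^+ n.
  move=> rL; rewrite normrX (le_trans (_ : _ <= L ^+ a)) ?lerXn2r ?nnegrE //.
  by rewrite ler_weXn2l // ltnW.
apply: (le_trans (ler_norm_sum _ _ _)).
have -> : n%:R * n%:R * (Q * (L ^+ n * L ^+ n)) = \sum_(a < n) \sum_(b < n) (Q * (L ^+ n * L ^+ n)).
  by rewrite !sumr_const !card_ord -mulrnA -[RHS]mulr_natl natrM.
apply: ler_sum => a _; apply: (le_trans (ler_norm_sum _ _ _)); apply: ler_sum => b _.
by rewrite !normrM -mulrA ler_pM ?mulr_ge0 ?qQ // ler_pM ?pw.
Qed.

Lemma norm_pol1_le n (q : nat -> R) (Q s : R) : `|s| <= 1 -> 0 <= Q ->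
  (forall a, (a < n)%N -> `|q a| <= Q) -> `|\sum_(a < n) q a * s ^+ a| <= n%:R * Q.
Proof.
move=> s1 Q0 qQ; apply: (le_trans (ler_norm_sum _ _ _)).
have -> : n%:R * Q = \sum_(a < n) Q by rewrite sumr_const card_ord mulr_natl.
apply: ler_sum => a _; apply: le_trans (qQ a (ltn_ord a)).
by rewrite normrM normrX ler_piMr // exprn_ile1.
Qed.

End coefficients.

Section pairings.
Context {R : realType}.
Local Notation mu := (@lebesgue_measure R).
Local Notation leb2 := (mu \x mu)%E.
Variables (T : triangle R) (k : 'I_3) (l : nat) (delta : R).
Hypotheses (D0 : tri_det T != 0) (d0 : 0 < delta).

(** The half of the strip along the edge on the side of the triangle; [lower] is
    its mirror image. *)
Definition upper T k delta : set (R * R) := region T k `[1 / 4, 3 / 4]%classic `]0, delta]%classic.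
Definition lower T k delta : set (R * R) := region T k `[1 / 4, 3 / 4]%classic `[- delta, 0[%classic.

Variables (f : R -> R) (A B : R) (a : nat).
Hypotheses (tf : test1 A B f) (A4 : 1 / 4 <= A) (B4 : B <= 3 / 4).
Hypothesis mf : forall j, (j <= l)%N -> mom (1 / 4) (3 / 4) f j = (j == a)%:R.

Let f2 i : (i <= l)%N -> mom (1 / 4) (3 / 4) f^`1^`1 i = i%:R * (i.-1%:R * (i.-2 == a)%:R).
Proof.
by move=> il; rewrite (mom_test1_derive2 _ _ A4 B4 tf) ?mf ?le_pred2 //; lra.
Qed.

Let oc (h : R -> R) j : smooth1 h ->
  \int[mu]_(t in `]0, delta]%classic) (h t * t ^+ j) = mom 0 delta h j.
Proof.
move=> /smooth1_continuous ch.
exact/Rintegral_itv_obnd_cbnd/(integrable_itv _ _ _ _ (continuousMXn ch)).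
Qed.

Let co (h : R -> R) j : smooth1 h ->
  \int[mu]_(t in `[- delta, 0[%classic) (h t * t ^+ j) = mom (- delta) 0 h j.
Proof.
move=> /smooth1_continuous ch.
exact/Rintegral_itv_bndo_bndc/(integrable_itv _ _ _ _ (continuousMXn ch)).
Qed.

(** Integrating by parts twice in each variable moves the Laplacian to the
    polynomial; the dual functions then select one of its coefficients. *)
Lemma pairing_element h b c : test1 (delta / 4) (delta / 2) h ->
  (forall j, (j <= l)%N -> mom 0 delta h j = (j == b)%:R) ->
  \int[leb2]_(y in upper T k delta) (fpol T k l c y * laplacian (tens T k f h) y) = lap_coef l c a b.
Proof.
move=> th mh; have [sh _] := th; have sh2 := smooth1_derive (smooth1_derive sh).
have [_ ->] := Rintegral_pol_laplacian k (1 / 4) (3 / 4) 0 delta true false false false D0 l.+1 c tf.1 sh.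
apply: eq_bigr => i _; apply: eq_bigr => j _; congr (_ * _).
have [il jl] : (i <= l)%N /\ (j <= l)%N by split; rewrite -ltnS.
rewrite !oc // -!/(mom _ _ _ _) f2 // mf // mh //.
have [q1 q2] : 0 <= delta / 4 /\ delta / 2 <= delta by split; move: d0; lra.
by rewrite (mom_test1_derive2 _ d0 q1 q2 th) mh ?le_pred2.
Qed.

(** The moments of the profile vanish, so the derivatives along the edge
    disappear, and its second derivative selects the normal derivative on the
    edge. The two sides give opposite signs, so that their sum is a coefficient
    of the jump. *)
Lemma pairing_edge g c : (0 < l)%N -> (a <= l)%N ->
  test1 (- (delta / 2)) (delta / 2) g ->
  (forall j, (j <= l)%N -> mom 0 delta g j = 0) ->
  (forall j, (j <= l)%N -> mom (- delta) 0 g j = 0) ->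
  (forall j, (j <= l)%N -> mom 0 delta g^`1^`1 j = (j == 1)%:R) ->
  (forall j, (j <= l)%N -> mom (- delta) 0 g^`1^`1 j = - (j == 1)%:R) ->
  \int[leb2]_(y in upper T k delta) (fpol T k l c y * laplacian (tens T k f g) y) = c a 1%N /\
  \int[leb2]_(y in lower T k delta) (fpol T k l c y * laplacian (tens T k f g) y) = - c a 1%N.
Proof.
move=> l0 al [sg _] g1 g2 g3 g4; have sg2 := smooth1_derive (smooth1_derive sg).
have E (e : R) (F : 'I_l.+1 -> 'I_l.+1 -> R) : (forall i j, F i j = c i j * (e * ((i == a :> nat)%:R * (j == 1%N :> nat)%:R))) ->
    \sum_(i < l.+1) \sum_(j < l.+1) F i j = e * c a 1%N.
  move=> H; have al' : (a < l.+1)%N by [].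
  rewrite -(sum_delta (fun i => e * c i 1%N) al'); apply: eq_bigr => i _.
  rewrite -(sum_delta (fun j => e * c i j) (l0 : (1 < l.+1)%N)) mulr_sumr; apply: eq_bigr => j _.
  rewrite H.
  by move: (c i j) (_ == a :> nat)%:R (_ == 1%N :> nat)%:R => c0 p q; ring.
split.
  have [_ ->] := Rintegral_pol_laplacian k (1 / 4) (3 / 4) 0 delta true false false false D0 l.+1 c tf.1 sg.
  rewrite -[RHS]mul1r; apply: E => i j; have [il jl] := (leq_ord i, leq_ord j); congr (_ * _).
  by rewrite !oc // -!/(mom _ _ _ _) f2 // mf // g1 // g3 // mulr0 add0r mul1r.
have [_ ->] := Rintegral_pol_laplacian k (1 / 4) (3 / 4) (- delta) 0 true false true true D0 l.+1 c tf.1 sg.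
rewrite -[RHS]mulN1r; apply: E => i j; have [il jl] := (leq_ord i, leq_ord j); congr (_ * _).
by rewrite !co // -!/(mom _ _ _ _) f2 // mf // g2 // g4 // mulr0 add0r mulN1r mulrN.
Qed.

End pairings.

(** * Residuals bounded by the seminorm of the error *)

Lemma integrable_setU d (X : measurableType d) (R : realType) (m : {measure set X -> \bar R})
    (A B : set X) (f : X -> \bar R) : measurable A -> measurable B -> [disjoint A & B] ->
  m.-integrable A f -> m.-integrable B f -> m.-integrable (A `|` B) f.
Proof.
move=> mA mB AB /integrableP[mf fA] /integrableP[mf' fB].
have mU : measurable_fun (A `|` B) f by apply/measurable_funU.
have mN : measurable_fun (A `|` B) (fun x => `|f x|%E).
  exact: (measurableT_comp (@abse_measurable R setT) mU).
apply/integrableP; split=> //.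
have -> := ge0_integral_setU m mA mB mN (fun x _ => abse_ge0 (f x)) AB.
exact: lte_add_pinfty fA fB.
Qed.

Section local_residuals.
Context {R : realType}.
Local Notation mu := (@lebesgue_measure R).
Local Notation leb2 := (mu \x mu)%E.
Local Notation RR := (measurableTypeR R * measurableTypeR R)%type.
Variables (Om : set (R * R)) (N : nat) (alpha : 'I_N -> R) (x : 'I_N -> R * R).
Variables (u U : R * R -> R) (theta tau : R) (l : nat).
Hypotheses (oO : open Om) (bO : bounded_set Om) (th : 0 < theta < 2^-1).
Hypotheses (ws : weak_solution Om alpha x u) (cU : {within closure Om, continuous U}).
Hypotheses (tau01 : 0 < tau <= 1) (l0 : (0 < l)%N).
Let delta := tau / 16.
Let d0 : 0 < delta. Proof. by move: tau01; rewrite /delta; lra. Qed.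
Variables (chi : nat -> nat -> R -> R) (xi : nat -> R -> R) (g : R -> R) (C : R).
Hypotheses (C0 : 0 < C)
  (Hchi : forall k i, (k <= N)%N -> test1 (cell N k) (cell N k.+1) (chi k i) /\
      forall j, (j <= l)%N -> mom (1 / 4) (3 / 4) (chi k i) j = (j == i)%:R)
  (Hxi : forall i, test1 (delta / 4) (delta / 2) (xi i) /\
      forall j, (j <= l)%N -> mom 0 delta (xi i) j = (j == i)%:R)
  (Hg : [/\ test1 (- (delta / 2)) (delta / 2) g,
      forall j, (j <= l)%N -> mom 0 delta g j = 0,
      forall j, (j <= l)%N -> mom (- delta) 0 g j = 0,
      forall j, (j <= l)%N -> mom 0 delta g^`1^`1 j = (j == 1)%:R &
      forall j, (j <= l)%N -> mom (- delta) 0 g^`1^`1 j = - (j == 1)%:R])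
  (HC : forall k i, (k <= N)%N -> (i <= l)%N ->
      (forall j s t, (j <= l)%N -> `|(chi k i)^`1^`1 s * xi j t + chi k i s * (xi j)^`1^`1 t| <= C) /\
      (forall s t, `|(chi k i)^`1^`1 s * g t + chi k i s * g^`1^`1 t| <= C)).

(** The square of the size C/r of the Laplacian of a test function, times the
    diameter of the strip to the power of the Gagliardo kernel. *)
Definition res_const (C theta r : R) := (C / r) ^+ 2 * Num.sqrt r `^ (2 + 2 * (1 - theta)).

Lemma laplacian_tens_out T k (f h : R -> R) (a b a' b' : R) y : tri_det T != 0 ->
  test1 a b f -> test1 a' b' h -> ~~ ((a < fs T k y < b) && (a' < ft T k y < b')) ->
  laplacian (tens T k f h) y = 0.
Proof.
move=> D0 tf th'; have [sf f0] := tf; have [sh h0] := th'; rewrite laplacian_tens //.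
have [_ f2] := test1_derive (test1_derive tf); have [_ h2] := test1_derive (test1_derive th').
by rewrite negb_and => /orP[q|q]; [rewrite f0 // f2 //|rewrite h0 // h2 //];
  rewrite ?mul0r ?mulr0 addr0 mulr0.
Qed.

Lemma strip_diameter T k (S : set (R * R)) : tri_det T != 0 ->
  S `<=` region T k `[1 / 4, 3 / 4]%classic `[- delta, delta]%classic ->
  forall y z, S y -> S z -> enorm (y - z) <= Num.sqrt (dot (fd T k) (fd T k)).
Proof.
move=> D0 Sub y z /Sub[h1 h2] /Sub[h3 h4]; move: h1 h2 h3 h4; rewrite /= !in_itv /= => h1 h2 h3 h4.
rewrite /enorm ler_wsqrtr // (dot_diff k D0) ler_piMr ?dot_ge0 //.
have dl : delta <= 1 / 16 by rewrite /delta; move: tau01; lra.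
move: h1 h2 h3 h4; set s := fs T k y; set s' := fs T k z; set t := ft T k y; set t' := ft T k z.
move=> h1 h2 h3 h4.
have e1 : `|s - s'| <= 1 / 2 by rewrite ler_norml; lra.
have e2 : `|t - t'| <= 1 / 8 by rewrite ler_norml; lra.
have q1 : (s - s') ^+ 2 <= (1 / 2) ^+ 2 by rewrite -real_normK ?num_real // lerXn2r ?nnegrE.
have q2 : (t - t') ^+ 2 <= (1 / 8) ^+ 2 by rewrite -real_normK ?num_real // lerXn2r ?nnegrE.
by move: q1 q2; lra.
Qed.

Lemma upper_strip T k : upper T k delta `<=` region T k `[1 / 4, 3 / 4]%classic `[- delta, delta]%classic.
Proof.
move=> y [h1]; rewrite /= !in_itv /= => h2; split=> //; rewrite /= in_itv /=.
by move: d0 h2; lra.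
Qed.

Lemma lower_strip T k : lower T k delta `<=` region T k `[1 / 4, 3 / 4]%classic `[- delta, delta]%classic.
Proof.
move=> y [h1]; rewrite /= !in_itv /= => h2; split=> //; rewrite /= in_itv /=.
by move: d0 h2; lra.
Qed.

Let lap_le T k (f h : R -> R) : tri_det T != 0 -> smooth1 f -> smooth1 h ->
  (forall s t, `|f^`1^`1 s * h t + f s * h^`1^`1 t| <= C) ->
  forall y, `|laplacian (tens T k f h) y| <= C / dot (fd T k) (fd T k).
Proof.
move=> D0 sf sh H y; rewrite laplacian_tens // normrM mulrC ler_pM //.
by rewrite ger0_norm // invr_ge0 dot_ge0.
Qed.

Lemma fat_upper T k : fat tau T -> tri_det T != 0 -> upper T k delta `<=` tri_int T.
Proof.
move=> fT D0 y [h1 h2]; apply: (@fat_tri_int _ _ k D0 tau) => //; first by case/andP: tau01.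
  by move: h1; rewrite /= in_itv /=; lra.
by move: h2; rewrite /= in_itv /= /delta; move: tau01; lra.
Qed.

(** The test function is supported in one triangle, where U is a polynomial,
    and avoids the sources because its tangential factor lives in a free cell. *)
Lemma element_residual T k c a b : tri_det T != 0 -> fat tau T -> tri_int T `<=` Om ->
  (forall y, upper T k delta y -> U y = fpol T k l c y) -> (a <= l)%N -> (b <= l)%N ->
  (((lap_coef l c a b) ^+ 2)%:E <= (res_const C theta (dot (fd T k) (fd T k)))%:E *
     gagliardo (1 - theta) (upper T k delta) (u \- U)%R)%E.
Proof.
move=> D0 fT TO Uc al bl; set r := dot _ _; have r0 : 0 < r := fd_gt0 k D0.
have [k0 [k0N free]] := free_cell (fun j => fs T k (x j)).
have [tchi mchi] := Hchi a k0N; have [txi mxi] := Hxi b.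
have [_ chi0] := tchi; have [A4 B4] := (@cell_ge R N k0, @cell_le R N k0 k0N).
have [Cb _] := HC k0N al; set phi := tens T k (chi k0 a) (xi b).
have cell01 := @cell_lt R N k0.
have SO : upper T k delta `<=` Om by apply: subset_trans TO; exact: fat_upper.
have tphi : test_fun Om phi.
  apply: (test_fun_tens D0 tchi txi) => y [h1 h2]; apply: SO; split.
    by move: h1; rewrite /= !in_itv /=; lra.
  by move: h2 d0; rewrite /= !in_itv /=; lra.
have pair c' := pairing_element k D0 d0 tchi A4 B4 mchi c' txi mxi.
have mean : \int[leb2]_(y in upper T k delta) laplacian phi y = 0.
  rewrite -(lap_coef1 l a b) -pair; apply: eq_Rintegral => y _.
  by rewrite fpol1 mul1r.
have -> : lap_coef l c a b = \int[leb2]_(y in upper T k delta) (U y * laplacian phi y).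
  by rewrite -pair; apply: eq_Rintegral => y /set_mem Sy; rewrite Uc.
apply: (residual_le (Nl := set0) oO bO th ws cU tphi) => //.
- by move=> j; rewrite /phi /tens chi0 ?mul0r.
- exact: measurable_region.
- by move=> y Sy; apply.
- by move=> y nS _; apply: (laplacian_tens_out D0 tchi txi); apply/negP => /andP[h1 h2];
    apply: nS; split; rewrite /= in_itv /=; move: h1 h2 d0; lra.
- by rewrite divr_gt0.
- by apply: lap_le => // [||s t]; [exact: tchi.1|exact: txi.1|exact: Cb].
- by rewrite sqrtr_gt0.
- exact: (strip_diameter D0 (@upper_strip _ _)).
Qed.

(** The test function crosses the edge, so that U contributes two polynomials,
    one from each triangle, and only the jump of the normal derivative remains. *)
Lemma edge_residual T k c c' a : tri_det T != 0 ->
  region T k `[1 / 4, 3 / 4]%classic `[- delta, delta]%classic `<=` Om ->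
  (forall y, upper T k delta y -> U y = fpol T k l c y) ->
  (forall y, lower T k delta y -> U y = fpol T k l c' y) -> (a <= l)%N ->
  (((c a 1%N - c' a 1%N) ^+ 2)%:E <= (res_const C theta (dot (fd T k) (fd T k)))%:E *
     gagliardo (1 - theta) (upper T k delta `|` lower T k delta) (u \- U)%R)%E.
Proof.
move=> D0 RO Uc Uc' al; set r := dot _ _; have r0 : 0 < r := fd_gt0 k D0.
have [k0 [k0N free]] := free_cell (fun j => fs T k (x j)).
have [tchi mchi] := Hchi a k0N; have [tg g1 g2 g3 g4] := Hg.
have [_ chi0] := tchi; have [A4 B4] := (@cell_ge R N k0, @cell_le R N k0 k0N).
have [_ Cb] := HC k0N al; set phi := tens T k (chi k0 a) g.
have cell01 := @cell_lt R N k0.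
have SR : upper T k delta `|` lower T k delta `<=` region T k `[1 / 4, 3 / 4]%classic `[- delta, delta]%classic.
  by move=> y [/upper_strip|/lower_strip].
have tphi : test_fun Om phi.
  apply: (test_fun_tens D0 tchi tg) => y [h1 h2]; apply: RO; split.
    by move: h1; rewrite /= !in_itv /=; lra.
  by move: h2 d0; rewrite /= !in_itv /=; lra.
have pair p := pairing_edge k D0 tchi A4 B4 mchi p l0 al tg g1 g2 g3 g4.
have mup : measurable (upper T k delta : set RR) by exact: measurable_region.
have mlo : measurable (lower T k delta : set RR) by exact: measurable_region.
have dis : [disjoint upper T k delta & lower T k delta].
  apply/disj_setPS => y [[_ +] [_]]; rewrite /= !in_itv /= => h1 h2; move: h1 h2; lra.
have iu p : leb2.-integrable (upper T k delta) (EFin \o (fun y => fpol T k l p y * laplacian phi y)).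
  exact: (Rintegral_pol_laplacian k _ _ _ _ _ _ _ _ D0 l.+1 p tchi.1 tg.1).1.
have il p : leb2.-integrable (lower T k delta) (EFin \o (fun y => fpol T k l p y * laplacian phi y)).
  exact: (Rintegral_pol_laplacian k _ _ _ _ _ _ _ _ D0 l.+1 p tchi.1 tg.1).1.
have split_int (V : R * R -> R) p p' : (forall y, upper T k delta y -> V y = fpol T k l p y) ->
    (forall y, lower T k delta y -> V y = fpol T k l p' y) ->
    \int[leb2]_(y in upper T k delta `|` lower T k delta) (V y * laplacian phi y) = p a 1%N - p' a 1%N.
  move=> Vp Vp'; rewrite Rintegral_setU //; last first.
    apply: integrable_setU => //.
      have := iu p; apply: eq_integrable => // y /set_mem Sy.
      by rewrite /= Vp.
    have := il p'; apply: eq_integrable => // y /set_mem Sy.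
    by rewrite /= Vp'.
  rewrite -(pair p).1 -[- p' a 1%N](pair p').2; congr (_ + _).
    by apply: eq_Rintegral => y /set_mem Sy; rewrite Vp.
  by apply: eq_Rintegral => y /set_mem Sy; rewrite Vp'.
have mean : \int[leb2]_(y in upper T k delta `|` lower T k delta) laplacian phi y = 0.
  have := @split_int (fun=> 1) _ _ (fun y _ => esym (fpol1 T k l y)) (fun y _ => esym (fpol1 T k l y)).
  by rewrite subrr => <-; apply: eq_Rintegral => y _; rewrite mul1r.
rewrite -(split_int U c c') //.
(* the edge itself separates the two halves of the strip *)
pose Nl := region T k `[1 / 4, 3 / 4]%classic `[0, 0]%classic.
apply: (residual_le (Nl := Nl) oO bO th ws cU tphi) => //.
- by move=> j; rewrite /phi /tens chi0 ?mul0r.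
- exact: measurableU.
- exact: subset_trans RO.
- exact: measurable_region.
- have := rect_measure k D0 (measurable_itv `[1 / 4 : R, 3 / 4]) (measurable_itv `[0 : R, 0]).
  have -> : mu `[0 : R, 0]%classic = 0%E by rewrite set_itv1 lebesgue_measure_set1.
  by rewrite mule0 mule0.
- by move=> y [] [_ +] [_]; rewrite /= !in_itv /= => h1 h2; move: h1 h2; lra.
- move=> y nS nN; apply: (laplacian_tens_out D0 tchi tg); apply/negP => /andP[h1 h2].
  have [t0|t0|t0] := ltgtP (ft T k y) 0.
  + by apply: nS; right; split; rewrite /= in_itv /=; move: h1 h2 d0; lra.
  + by apply: nS; left; split; rewrite /= in_itv /=; move: h1 h2 d0; lra.
  + by apply: nN; split; rewrite /= in_itv /=; move: h1 h2 d0; lra.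
- by rewrite divr_gt0.
- by apply: lap_le => //; [exact: tchi.1|exact: tg.1].
- by rewrite sqrtr_gt0.
- exact: (strip_diameter D0 SR).
Qed.

End local_residuals.

(** * Scaling of the estimator *)

Section scaled_terms.
Context {R : realType}.
Local Notation mu := (@lebesgue_measure R).
Local Notation leb2 := (mu \x mu)%E.
Local Notation RR := (measurableTypeR R * measurableTypeR R)%type.
Implicit Types (T : triangle R) (k : 'I_3).

Lemma res_constE (C theta r : R) : 0 < r ->
  res_const C theta r = C ^+ 2 * Num.sqrt r `^ (- (2 * theta)).
Proof.
move=> r0; rewrite /res_const; have q0 : 0 < Num.sqrt r by rewrite sqrtr_gt0.
have -> : 2 + 2 * (1 - theta) = 4%:R + - (2 * theta) by ring.
rewrite powRD; last by rewrite (gt_eqF q0) implybT.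
rewrite powR_mulrn ?ltW //.
have -> : Num.sqrt r ^+ 4 = r ^+ 2 by rewrite -{2}(sqr_sqrtr (ltW r0)) -exprM.
by rewrite mulrA expr_div_n divfK // expf_neq0 // gt_eqF.
Qed.

(** The powers of the mesh size in the estimator are those for which the
    length of the edge cancels from the final constants. *)
Lemma mesh_scaling (h rho M theta : R) e : 0 < rho -> 0 <= h -> 0 <= M -> h <= M * rho -> 0 < theta ->
  h `^ (e%:R + 2 * theta) * rho `^ (- (2 * theta)) <= M `^ (e%:R + 2 * theta) * rho ^+ e.
Proof.
move=> r0 h0 M0 hM t0.
have p0 : 0 <= e%:R + 2 * theta by rewrite addr_ge0 // mulr_ge0 // ltW.
have H : h `^ (e%:R + 2 * theta) <= (M * rho) `^ (e%:R + 2 * theta).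
  by rewrite ge0_ler_powR ?nnegrE // mulr_ge0 // ltW.
apply: (le_trans (ler_wpM2r (powR_ge0 _ _) H)).
rewrite powRM ?(ltW r0) // -mulrA -powRD; last by rewrite (gt_eqF r0) implybT.
by rewrite addrK powR_mulrn // ltW.
Qed.

(** A bound by an infinite seminorm is trivial, as the constant is positive. *)
Lemma le_mul_ereal (c : R) (X g : \bar R) : 0 < c -> (0 <= g)%E ->
  (forall G : R, 0 <= G -> g = G%:E -> (X <= (c * G)%:E)%E) -> (X <= c%:E * g)%E.
Proof.
move=> c0; case: g => [G|_ _|//]; first by rewrite lee_fin => G0 /(_ G G0 erefl); rewrite EFinM.
by rewrite gt0_muley ?lte_fin // leey.
Qed.

Lemma sqr_le_norm (q B : R) : 0 <= B -> q ^+ 2 <= B -> `|q| <= Num.sqrt B.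
Proof. by move=> B0 qB; rewrite -sqrtr_sqr ler_wsqrtr. Qed.

Section constants.
Variables (l : nat) (theta tau C : R).
Hypotheses (th : 0 < theta) (tau01 : 0 < tau <= 1) (C0 : 0 < C).

(* mesh sizes are at most M times any edge length *)
Let M := 2 / tau.
Let L := tau^-1.
Let n := l.+1.

Let tau0 : 0 < tau. Proof. by case/andP: tau01. Qed.
Let M0 : 0 < M. Proof. by rewrite /M divr_gt0. Qed.
Let L1 : 1 <= L. Proof. by rewrite /L invf_ge1 //; case/andP: tau01. Qed.

(** The powers of 1/tau come from evaluating monomials on the whole triangle,
    which in the frame of an edge is only contained in a square of side 2/tau. *)
Definition el_const : R :=
  M `^ (2%:R + 2 * theta) * M ^+ 2 * (n%:R * n%:R * (L ^+ n * L ^+ n)) ^+ 2 * C ^+ 2.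
Definition ed_const : R := M `^ (1%:R + 2 * theta) * n%:R ^+ 2 * C ^+ 2.

Lemma el_const_gt0 : 0 < el_const.
Proof.
have L0 : 0 < L by rewrite invr_gt0.
rewrite /el_const mulr_gt0 ?exprn_gt0 // mulr_gt0 //; first by rewrite mulr_gt0 ?powR_gt0 ?exprn_gt0.
by rewrite exprn_gt0 // !mulr_gt0 // exprn_gt0.
Qed.

Lemma ed_const_gt0 : 0 < ed_const.
Proof. by rewrite /ed_const !mulr_gt0 ?powR_gt0 ?exprn_gt0. Qed.

Lemma element_term_le T k c (g : \bar R) : tri_det T != 0 -> fat tau T -> (0 <= g)%E ->
  (forall a b, (a <= l)%N -> (b <= l)%N ->
    (((lap_coef l c a b) ^+ 2)%:E <= (res_const C theta (dot (fd T k) (fd T k)))%:E * g)%E) ->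
  ((mesh_size T `^ (2 + 2 * theta))%:E * L2sq (tri_set T) (laplacian (fpol T k l c)) <= el_const%:E * g)%E.
Proof.
move=> D0 fT g0 H; apply: le_mul_ereal => //; first exact: el_const_gt0.
move=> G G0 gE; rewrite gE in H.
have r0 := fd_gt0 k D0; set r := dot _ _ in H r0.
pose rho := Num.sqrt r; have rho0 : 0 < rho by rewrite sqrtr_gt0.
have rhoE : rho ^+ 2 = r by rewrite sqr_sqrtr ?ltW.
have hM : mesh_size T <= M * rho := mesh_size_le k tau01 D0 fT.
set h := mesh_size T in hM *; have h0 : 0 <= h by exact: sqrtr_ge0.
have rc0 : 0 <= res_const C theta r by rewrite mulr_ge0 ?sqr_ge0 ?powR_ge0.
pose B := res_const C theta r * G; have B0 : 0 <= B by exact: mulr_ge0.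
pose A := n%:R * n%:R * (L ^+ n * L ^+ n).
have A0 : 0 <= A by rewrite /A !mulr_ge0 ?exprn_ge0 // (le_trans ler01 L1).
have tauL z : tau * z <= 1 -> z <= L by rewrite -ler_pdivlMl // mulr1.
have ptw y : tri_set T y -> (laplacian (fpol T k l c) y) ^+ 2 <= (r^-1) ^+ 2 * (A ^+ 2 * B).
  move=> Ty; rewrite laplacian_fpol // -/r exprMn ler_wpM2l ?sqr_ge0 //.
  have [hs ht] := fat_tri_set k D0 tau01 fT Ty.
  have := @norm_pol2_le R n (lap_coef l c) (Num.sqrt B) L (fs T k y) (ft T k y) L1.
  move=> /(_ (tauL _ hs) (tauL _ ht) (sqrtr_ge0 _)) bnd.
  have /bnd {}bnd : forall a b, (a < n)%N -> (b < n)%N -> `|lap_coef l c a b| <= Num.sqrt B.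
    by move=> a b al bl; apply: sqr_le_norm => //; have := H a b al bl; rewrite -EFinM lee_fin.
  rewrite -real_normK ?num_real //.
  have -> : A ^+ 2 * B = (A * Num.sqrt B) ^+ 2 by rewrite [RHS]exprMn sqr_sqrtr.
  rewrite lerXn2r ?nnegrE ?(mulr_ge0 A0 (sqrtr_ge0 B)) //.
  apply: (le_trans bnd); rewrite /A; move: (Num.sqrt B) (L ^+ n) => q w.
  by rewrite [leLHS](_ : _ = n%:R * n%:R * (w * w) * q) //; ring.
have mT := measurable_tri_set D0.
have Tfin : leb2 (tri_set T : set RR) = (h ^+ 2)%:E.
  rewrite /h /mesh_size sqr_sqrtr ?fine_ge0 // fineK // ge0_fin_numE //.
  have sub : tri_set T `<=` region T k `[- L, L]%classic `[- L, L]%classic.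
    move=> y /(fat_tri_set k D0 tau01 fT) [hs ht]; by split; rewrite /= in_itv /= -ler_norml; exact: tauL.
  apply: le_lt_trans (region_measure_lty k (- L) L (- L) L true false true false D0).
  have mR : measurable (region T k `[- L, L]%classic `[- L, L]%classic : set RR) by exact: measurable_region.
  exact: (le_measure leb2 (mem_set mT) (mem_set mR) sub).
have L2 : (L2sq (tri_set T) (laplacian (fpol T k l c)) <= ((r^-1) ^+ 2 * (A ^+ 2 * B) * h ^+ 2)%:E)%E.
  have c0 : 0 <= (r^-1) ^+ 2 * (A ^+ 2 * B) by exact: mulr_ge0 (sqr_ge0 _) (mulr_ge0 (sqr_ge0 _) B0).
  rewrite EFinM -Tfin -integral_cst //; apply: ge0_le_integral_any => //.
  by move=> y _; rewrite lee_fin sqr_ge0.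
apply: (@le_trans _ _ ((h `^ (2 + 2 * theta))%:E * ((r^-1) ^+ 2 * (A ^+ 2 * B) * h ^+ 2)%:E)%E).
  by apply: lee_wpmul2l => //; rewrite lee_fin powR_ge0.
rewrite -EFinM lee_fin /B (res_constE _ _ r0) -/rho.
have sc := mesh_scaling 2 rho0 h0 (ltW M0) hM th; rewrite rhoE in sc.
have h2 : h ^+ 2 <= M ^+ 2 * r by rewrite -rhoE -exprMn lerXn2r ?nnegrE // (le_trans h0).
set X := h `^ _ in sc *; set Y := rho `^ _ in sc *; set Z := M `^ _ in sc.
have XY0 : 0 <= X * Y by rewrite mulr_ge0 ?powR_ge0.
have step : X * Y * h ^+ 2 <= Z * r * (M ^+ 2 * r) by rewrite ler_pM ?sqr_ge0.
rewrite (_ : X * _ = X * Y * h ^+ 2 * ((r^-1) ^+ 2 * A ^+ 2 * C ^+ 2 * G)); last by ring.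
rewrite (_ : el_const * G = Z * r * (M ^+ 2 * r) * ((r^-1) ^+ 2 * A ^+ 2 * C ^+ 2 * G)).
  apply: ler_wpM2r step.
  exact: mulr_ge0 (mulr_ge0 (mulr_ge0 (sqr_ge0 _) (sqr_ge0 _)) (sqr_ge0 _)) G0.
have -> : el_const = Z * M ^+ 2 * A ^+ 2 * C ^+ 2 by [].
by field; rewrite gt_eqF.
Qed.

Lemma edge_term_le T k (J : R * R -> R) (d : nat -> R) (g : \bar R) :
  tri_det T != 0 -> fat tau T -> (0 <= g)%E ->
  (forall y, 0 <= fs T k y <= 1 -> ft T k y = 0 ->
    J y = - (Num.sqrt (dot (fd T k) (fd T k)))^-1 * \sum_(a < n) d a * fs T k y ^+ a) ->
  (forall a, (a <= l)%N ->
    ((d a ^+ 2)%:E <= (res_const C theta (dot (fd T k) (fd T k)))%:E * g)%E) ->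
  ((mesh_size T `^ (1 + 2 * theta))%:E * edge_integral T k (fun y => (J y) ^+ 2)%R <= ed_const%:E * g)%E.
Proof.
move=> D0 fT g0 JE H; apply: le_mul_ereal => //; first exact: ed_const_gt0.
move=> G G0 gE; rewrite gE in H.
have r0 := fd_gt0 k D0; set r := dot _ _ in H r0 JE.
pose rho := Num.sqrt r; have rho0 : 0 < rho by rewrite sqrtr_gt0.
have hM : mesh_size T <= M * rho := mesh_size_le k tau01 D0 fT.
set h := mesh_size T in hM *; have h0 : 0 <= h by exact: sqrtr_ge0.
have rc0 : 0 <= res_const C theta r by rewrite mulr_ge0 ?sqr_ge0 ?powR_ge0.
pose B := res_const C theta r * G; have B0 : 0 <= B by exact: mulr_ge0.
have ptw s : 0 <= s <= 1 -> J ((1 - s) *: T (k + 1) + s *: T (k + 2)) ^+ 2 <= (rho^-1) ^+ 2 * (n%:R ^+ 2 * B).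
  move=> s01; set y := _ + _.
  have yE : y = aff (T (k + 1)) (fd T k) (fe T k) (s, 0).
    rewrite /y /aff /fd; apply/pair_equal_spec; split; rewrite /= /GRing.scale /=; ring.
  have := inv_frameK (T (k + 1)) (fd_fe T k) (fe_fe k D0) (fd_gt0 k D0) (s, 0); rewrite -yE => -[e1 e2].
  have fsy : fs T k y = s by [].
  have fty : ft T k y = 0 by [].
  rewrite JE ?fsy // exprMn sqrrN ler_wpM2l ?sqr_ge0 //.
  have := @norm_pol1_le R n d (Num.sqrt B) s.
  have s1 : `|s| <= 1 by rewrite ger0_norm; case/andP: s01.
  move=> /(_ s1 (sqrtr_ge0 _)) bnd.
  have /bnd {}bnd : forall a, (a < n)%N -> `|d a| <= Num.sqrt B.
    by move=> a al; apply: sqr_le_norm => //; have := H a al; rewrite -EFinM lee_fin.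
  rewrite -real_normK ?num_real //.
  have -> : n%:R ^+ 2 * B = (n%:R * Num.sqrt B) ^+ 2 by rewrite [RHS]exprMn sqr_sqrtr.
  by rewrite lerXn2r ?nnegrE ?mulr_ge0 ?sqrtr_ge0.
have c0 : 0 <= (rho^-1) ^+ 2 * (n%:R ^+ 2 * B) by exact: mulr_ge0 (sqr_ge0 _) (mulr_ge0 (sqr_ge0 _) B0).
have I1 : (\int[mu]_(s in `[0%R, 1%R]) ((J ((1 - s) *: T (k + 1) + s *: T (k + 2))) ^+ 2)%:E <=
    ((rho^-1) ^+ 2 * (n%:R ^+ 2 * B))%:E)%E.
  have -> : ((rho^-1) ^+ 2 * (n%:R ^+ 2 * B))%:E =
      (\int[mu]_(s in `[0%R, 1%R]) (((rho^-1) ^+ 2 * (n%:R ^+ 2 * B))%:E))%E.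
    have m1 : mu `[0 : R, 1 : R]%classic = 1%E.
      by rewrite lebesgue_measure_itv /= lte_fin ltr01 oppr0 adde0.
    by rewrite integral_cst // [X in (_ * X)%E]m1 mule1.
  apply: ge0_le_integral_any => //.
  by move=> y _; rewrite lee_fin sqr_ge0.
have el : edge_length T k = rho by [].
apply: (@le_trans _ _ ((h `^ (1 + 2 * theta))%:E * (rho%:E * ((rho^-1) ^+ 2 * (n%:R ^+ 2 * B))%:E))%E).
  apply: lee_wpmul2l; first by rewrite lee_fin powR_ge0.
  by rewrite /edge_integral el; apply: lee_wpmul2l => //; rewrite lee_fin ltW.
rewrite -!EFinM lee_fin /B (res_constE _ _ r0) -/rho.
have sc := mesh_scaling 1 rho0 h0 (ltW M0) hM th; rewrite expr1 in sc.
set X := h `^ _ in sc *; set Y := rho `^ _ in sc *; set Z := M `^ _ in sc.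
rewrite (_ : X * _ = X * Y * (rho * (rho^-1) ^+ 2 * n%:R ^+ 2 * C ^+ 2 * G)); last by ring.
rewrite (_ : ed_const * G = Z * rho * (rho * (rho^-1) ^+ 2 * n%:R ^+ 2 * C ^+ 2 * G)).
  apply: ler_wpM2r sc; apply: (mulr_ge0 _ G0); apply: (mulr_ge0 _ (sqr_ge0 _)).
  by apply: (mulr_ge0 _ (sqr_ge0 _)); exact: mulr_ge0 (ltW rho0) (sqr_ge0 _).
have -> : ed_const = Z * n%:R ^+ 2 * C ^+ 2 by [].
by field; rewrite gt_eqF.
Qed.

End constants.
End scaled_terms.

(** * Strips along the edges *)

Section strips.
Context {R : realType}.
Local Notation RR := (measurableTypeR R * measurableTypeR R)%type.
Variables (Om : set (R * R)) (m : nat) (K : 'I_m -> triangle R).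
Hypotheses (oO : open Om) (lO : lipschitz_boundary Om) (cK : conforming_triangulation Om K).

Let tau := fatness (shape_coef K).
Let delta := tau / 16.

Let D0 i : tri_det (K i) != 0. Proof. exact: conforming_det cK i. Qed.
Let tau01 : 0 < tau <= 1. Proof. exact/fatness_bounds/shape_coef_bounds. Qed.
Let tau0 : 0 < tau. Proof. by case/andP: tau01. Qed.
Let d0 : 0 < delta. Proof. by rewrite /delta divr_gt0. Qed.
Let fT i : fat tau (K i). Proof. exact: fat_shape. Qed.

(** The same choice as in the definition of the jump. *)
Definition neighbor i k : option ('I_m * 'I_3) :=
  [pick jk : 'I_m * 'I_3 | (jk.1 != i) && `[< edge (K i) k = edge (K jk.1) jk.2 >]].

(** On a boundary edge the jump is zero by definition, and the half of the strip
    in the triangle suffices. *)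
Definition strip delta i k : set (R * R) := upper (K i) k delta `|`
  (if neighbor i k is Some _ then lower (K i) k delta else set0).

Lemma neighborP i k jk : neighbor i k = Some jk ->
  jk.1 != i /\ edge (K i) k = edge (K jk.1) jk.2.
Proof. by rewrite /neighbor; case: pickP => // p /andP[ne /asboolP e] [<-]. Qed.

Section two_triangles.
Variables (i j : 'I_m) (k k' : 'I_3).
Hypotheses (ij : j != i) (eij : edge (K i) k = edge (K j) k').

Lemma neighbor_frames :
  [/\ fe (K j) k' = - fe (K i) k,
      dot (fd (K j) k') (fd (K j) k') = dot (fd (K i) k) (fd (K i) k),
      forall x, ft (K j) k' x = - ft (K i) k x &
      (forall x, fs (K j) k' x = fs (K i) k x) \/ (forall x, fs (K j) k' x = 1 - fs (K i) k x)].
Proof.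
apply: (neighbor_frame tau0 (D0 i) (D0 j) (fT i) (fT j) eij) => x.
by apply: (tri_int_disjoint cK); rewrite eq_sym.
Qed.

Lemma lower_upper y : lower (K i) k delta y -> upper (K j) k' delta y.
Proof.
have [_ _ ftE fsE] := neighbor_frames; move=> [h1 h2]; move: h1 h2; rewrite /= !in_itv /= => h1 h2.
split; rewrite /= in_itv /= ?ftE; last by move: h2; lra.
by case: fsE => ->; move: h1; lra.
Qed.

(** The strip is open, up to a slight enlargement, and covered by the two closed
    triangles; hence it is interior to the closure of the domain. *)
Lemma edge_strip_Om : region (K i) k `[1 / 4, 3 / 4]%classic `[- delta, delta]%classic `<=` Om.
Proof.
pose W := fs (K i) k @^-1` `]1 / 8, 7 / 8[%classic `&` ft (K i) k @^-1` `](- (tau / 8)), tau / 8[%classic.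
have oW : open W.
  have /continuousP c1 : continuous (fs (K i) k) by exact: continuous_coord.
  have /continuousP c2 : continuous (ft (K i) k) by exact: continuous_coord.
  by apply: openI; [apply: c1|apply: c2]; exact: interval_open.
have WO : W `<=` closure Om.
  have [_ _ ftE fsE] := neighbor_frames.
  move=> y [h1 h2]; move: h1 h2; rewrite /= !in_itv /= => h1 h2.
  have [t0|t0|t0] := ltgtP (ft (K i) k y) 0.
  - apply: (tri_set_closure cK (i := j)); apply: tri_int_sub => //.
    apply: (@fat_tri_int _ _ k' (D0 j) tau _ tau0 (fT j)); last by rewrite ftE; move: h2 t0; lra.
    by case: fsE => ->; move: h1; lra.
  - apply: (tri_set_closure cK (i := i)); apply: tri_int_sub => //.
    by apply: (@fat_tri_int _ _ k (D0 i) tau _ tau0 (fT i)) => //; move: h2 t0; lra.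
  - apply: (tri_set_closure cK (i := i)); apply/tri_setE => // k0.
    have [-> | -> | ->] := ord3_cases k k0.
    + by rewrite bary_k // t0 mul0r.
    + by rewrite bary_k1 // t0 !mul0r; move: h1; lra.
    + by rewrite bary_k2 // t0 !mul0r; move: h1; lra.
move=> y [h1 h2]; apply: (lipschitz_interior_closure oO lO).
have := WO; rewrite (open_subsetE _ oW); apply.
move: h1 h2; rewrite /W /= !in_itv /= => h1 h2.
split; first by move: h1; lra.
by move: h2 tau0; rewrite /delta; lra.
Qed.

End two_triangles.

Lemma tri_int_Om i : tri_int (K i) `<=` Om.
Proof.
apply: subset_trans (lipschitz_interior_closure oO lO).
rewrite -open_subsetE; last exact: open_tri_int.
by apply: subset_trans (tri_set_closure cK (i := i)); exact: tri_int_sub.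
Qed.

Lemma upper_tri_int i k : upper (K i) k delta `<=` tri_int (K i).
Proof. exact: (fat_upper tau01 (fT i) (D0 i)). Qed.

Lemma strip_Om i k : strip delta i k `<=` Om.
Proof.
move=> y [/upper_tri_int/tri_int_Om //|].
case E : (neighbor i k) => [[j k']|] // /(lower_upper (neighborP E).1 (neighborP E).2).
by move=> /upper_tri_int/tri_int_Om.
Qed.

Lemma strip_patch i k : strip delta i k `<=` tri_patch K i.
Proof.
move=> y [/upper_tri_int h|].
  by exists i; [left|exact: tri_int_sub].
case E : (neighbor i k) => [[j k']|] // h; have [ne e] := neighborP E; exists j.
  by right; exists k, k'.
by apply: tri_int_sub => //; exact: upper_tri_int (lower_upper ne e h).
Qed.

Lemma measurable_strip i k : measurable (strip delta i k : set RR).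
Proof.
have mu1 : measurable (upper (K i) k delta : set RR) by exact: measurable_region.
have ml1 : measurable (lower (K i) k delta : set RR) by exact: measurable_region.
by rewrite /strip; apply: measurableU => //; case: neighbor.
Qed.

Lemma upper_nonempty i k : exists y, upper (K i) k delta y.
Proof.
pose y := aff (K i (k + 1)) (fd (K i) k) (fe (K i) k) (1 / 2, delta).
have [e1 e2] := inv_frameK (K i (k + 1)) (fd_fe (K i) k) (fe_fe k (D0 i)) (fd_gt0 k (D0 i)) (1 / 2, delta).
exists y; split; rewrite /= /fs /ft ?e1 ?e2 in_itv /=; first by lra.
by rewrite d0 lexx.
Qed.

(** At the midpoint of an edge both other barycentric coordinates are 1/2. *)
Lemma edge_inj i k k2 : edge (K i) k = edge (K i) k2 -> k = k2.
Proof.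
move=> e; pose y := aff (K i (k + 1)) (fd (K i) k) (fe (K i) k) (1 / 2, 0).
have [e1 e2] := inv_frameK (K i (k + 1)) (fd_fe (K i) k) (fe_fe k (D0 i)) (fd_gt0 k (D0 i)) (1 / 2, 0).
have ey : edge (K i) k y.
  exists (1 / 2); first by lra.
  by apply: injective_projections; rewrite /= /fd /GRing.scale /=; field.
have b2 : bary (K i) k2 y = 0 by apply: edge_bary => //; rewrite -e.
have fsy : fs (K i) k y = 1 / 2 by [].
have fty : ft (K i) k y = 0 by [].
have [kk|kk|kk] := ord3_cases k k2; first by [].
  by exfalso; move: b2; rewrite kk bary_k1 // fsy fty !mul0r; lra.
by exfalso; move: b2; rewrite kk bary_k2 // fsy fty !mul0r; lra.
Qed.

(** Two triangles on the same side of a common edge overlap, so an edge has at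
    most one neighbour on each side. *)
Lemma common_neighbor i i2 j k k2 k' : j != i -> j != i2 ->
  edge (K i) k = edge (K j) k' -> edge (K i2) k2 = edge (K j) k' -> (i, k) = (i2, k2).
Proof.
move=> ji ji2 e e2; have [ii|ne] := eqVneq i i2.
  by move: e2; rewrite -ii -e => /esym/edge_inj ->.
have [_ _ t1 s1] := neighbor_frames ji e; have [_ _ t2 s2] := neighbor_frames ji2 e2.
have [y hy] := upper_nonempty i k; have hi := upper_tri_int hy.
have tE : ft (K i2) k2 y = ft (K i) k y by apply: oppr_inj; rewrite -t1 -t2.
have : upper (K i2) k2 delta y.
  move: hy => [h1 h2]; split; last by rewrite /= tE.
  move: h1; rewrite /= !in_itv /=.
  by case: s1 => /(_ y) q1; case: s2 => /(_ y) q2; move: q1 q2; lra.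
move=> /upper_tri_int/(tri_int_sub (D0 i2)) h2.
by case: (tri_int_disjoint cK ne hi h2).
Qed.

Lemma sum_indic_le3 (I : finType) (S : I -> set (R * R)) (f : I -> 'I_3) (y : R * R) :
  (forall p q, S p y -> S q y -> f p = f q -> p = q) -> \sum_p \1_(S p) y <= 3%:R :> R.
Proof.
move=> inj; have -> : \sum_p \1_(S p) y = \sum_(p | y \in S p) (1 : R).
  by rewrite [RHS]big_mkcond; apply: eq_bigr => p _; rewrite indicE; case: (_ \in _).
rewrite sumr_const ler_nat -[X in (_ <= X)%N](card_ord 3).
rewrite -(@card_in_image _ _ f [pred p | y \in S p]); first exact: max_card.
by move=> p q /set_mem Sp /set_mem Sq; exact: inj.
Qed.

(** A point lies in the interior of at most one triangle. That triangle
    determines the strips of which it contains the upper half, up to the choice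
    of one of its three edges, and likewise those of which it contains the lower
    half. *)
Lemma strip_overlap y : \sum_(p : 'I_m * 'I_3) \1_(strip delta p.1 p.2) y <= 6%:R :> R.
Proof.
pose A (p : 'I_m * 'I_3) := upper (K p.1) p.2 delta.
pose B (p : 'I_m * 'I_3) : set (R * R) := if neighbor p.1 p.2 is Some _ then lower (K p.1) p.2 delta else set0.
pose f (p : 'I_m * 'I_3) := if neighbor p.1 p.2 is Some jk then jk.2 else ord0.
have le : \sum_p \1_(strip delta p.1 p.2) y <= \sum_p (\1_(A p) y + \1_(B p) y : R).
  apply: ler_sum => p _; rewrite !indicE -/(A p) /strip -/(B p) in_setU.
  by case: (_ \in A p); case: (_ \in B p); rewrite ?addr0 ?add0r //= lerDl.
apply: (le_trans le); rewrite big_split /=.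
have -> : 6%:R = 3%:R + 3%:R :> R by rewrite -natrD.
apply: lerD; first apply: (@sum_indic_le3 _ A (fun p => p.2)).
  move=> [i k] [i2 k2] /upper_tri_int h /upper_tri_int h2 /= ->; congr pair.
  apply: contrapT => /eqP ne; exact: (tri_int_disjoint cK ne h (tri_int_sub (D0 i2) h2)).
apply: (@sum_indic_le3 _ B f) => -[i k] [i2 k2]; rewrite /B /f /=.
case E : (neighbor i k) => [[j k']|] //; case E2 : (neighbor i2 k2) => [[j2 k2']|] //= h h2 kk.
have [ne e] := neighborP E; have [ne2 e2] := neighborP E2; move: ne e ne2 e2 => /= ne e ne2 e2.
have hj := upper_tri_int (lower_upper ne e h); have hj2 := upper_tri_int (lower_upper ne2 e2 h2).
have jj : j = j2.
  apply: contrapT => /eqP nj; exact: (tri_int_disjoint cK nj hj (tri_int_sub (D0 j2) hj2)).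
by apply: (common_neighbor ne _ e); rewrite ?jj // kk.
Qed.

End strips.

(** * The lower bounds *)

Section estimator.
Context {R : realType}.

Lemma hseminorm0E (t : R) (G : set (R * R)) f : hseminorm 0 t G f = (gagliardo t G f `^ 2^-1)%E.
Proof. by rewrite /hseminorm big_ord_recl big_ord0 adde0. Qed.

Lemma local_polyP Om m (K : 'I_m -> triangle R) l U i : fe_space Om K l U ->
  poly2 l (local_poly l U (K i)) /\ forall x, tri_set (K i) x -> U x = local_poly l U (K i) x.
Proof.
by move=> [_ _ /(_ i) H]; exact: (xgetPex (fun=> 0) H).
Qed.

Lemma ge0_mulr_suml (I : finType) (c : R) (F : I -> \bar R) : (forall i, 0 <= F i)%E ->
  (c%:E * \sum_i F i = \sum_i c%:E * F i)%E.
Proof. by move=> F0; rewrite ge0_sume_distrr. Qed.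

Lemma poweR_half_le (c : R) (X Y : \bar R) : 0 <= c -> (0 <= X)%E -> (0 <= Y)%E ->
  (X <= c%:E * Y)%E -> (X `^ 2^-1 <= (c `^ 2^-1)%:E * Y `^ 2^-1)%E.
Proof.
move=> c0 X0 Y0 XY; rewrite -poweR_EFin -poweRM ?lee_fin //.
have h0 : 0 <= 2^-1 :> R by rewrite invr_ge0.
by apply: (gt0_ler_poweR h0) => //; rewrite in_itv /= leey andbT // mule_ge0 ?lee_fin.
Qed.

Lemma grad_fpol T k l c y (q : R) : tri_det T != 0 -> (0 < l)%N -> ft T k y = 0 ->
  dot (grad (fpol T k l c) y) (q *: fe T k) = q * \sum_(a < l.+1) c a 1%N * fs T k y ^+ a.
Proof.
move=> D0 l0 ty.
exact: (grad_frame_pol (fd_fe T k) (fe_fe k D0) (fd_gt0 k D0) c q _ ty).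
Qed.

(** In the frame of one triangle both normal derivatives are read off the
    coefficients of degree 1 in t, and the opposite outer normals make their
    difference appear. *)
Lemma jump_fpol Om m (K : 'I_m -> triangle R) l U i k j k' c c' y :
  conforming_triangulation Om K -> (0 < l)%N -> neighbor K i k = Some (j, k') ->
  local_poly l U (K i) = fpol (K i) k l c -> local_poly l U (K j) = fpol (K i) k l c' ->
  ft (K i) k y = 0 ->
  jump K l U i k y = - (Num.sqrt (dot (fd (K i) k) (fd (K i) k)))^-1 *
    \sum_(a < l.+1) (c a 1%N - c' a 1%N) * fs (K i) k y ^+ a.
Proof.
move=> cK l0 nE pE pE' ty; have D0 := conforming_det cK i.
have [ne e] := neighborP nE; have [feE fdE _ _] := neighbor_frames cK ne e.
rewrite /jump -/(neighbor K i k) nE pE pE' !outer_normalE feE /enorm fdE.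
rewrite scalerN -scaleNr opprK !grad_fpol //.
have -> : \sum_(a < l.+1) (c a 1%N - c' a 1%N) * fs (K i) k y ^+ a =
    \sum_(a < l.+1) c a 1%N * fs (K i) k y ^+ a - \sum_(a < l.+1) c' a 1%N * fs (K i) k y ^+ a.
  by rewrite -sumrB; apply: eq_bigr => a _; rewrite mulrBl.
by rewrite mulrBr !mulNr opprK.
Qed.

Lemma jump_boundary m (K : 'I_m -> triangle R) l U i k y : neighbor K i k = None ->
  jump K l U i k y = 0.
Proof. by move=> nE; rewrite /jump -/(neighbor K i k) nE. Qed.

(** The constant is chosen before the domain and the mesh: it depends
    on theta and on the test functions, which are fixed by l, N and the fatness. *)
Lemma eta_sq_le (theta sigma : R) (l N : nat) : exists c : R, 0 < c /\
  forall (Om : set (R * R)) (alpha : 'I_N -> R) (x : 'I_N -> R * R) (m : nat)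
    (K : 'I_m -> triangle R) (u U : R * R -> R),
  0 < theta < 2^-1 -> (0 < l)%N -> polygonal_domain Om ->
  weak_solution Om alpha x u -> conforming_triangulation Om K -> fe_space Om K l U ->
  shape_coef K = sigma -> forall i,
  (eta_sq K l theta U i <= c%:E *
    \sum_(k < 3) gagliardo (1 - theta) (strip K (fatness (shape_coef K) / 16) i k) (u \- U)%R)%E.
Proof.
have [|ns] := boolP (0 < sigma <= pi); last first.
  exists 1; split=> // Om alpha x m K u U th l0 pO ws cK fU sE i; exfalso; apply: (negP ns).
  by rewrite -sE; apply: shape_coef_bounds => j; exact: conforming_det cK j.
move=> /fatness_bounds; set tau := fatness sigma => tau01.
have d0 : 0 < tau / 16 by rewrite divr_gt0 //; case/andP: tau01.
have [chi [xi [g [C [C0 Hchi Hxi Hg HC]]]]] := test_families N l d0.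
have [el0 ed0] : 0 < el_const l theta tau C /\ 0 < ed_const l theta tau C.
  by split; [exact: el_const_gt0|exact: ed_const_gt0].
exists (el_const l theta tau C + ed_const l theta tau C); split; first exact: addr_gt0.
move=> Om alpha x m K u U th l0 [oO _ _ bO [_ lO]] ws cK fU sE i.
have [cU _ _] := fU; have D0 j := conforming_det cK j.
have fT j : fat tau (K j) by rewrite /tau -sE; exact: fat_shape.
have th0 : 0 < theta by case/andP: th.
rewrite sE -/tau; set t := 1 - theta.
set S := strip K (tau / 16) i.
have upS k : upper (K i) k (tau / 16) `<=` S k by move=> y; left.
have upT j k : upper (K j) k (tau / 16) `<=` tri_set (K j).
  by apply: subset_trans (tri_int_sub (D0 j)); exact: fat_upper.
have [pi_poly piE] := local_polyP i fU.
have gS0 k : (0 <= gagliardo t (S k) (u \- U)%R)%E by exact: gagliardo_ge0.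
have element : ((mesh_size (K i) `^ (2 + 2 * theta))%:E *
     L2sq (tri_set (K i)) (laplacian (local_poly l U (K i))) <=
     (el_const l theta tau C)%:E * \sum_(k < 3) gagliardo t (S k) (u \- U)%R)%E.
  have [c cE] := poly2_fpol ord0 (D0 i) pi_poly; rewrite cE.
  apply: (@le_trans _ _ ((el_const l theta tau C)%:E *
     gagliardo t (upper (K i) ord0 (tau / 16)) (u \- U)%R)%E).
    apply: (element_term_le th0 tau01 C0 (D0 i) (fT i)); first exact: gagliardo_ge0.
    move=> a b al bl.
    apply: (element_residual oO bO th ws cU tau01 C0 Hchi Hxi HC (D0 i) (fT i)) => //.
      exact: (tri_int_Om oO lO cK).
    by move=> y Sy; rewrite -cE; exact: piE _ (upT i ord0 _ Sy).
  apply: lee_wpmul2l; first by rewrite lee_fin ltW.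
  apply: (le_trans (le_gagliardo t _ (upS ord0))).
  by rewrite (bigD1 ord0) //= leeDl // sume_ge0.
have edges k : ((mesh_size (K i) `^ (1 + 2 * theta))%:E *
     edge_integral (K i) k (fun y => (jump K l U i k y) ^+ 2)%R <=
     (ed_const l theta tau C)%:E * gagliardo t (S k) (u \- U)%R)%E.
  case nE : (neighbor K i k) => [[j k']|].
    have [ne e] := neighborP nE; have [pj_poly pjE] := local_polyP j fU.
    have [c cE] := poly2_fpol k (D0 i) pi_poly; have [c' cE'] := poly2_fpol k (D0 i) pj_poly.
    apply: (edge_term_le (d := fun a => c a 1%N - c' a 1%N) th0 tau01 C0 (D0 i) (fT i) (gS0 k)
      (fun y _ ty => jump_fpol cK l0 nE cE cE' ty)) => a al.
    have SE : S k = upper (K i) k (tau / 16) `|` lower (K i) k (tau / 16) by rewrite /S /strip nE.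
    rewrite SE; apply: (edge_residual (c := c) (c' := c') oO bO th ws cU tau01 l0 C0 Hchi Hg HC (D0 i)) => //.
    - by have := edge_strip_Om oO lO cK ne e; rewrite sE.
    - by move=> y Sy; rewrite -cE; exact: piE _ (upT i k _ Sy).
    - move=> y Sy; rewrite -cE'; apply: pjE; apply: (upT j k').
      by have := lower_upper cK ne e; rewrite sE; apply.
  apply: (@edge_term_le R l theta tau C th0 tau01 C0 _ k _ (fun=> 0) _ (D0 i) (fT i) (gS0 k)).
    move=> y _ _; rewrite (jump_boundary _ _ _ nE) big1 ?mulr0 // => a _.
    by rewrite mul0r.
  move=> a _; rewrite [X in X%:E](_ : _ = 0); last by rewrite expr0n.
  by apply: mule_ge0 => //; rewrite lee_fin mulr_ge0 ?sqr_ge0 ?powR_ge0.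
rewrite EFinD ge0_muleDl ?lee_fin ?(ltW el0) ?(ltW ed0) //.
rewrite /eta_sq; cbv zeta; apply: leeD; first exact: element.
rewrite !ge0_mulr_suml //; first by apply: lee_sum => k _; exact: edges.
move=> k; apply: mule_ge0; first by rewrite lee_fin sqrtr_ge0.
by apply: integral_ge0 => y _; rewrite lee_fin sqr_ge0.
Qed.

Lemma eta_sq_ge0 m (K : 'I_m -> triangle R) l (theta : R) U i : (0 <= eta_sq K l theta U i)%E.
Proof.
have i0 d (X : measurableType d) (nu : {measure set X -> \bar R}) (A : set X) (f : X -> R) :
    (0 <= \int[nu]_(y in A) ((f y) ^+ 2)%:E)%E.
  by apply: integral_ge0 => y _; rewrite lee_fin sqr_ge0.
apply: adde_ge0; apply: mule_ge0; rewrite ?lee_fin ?powR_ge0 //; first exact: i0.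
by apply: sume_ge0 => k _; apply: mule_ge0; [rewrite lee_fin sqrtr_ge0|exact: i0].
Qed.

End estimator.

Theorem theorem3p6 (R : realType) :
  exists C_L Ct_L : R -> nat -> R -> nat -> R,
  forall (theta : R) (Om : set (R * R)) (N : nat) (alpha : 'I_N -> R)
    (x : 'I_N -> R * R) (m : nat) (K : 'I_m -> triangle R) (l : nat)
    (u U : R * R -> R),
  0 < theta < 2^-1 ->
  (0 < N)%N ->
  (0 < l)%N ->
  polygonal_domain Om ->
  (forall j, Om (x j)) ->
  weak_solution Om alpha x u ->
  conforming_triangulation Om K ->
  galerkin Om alpha x K l U ->
  (forall i : 'I_m,
     (eta_loc K l theta U i <=
        (C_L theta l (shape_coef K) N)%:E
        * hseminorm 0 (1 - theta) (tri_patch K i) (u \- U)%R)%E) /\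
  (eta_glob K l theta U <=
     (Ct_L theta l (shape_coef K) N)%:E
     * hseminorm 0 (1 - theta) Om (u \- U)%R)%E.
Proof.
have [F HF] := boolp.choice (fun p : R * R * nat * nat => eta_sq_le p.1.1.1 p.1.1.2 p.1.2 p.2).
pose c theta l sigma N := F (theta, sigma, l, N).
exists (fun theta l sigma N => (c theta l sigma N * 3%:R) `^ 2^-1).
exists (fun theta l sigma N => (c theta l sigma N * 6%:R) `^ 2^-1).
move=> theta Om N alpha x m K l u U th N0 l0 pO xO ws cK [fU _].
have [c0 Hc] := HF (theta, shape_coef K, l, N).
have {}Hc i := Hc Om alpha x m K u U th l0 pO ws cK fU erefl i.
rewrite -/(c theta l (shape_coef K) N) in c0 Hc *; set c1 := c _ _ _ _ in c0 Hc *.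
have [oO _ _ bO [_ lO]] := pO.
rewrite hseminorm0E; set w := (u \- U)%R; set t := 1 - theta.
have g0 G : (0 <= gagliardo t G w)%E by exact: gagliardo_ge0.
split=> [i|].
  rewrite hseminorm0E; apply: poweR_half_le => //; first by rewrite mulr_ge0 // ltW.
    exact: eta_sq_ge0.
  apply: (le_trans (Hc i)); rewrite EFinM -muleA; apply: lee_wpmul2l; first by rewrite lee_fin ltW.
  apply: (@le_trans _ _ (\sum_(k < 3) gagliardo t (tri_patch K i) w)%E).
    by apply: lee_sum => k _; apply: le_gagliardo; exact: (strip_patch cK).
  by rewrite mule_natl !big_ord_recl big_ord0 adde0.
apply: poweR_half_le => //; first by rewrite mulr_ge0 // ltW.
  by apply: sume_ge0 => i _; exact: eta_sq_ge0.
apply: (@le_trans _ _ (\sum_(i < m) c1%:E * \sum_(k < 3) gagliardo t (strip K (fatness (shape_coef K) / 16) i k) w)%E).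
  by apply: lee_sum => i _; exact: Hc.
rewrite -ge0_mulr_suml; last by move=> i; apply: sume_ge0.
rewrite EFinM -muleA; apply: lee_wpmul2l; first by rewrite lee_fin ltW.
rewrite pair_big /=.
have mw : measurable_fun (Om : set (measurableTypeR R * measurableTypeR R)) (w : (measurableTypeR R * measurableTypeR R)%type -> R).
  have [[mu_u _] _] := ws _ th; have [cU _ _] := fU.
  by apply: measurable_funB => //; exact: within_measurable.
apply: (sum_gagliardo_le t (open_measurable2 oO) mw (S := fun p : 'I_m * 'I_3 => strip K (fatness (shape_coef K) / 16) p.1 p.2)).
- by move=> p; exact: measurable_strip.
- by move=> p; exact: (strip_Om oO lO cK).
- exact: strip_overlap cK.
Qed.
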